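(* Consider the second-order PDE in 4D $$(x_1-x_2)(x_3-x_4)\,u_{12}u_{34}+(x_3-x_1)(x_2-x_4)\,u_{13}u_{24}+(x_2-x_3)(x_1-x_4)\,u_{23}u_{14}=0 .$$ (i) The conformal structure $[g]$ defined by its characteristic variety is half-flat on every solution on which the characteristic variety is non-degenerate. (ii) This equation is not contact equivalent to the general heavenly equation $$\alpha\,u_{12}u_{34}+\beta\,u_{13}u_{24}+\gamma\,u_{23}u_{14}=0,\qquad \alpha+\beta+\gamma=0,$$ where $\alpha,\beta,\gamma$ are nonzero constants.
   Context: The setting is local. $u$ is a scalar function of $x=(x_1,\dots,x_4)$ and $u_{\alpha\beta}=\partial_{x_\alpha}\partial_{x_\beta}u$. Conformal structure: for an equation $F(x,u,Du,D^2u)=0$ the characteristic variety is $\sum_{\alpha\le\beta}\frac{\partial F}{\partial u_{\alpha\beta}}p_\alpha p_\beta=0$. On a solution $u$ where this quadratic form is non-degenerate, $[g]$ is the conformal class of $g=g_{\alpha\beta}dx_\alpha dx_\beta$, where $(g_{\alpha\beta})$ is the inverse of the symmetric matrix of the quadratic form evaluated on $u$. Half-flatness: let $W$ be the Weyl tensor of $[g]$ and $W_\pm=\tfrac12(W\pm *W)$ with $*$ the Hodge star operator, $*W^i{}_{jkl}=\tfrac12\sqrt{\det g}\;g^{ia}g^{bc}\epsilon_{ajbd}W^d{}_{ckl}$. The conformal structure is half-flat (self-dual or anti-self-dual) if $W_-=0$ or $W_+=0$. Contact equivalence: two equations are contact equivalent if a (local) contact transformation of the first jet space $J^1M$ with coordinates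 $(x,u,Du)$, prolonged to 2-jets, maps one equation to the other. *)

(* Defs.v *)
From HB Require Import structures.
From mathcomp Require Import all_boot all_order all_algebra.
From mathcomp Require Import all_classical all_reals all_analysis.

Set Implicit Arguments.
Unset Strict Implicit.
Unset Printing Implicit Defensive.

Import Order.TTheory GRing.Theory Num.Theory.
Import numFieldNormedType.Exports.

Local Open Scope classical_set_scope.
Local Open Scope ring_scope.

(** Everything is local and real.  Points of the base are row vectors [x] of
    type ['rV[R]_4]; the coordinate [x_k] of the mathematical notation
    (k = 1, ..., 4) is the entry of index [ix k], that is [k - 1]. *)

Definition ix (k : nat) : 'I_4 := inord k.-1.

(** For finite-dimensional [V] and open [A], differentiability on [A] of all
    iterated directional derivatives (the empty list gives [f] itself) is
    C^infinity smoothness on [A]. *)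
Definition smooth_on (R : realType) (V W : normedModType R) (A : set V)
    (f : V -> W) : Prop :=
  forall (s : seq V) (x : V), A x ->
    differentiable (foldr (fun v h => 'D_v h) f s) x.

Definition pd (R : realType) (i : 'I_4) (f : 'rV[R]_4 -> R) : 'rV[R]_4 -> R :=
  'D_(delta_mx 0 i) f.

(** ** Jets and second-order equations *)

(** The first jet space J^1, with coordinates [(x, u, p)], [p = Du]. *)
Definition jet1 (R : realType) : normedModType R :=
  ('rV[R]_4 * R^o * 'rV[R]_4)%type.

Section Jets.
Variable R : realType.
Implicit Types (z : jet1 R) (H : 'M[R]_4) (u : 'rV[R]_4 -> R).

Definition jx z : 'rV[R]_4 := z.1.1.
Definition jp z : 'rV[R]_4 := z.2.

Definition grad u (x : 'rV[R]_4) : 'rV[R]_4 := \row_i pd i u x.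
Definition hess u (x : 'rV[R]_4) : 'M[R]_4 := \matrix_(i, j) pd i (pd j u) x.
Definition j1 u (x : 'rV[R]_4) : jet1 R := (x, u x, grad u x).

Definition symmetric H : Prop := H^T = H.

(** A second-order equation [F (x, u, Du, D^2 u) = 0]; only the values of [F]
    at symmetric matrices matter. *)
Definition pde := jet1 R -> 'M[R]_4 -> R.

Definition solution (F : pde) (A : set 'rV[R]_4) u : Prop :=
  smooth_on A u /\ forall x, A x -> F (j1 u x) (hess u x) = 0.

(** [dF/du_ab], where [u_ab] and [u_ba] are one and the same coordinate on
    symmetric matrices. *)
Definition sym_delta (a b : 'I_4) : 'M[R]_4 :=
  if a == b then delta_mx a a else delta_mx a b + delta_mx b a.

Definition dF_du (F : pde) z H (a b : 'I_4) : R := 'D_(sym_delta a b) (F z) H.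

(** The symmetric matrix of the quadratic form
    [\sum_(a <= b) dF/du_ab p_a p_b]: off-diagonal coefficients are halved. *)
Definition char_matrix (F : pde) z H : 'M[R]_4 :=
  \matrix_(a, b) (if a == b then dF_du F z H a b else dF_du F z H a b / 2).

Definition char_matrix_on (F : pde) u (x : 'rV[R]_4) : 'M[R]_4 :=
  char_matrix F (j1 u x) (hess u x).

Definition char_nondegenerate (F : pde) (A : set 'rV[R]_4) u : Prop :=
  forall x, A x -> char_matrix_on F u x \in unitmx.

(** The representative [g] of the conformal class. *)
Definition char_metric (F : pde) u (x : 'rV[R]_4) : 'M[R]_4 :=
  invmx (char_matrix_on F u x).

End Jets.

(** ** Curvature and half-flatness of a metric in dimension 4 *)

Section Curvature.
Variable R : realType.
Variable g : 'rV[R]_4 -> 'M[R]_4.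
Implicit Types (x : 'rV[R]_4) (i j k l : 'I_4).

Definition ginv x : 'M[R]_4 := invmx (g x).

Definition dg k i j x : R := pd k (fun y => g y i j) x.

(** [christoffel i j k] is Gamma^i_jk of the Levi-Civita connection. *)
Definition christoffel i j k x : R :=
  2^-1 * \sum_l ginv x i l * (dg j l k x + dg k l j x - dg l j k x).

(** [riemann i j k l] is R^i_jkl. *)
Definition riemann i j k l x : R :=
  pd k (christoffel i l j) x - pd l (christoffel i k j) x
  + \sum_m (christoffel i k m x * christoffel m l j x
            - christoffel i l m x * christoffel m k j x).

Definition ricci j l x : R := \sum_i riemann i j i l x.

Definition ricci_up i k x : R := \sum_m ginv x i m * ricci m k x.

Definition scalar_curv x : R := \sum_i ricci_up i i x.

(** [weyl i j k l] is W^i_jkl; 2 and 6 are n - 2 and (n - 1)(n - 2), n = 4. *)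
Definition weyl i j k l x : R :=
  let d a b : R := (a == b)%:R in
  riemann i j k l x
  - 2^-1 * (d i k * ricci j l x - d i l * ricci j k x
            + g x j l * ricci_up i k x - g x j k * ricci_up i l x)
  + 6^-1 * scalar_curv x * (d i k * g x j l - d i l * g x j k).

(** The Levi-Civita symbol, with value 1 at (1, 2, 3, 4). *)
Definition levi_civita (a b c d : 'I_4) : R :=
  \det (\matrix_(r < 4, s < 4) ((tnth [tuple a; b; c; d] r == s)%:R : R)).

(** *W^i_jkl = 1/2 sqrt(det g) g^ia g^bc eps_ajbd W^d_ckl.  [Num.sqrt] vanishes
    on negative reals, so for [det g < 0], where the true star is imaginary,
    each of [W_+ = 0] and [W_- = 0] reads [W = 0], as it should. *)
Definition hodge_weyl i j k l x : R :=
  2^-1 * Num.sqrt (\det (g x)) *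
  \sum_a \sum_b \sum_c \sum_d
    ginv x i a * ginv x b c * levi_civita a j b d * weyl d c k l x.

Definition weyl_plus i j k l x : R :=
  2^-1 * (weyl i j k l x + hodge_weyl i j k l x).

Definition weyl_minus i j k l x : R :=
  2^-1 * (weyl i j k l x - hodge_weyl i j k l x).

(** The Weyl tensor W^i_jkl and the operator * depend only on the conformal
    class, so this is a property of [[g]]. *)
Definition half_flat (A : set 'rV[R]_4) : Prop :=
  (forall x, A x -> forall i j k l, weyl_minus i j k l x = 0) \/
  (forall x, A x -> forall i j k l, weyl_plus i j k l x = 0).

End Curvature.

(** ** Contact equivalence *)

Section Contact.
Variable R : realType.
Implicit Types (z w : jet1 R) (U : set (jet1 R)) (phi : jet1 R -> jet1 R).

(** The contact form [du - \sum_i p_i dx_i] at [z], on a tangent vector [w]. *)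
Definition contact_form z w : R :=
  w.1.2 - \sum_i jp z 0 i * w.1.1 0 i.

Definition local_diffeo U phi : Prop :=
  [/\ open U, open (phi @` U), smooth_on U phi &
      exists psi : jet1 R -> jet1 R,
        smooth_on (phi @` U) psi /\ forall z, U z -> psi (phi z) = z].

(** [phi] pulls the contact form back to a nowhere zero multiple of itself. *)
Definition contact_transformation U phi : Prop :=
  local_diffeo U phi /\
  forall z, U z -> exists2 rho : R, rho != 0 &
    forall w, contact_form (phi z) ('d phi z w) = rho * contact_form z w.

(** The 2-jet over [z] with symmetric second derivatives [H], seen as the
    tangent 4-plane of J^1 spanned by the truncated total derivatives
    [d/dx_i + p_i d/du + \sum_j H_ij d/dp_j]. *)
Definition jet2_plane z (H : 'M[R]_4) : set (jet1 R) :=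
  [set ((v, \sum_i jp z 0 i * v 0 i, v *m H) : jet1 R) | v in [set: 'rV[R]_4]].

(** The prolongation of [phi] sends the 2-jet [(z, H)] to [(phi z, H')].  For
    given [(z, H)] there is at most one such [H'], and there is one exactly
    when the image plane is transversal to the fibres of [(x, u, p) |-> x]. *)
Definition prolongs_to phi z (H H' : 'M[R]_4) : Prop :=
  'd phi z @` jet2_plane z H = jet2_plane (phi z) H'.

(** The prolongation of [phi], wherever it is defined over [U], sends the
    equation [F = 0] to the equation [F' = 0]. *)
Definition maps_equation U phi (F F' : pde R) : Prop :=
  forall z H H', U z -> symmetric H -> symmetric H' ->
    prolongs_to phi z H H' -> (F z H = 0 <-> F' (phi z) H' = 0).

Definition contact_equivalent (F F' : pde R) : Prop :=
  exists U phi, [/\ U !=set0, contact_transformation U phi &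
                    maps_equation U phi F F'].

End Contact.

(** ** The two equations *)

Section Equations.
Variable R : realType.

Definition modified_heavenly : pde R := fun z H =>
  let x k := jx z 0 (ix k) in
  let u a b := H (ix a) (ix b) in
    (x 1 - x 2) * (x 3 - x 4) * u 1 2 * u 3 4
  + (x 3 - x 1) * (x 2 - x 4) * u 1 3 * u 2 4
  + (x 2 - x 3) * (x 1 - x 4) * u 2 3 * u 1 4.

Definition general_heavenly (alpha beta gamma : R) : pde R := fun _ H =>
  let u a b := H (ix a) (ix b) in
  alpha * u 1 2 * u 3 4 + beta * u 1 3 * u 2 4 + gamma * u 2 3 * u 1 4.

End Equations.

(* Main.v *)
(** On a solution, if [s_i] depends on [x_i] only, the 2-form
    [\sum_i s_i dx_i /\ du_i] is closed and of fixed duality.  For [s] the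
    indicator of one coordinate, and for [s = x], its Pfaffian vanishes, so its
    kernel is an integrable totally null distribution.  Such a distribution is
    totally geodesic, hence the corresponding half of the Weyl tensor, seen as a
    binary quartic, vanishes at five distinct points and is zero.

    At a point a contact transformation acts on the contact hyperplane by a
    conformally symplectic map, and on 2-jets through the induced action on the
    Lagrangian Grassmannian.  The rank one directions that are characteristic at
    every 2-jet of either equation form the four planes [<d/dx_i, d/dp_i>], so
    the map permutes these planes; up to scaling it then permutes the three
    coefficients.  Hence [(a^2 + b^2 + c^2)^3 / (a b c)^2] is preserved.  It is a
    constant for the general heavenly equation and not for the other one. *)

Require Import Defs.
From HB Require Import structures.
From mathcomp Require Import all_boot all_order all_algebra.
From mathcomp Require Import all_classical all_reals all_analysis.
From mathcomp Require Import ring lra.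

Import Order.TTheory GRing.Theory Num.Theory.
Import numFieldNormedType.Exports.

Set Implicit Arguments.
Unset Strict Implicit.
Unset Printing Implicit Defensive.

Local Open Scope classical_set_scope.
Local Open Scope ring_scope.

(** Each nondegenerate solution carries an explicit real null frame, whose determinant is [kap / 4].
    So [det g] is a positive square, and the sign of [kap] is the orientation that decides which
    half of the Weyl tensor vanishes; connectedness fixes this sign on the domain. The curvature
    identities live in a commutative ring with commuting derivations, later the ring of smooth
    functions on the domain. Its zero divisors forbid cancellation, so vanishing statements carry
    powers of entries of [hat O], which are removed at each point separately. The five points are
    used through conics: the forms of fixed duality make a 3-dimensional space, the decomposable
    ones are the conic of zero Pfaffian, and a conic through five of its points is a multiple of it.
    That multiple is a scalar curvature term and does not reach the Weyl tensor. In the contact part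
    the obstacle is that the prolongation is defined only where a denominator is invertible.
    Statements are proved there and extended along a line of 2-jets, because a polynomial with
    infinitely many roots is zero. *)

Definition o0 : 'I_4 := @Ordinal 4 0 isT.
Definition o1 : 'I_4 := @Ordinal 4 1 isT.
Definition o2 : 'I_4 := @Ordinal 4 2 isT.
Definition o3 : 'I_4 := @Ordinal 4 3 isT.

Lemma ord4P (P : 'I_4 -> Prop) : P o0 -> P o1 -> P o2 -> P o3 -> forall i, P i.
Proof.
move=> P0 P1 P2 P3 [[|[|[|[|m]]]] im] //.
- by rewrite (_ : Ordinal im = o0) //; apply/val_inj.
- by rewrite (_ : Ordinal im = o1) //; apply/val_inj.
- by rewrite (_ : Ordinal im = o2) //; apply/val_inj.
- by rewrite (_ : Ordinal im = o3) //; apply/val_inj.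
Qed.

Lemma sum4 (V : nmodType) (F : 'I_4 -> V) :
  \sum_(i < 4) F i = F o0 + F o1 + F o2 + F o3.
Proof.
rewrite !big_ord_recl big_ord0 addr0 !addrA.
by congr (F _ + F _ + F _ + F _); apply/val_inj.
Qed.

Lemma ixE : (ix 1 = o0) * (ix 2 = o1) * (ix 3 = o2) * (ix 4 = o3).
Proof. by do !split; apply/val_inj; rewrite /ix /= inordK. Qed.

Section MxEntries.
Variables (R : pzRingType) (m n : nat).
Implicit Types (A B : 'M[R]_(m, n)).

Lemma mxDE A B i j : (A + B) i j = A i j + B i j. Proof. exact: mxE. Qed.
Lemma mxNE A i j : (- A) i j = - A i j. Proof. exact: mxE. Qed.
Lemma mxTE A i j : A^T i j = A j i. Proof. exact: mxE. Qed.
Lemma mxZE c A i j : (c *: A) i j = c * A i j. Proof. exact: mxE. Qed.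
End MxEntries.

(** * Levi-Civita calculus over a differential ring *)

(** Commuting derivations are all that the tensor calculus needs, and an abstract ring removes the
    differentiability side conditions. Inverses enter as explicit elements, such as [hf] for one
    half. *)
Record derivations (K : comNzRingType) := Derivations {
  der :> 'I_4 -> K -> K;
  derD : forall i f g, der i (f + g) = der i f + der i g;
  derM : forall i f g, der i (f * g) = der i f * g + f * der i g;
  derC : forall i j f, der i (der j f) = der j (der i f) }.

Section Derivations.
Variables (K : comNzRingType) (d : derivations K).

Lemma der_is_zmod_morphism i : zmod_morphism (d i).
Proof.
move=> f g; have dB h : d i (f - g) + h = d i f - d i g + h -> d i (f - g) = d i f - d i g.
  by move/addIr.
by apply: (dB (d i g)); rewrite -derD subrK addrNK.
Qed.
HB.instance Definition _ i :=
  GRing.isZmodMorphism.Build K K (der d i) (der_is_zmod_morphism i).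

Lemma der1 i : d i 1 = 0.
Proof. by apply: (addrI (d i 1)); rewrite addr0 -{3}[1]mulr1 derM mulr1 mul1r. Qed.

Definition dermx m n i (A : 'M[K]_(m, n)) : 'M[K]_(m, n) := map_mx (d i) A.

HB.instance Definition _ m n i :=
  GRing.Additive.copy (@dermx m n i) (map_mx (d i)).

Lemma dermxM m n p i (A : 'M[K]_(m, n)) (B : 'M[K]_(n, p)) :
  dermx i (A *m B) = dermx i A *m B + A *m dermx i B.
Proof.
apply/matrixP=> r s; rewrite !mxE raddf_sum -big_split /=.
by apply: eq_bigr => j _; rewrite derM !mxE.
Qed.

Lemma dermxZ m n i c (A : 'M[K]_(m, n)) :
  dermx i (c *: A) = d i c *: A + c *: dermx i A.
Proof. by apply/matrixP=> r s; rewrite !mxE derM. Qed.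

Lemma dermx_tr m n i (A : 'M[K]_(m, n)) : dermx i A^T = (dermx i A)^T.
Proof. by apply/matrixP=> r s; rewrite !mxE. Qed.

Lemma dermxC m n i j (A : 'M[K]_(m, n)) :
  dermx i (dermx j A) = dermx j (dermx i A).
Proof. by apply/matrixP=> r s; rewrite !mxE derC. Qed.

End Derivations.

Section LeviCivita.
Variables (K : comNzRingType) (d : derivations K) (hf : K).
Hypothesis hfE : hf + hf = 1.
Variables g h : 'M[K]_4.
Hypotheses (gT : g^T = g) (gh : g *m h = 1%:M).

(** The connection matrices [(Gam k) i j] = Gamma^i_kj and the curvature
    matrices [(Rm k l) i j] = R^i_jkl. *)
Definition Gam k : 'M[K]_4 := \matrix_(i, j)
  (hf * \sum_l h i l * (d k (g l j) + d j (g l k) - d l (g k j))).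

Definition Rm k l : 'M[K]_4 :=
  dermx d k (Gam l) - dermx d l (Gam k) + (Gam k *m Gam l - Gam l *m Gam k).

Lemma g_sym i j : g i j = g j i. Proof. by rewrite -{1}gT mxE. Qed.

Lemma Gam_sym k i j : Gam k i j = Gam j i k.
Proof.
rewrite !mxE; congr (_ * _); apply: eq_bigr => l _.
by rewrite (g_sym k j) [d k _ + _]addrC.
Qed.

Lemma g_Gam k i j :
  (g *m Gam k) i j = hf * (d k (g i j) + d j (g i k) - d i (g k j)).
Proof.
pose G l := d k (g l j) + d j (g l k) - d l (g k j).
have -> : Gam k = \matrix_(i', j') (h *m \col_l (hf * (d k (g l j') + d j' (g l k) - d l
  (g k j')))) i' 0.
  apply/matrixP=> a b; rewrite !mxE mulr_sumr; apply: eq_bigr => l _.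
  by rewrite !mxE mulrCA.
have -> : (g *m \matrix_(i', j') (h *m \col_l (hf * (d k (g l j') + d j' (g l k) - d l
  (g k j')))) i' 0) i j
  = (g *m (h *m \col_l (hf * (d k (g l j) + d j (g l k) - d l (g k j))))) i 0.
  by rewrite !mxE; apply: eq_bigr => l _; rewrite !mxE.
by rewrite mulmxA gh mul1mx mxE.
Qed.

Lemma metric_compat k : dermx d k g = (Gam k)^T *m g + g *m Gam k.
Proof.
rewrite -{2}gT -trmx_mul; apply/matrixP=> i j.
rewrite mxDE mxTE !g_Gam [dermx _ _ _ i j]mxE (g_sym j i) (g_sym k i) (g_sym j k) -mulrDr.
transitivity ((hf + hf) * d k (g i j)); last by ring.
by rewrite hfE mul1r.
Qed.

(** Metric compatibility is differentiated once more; equating the mixed second derivatives of [g]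
    leaves the antisymmetry. *)
Lemma g_Rm_antisym k l : (g *m Rm k l)^T = - (g *m Rm k l).
Proof.
apply/eqP; rewrite -subr_eq0 opprK trmx_mul gT /Rm; apply/eqP.
have := dermxC d k l g; rewrite (metric_compat l) (metric_compat k).
rewrite !raddfD /= !dermxM !dermx_tr (metric_compat l) (metric_compat k).
set a := dermx d k (Gam l); set b := dermx d l (Gam k).
move: (Gam k) (Gam l) a b => A B a b E.
have trD (X Y : 'M[K]_4) : (X + Y)^T = X^T + Y^T by exact: raddfD.
have trN (X : 'M[K]_4) : (- X)^T = - X^T by exact: raddfN.
rewrite !(trD, trN) !trmx_mul.
move: E; rewrite !(mulmxDl, mulmxDr, mulmxBl, mulmxBr, mulNmx, mulmxN, mulmxA).
move: (a^T *m g) (b^T *m g) (g *m a) (g *m b) (g *m A *m B) (g *m B *m A)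
  (B^T *m A^T *m g) (A^T *m B^T *m g) (A^T *m g *m B) (B^T *m g *m A).
move=> x1 x2 x3 x4 x5 x6 x7 x8 x9 x10 /matrixP E; apply/matrixP=> i j.
have := E i j; rewrite !(mxDE, mxNE) [X in _ -> _ = X]mxE.
move: (x1 i j) (x2 i j) (x3 i j) (x4 i j) (x5 i j) (x6 i j) (x7 i j) (x8 i j) (x9 i j) (x10 i j).
clear=> y1 y2 y3 y4 y5 y6 y7 y8 y9 y10 /eqP; rewrite -subr_eq0 => /eqP E.
rewrite -[RHS]E; ring.
Qed.

Lemma RmE k l i j : Rm k l i j = d k (Gam l i j) - d l (Gam k i j)
  + (\sum_m Gam k i m * Gam l m j - \sum_m Gam l i m * Gam k m j).
Proof.
rewrite /Rm !(mxDE, mxNE) [dermx _ _ _ i j]mxE [dermx _ l _ i j]mxE.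
by rewrite [X in _ + (X - _)]mxE [X in _ + (_ - X)]mxE.
Qed.

Lemma Rm_bianchi j k l i : Rm k l i j + Rm l j i k + Rm j k i l = 0.
Proof.
have sw (a b c : 'I_4) : \sum_m Gam a i m * Gam b m c = \sum_m Gam a i m * Gam c m b.
  by apply: eq_bigr => m _; rewrite (Gam_sym b m c).
rewrite !RmE (sw k l j) (sw l k j) (sw j l k).
rewrite (Gam_sym l i j) (Gam_sym k i j) (Gam_sym l i k).
move: (\sum_m _) (\sum_m _) (\sum_m _) (d _ _) (d _ _) (d _ _) => *.
ring.
Qed.

Definition ip (X Y : 'cV[K]_4) : K := (X^T *m g *m Y) 0 0.
Definition dird (X : 'cV[K]_4) (f : K) : K := \sum_k X k 0 * d k f.
Definition dirdm (X Y : 'cV[K]_4) : 'cV[K]_4 := \sum_k X k 0 *: dermx d k Y.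
Definition cov (X Y : 'cV[K]_4) : 'cV[K]_4 :=
  \sum_k X k 0 *: (dermx d k Y + Gam k *m Y).
Definition brack (X Y : 'cV[K]_4) : 'cV[K]_4 := dirdm X Y - dirdm Y X.
Definition curv (X Y : 'cV[K]_4) : 'M[K]_4 :=
  \sum_k \sum_l (X k 0 * Y l 0) *: Rm k l.

Lemma ipC X Y : ip X Y = ip Y X.
Proof. by rewrite /ip -[LHS]mxTE !trmx_mul trmxK gT mulmxA. Qed.

Lemma ip_is_zmod_morphism X : zmod_morphism (ip X).
Proof. by move=> Y Z; rewrite /ip mulmxBr !(mxDE, mxNE). Qed.
HB.instance Definition _ X :=
  GRing.isZmodMorphism.Build 'cV[K]_4 K (ip X) (ip_is_zmod_morphism X).

Lemma ipZr X c Y : ip X (c *: Y) = c * ip X Y.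
Proof. by rewrite /ip -scalemxAr mxZE. Qed.

Lemma ip_sumr X (F : 'I_4 -> 'cV[K]_4) : ip X (\sum_k F k) = \sum_k ip X (F k).
Proof. exact: raddf_sum. Qed.

Lemma ip_cov X Y Z : dird X (ip Y Z) = ip (cov X Y) Z + ip Y (cov X Z).
Proof.
rewrite [ip (cov _ _) _]ipC !ip_sumr -big_split /=; apply: eq_bigr => k _.
rewrite !ipZr -mulrDr; congr (_ * _).
have -> : d k (ip Y Z) = (dermx d k (Y^T *m g *m Z)) 0 0 by rewrite [RHS]mxE.
rewrite !dermxM dermx_tr metric_compat !raddfD /= ![ip Z _]ipC /ip.
rewrite !(trmx_mul, mulmxDl, mulmxDr, mulmxA) !(mxDE).
ring.
Qed.

Lemma cov_torsion X Y : cov X Y - cov Y X = brack X Y.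
Proof.
have covE (U V : 'cV_4) : cov U V = dirdm U V + \sum_k U k 0 *: (Gam k *m V).
  by rewrite /cov /dirdm -big_split; apply: eq_bigr => k _; rewrite scalerDr.
suff E (U V : 'cV_4) (i : 'I_4) : (\sum_k U k 0 *: (Gam k *m V)) i 0 = (\sum_k V k 0 *:
  (Gam k *m U)) i 0.
  rewrite !covE /brack; have -> : \sum_k X k 0 *: (Gam k *m Y) = \sum_k Y k 0 *: (Gam k *m X).
    by apply/colP => i; exact: E.
  by rewrite opprD addrACA subrr addr0.
rewrite !summxE.
under eq_bigr do rewrite mxE [(_ *m _) _ _]mxE mulr_sumr.
under [RHS]eq_bigr do rewrite mxE [(_ *m _) _ _]mxE mulr_sumr.
rewrite exchange_big; apply: eq_bigr => k _; apply: eq_bigr => l _.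
by rewrite Gam_sym; ring.
Qed.

(** In [cov X (cov Y Z)] the terms where [X] differentiates the components of [Y] assemble into
    [cov (dirdm X Y) Z]. The rest is bilinear in the components, and its skew part is the commutator
    of the operators [n k]. *)
Lemma cov_curv X Y Z :
  curv X Y *m Z = cov X (cov Y Z) - cov Y (cov X Z) - cov (brack X Y) Z.
Proof.
pose n k (V : 'cV[K]_4) := dermx d k V + Gam k *m V.
have nZ k c (V : 'cV[K]_4) : n k (c *: V) = d k c *: V + c *: n k V.
  by rewrite /n dermxZ -scalemxAr scalerDr addrA.
have nD k (F : 'I_4 -> 'cV[K]_4) : n k (\sum_l F l) = \sum_l n k (F l).
  by rewrite /n raddf_sum mulmx_sumr -big_split.
have covcov U V : cov U (cov V Z) = cov (dirdm U V) Z
    + \sum_k \sum_l (U k 0 * V l 0) *: n k (n l Z).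
  rewrite /cov -/n.
  transitivity (\sum_k \sum_l U k 0 *: n k (V l 0 *: n l Z)).
    by apply: eq_bigr => k _; rewrite -scaler_sumr -nD.
  under eq_bigr do (under eq_bigr do rewrite nZ scalerDr !scalerA; rewrite big_split /=).
  rewrite big_split /=; congr (_ + _); rewrite exchange_big; apply: eq_bigr => l _.
  rewrite /dirdm summxE scaler_suml; apply: eq_bigr => k _.
  by rewrite !mxE.
have covB U V : cov (U - V) Z = cov U Z - cov V Z.
  by rewrite /cov -sumrB; apply: eq_bigr => k _; rewrite mxDE mxNE scalerBl.
rewrite !covcov covB.
set a := cov (dirdm X Y) Z; set b := cov (dirdm Y X) Z.
set s := \sum_k _; set t := \sum_k _.
have -> : a + s - (b + t) - (a - b) = s - t.
  apply/colP => i; rewrite !(mxDE, mxNE); move: (a i 0) (b i 0) (s i 0) (t i 0).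
  by clear => *; ring.
have -> : t = \sum_k \sum_l (X k 0 * Y l 0) *: n l (n k Z).
  rewrite /t exchange_big; apply: eq_bigr => k _; apply: eq_bigr => l _.
  by rewrite mulrC.
rewrite /s /curv mulmx_suml -sumrB; apply: eq_bigr => k _.
rewrite mulmx_suml -sumrB; apply: eq_bigr => l _.
rewrite -scalemxAl -scalerBr; congr (_ *: _).
rewrite /n /Rm !raddfD /= !dermxM !mulmxDl !mulNmx !mulmxA (dermxC d l k).
have trick (x y1 y2 y3 y4 y5 y6 : 'cV[K]_4) :
  y1 - y2 + (y3 - y4) = x + (y1 + y5) + (y6 + y3) + (- x - (y2 + y6) + (- y5 - y4)).
  apply/colP => i; rewrite !(mxDE, mxNE).
  move: (x i 0) (y1 i 0) (y2 i 0) (y3 i 0) (y4 i 0) (y5 i 0) (y6 i 0).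
  clear => *; ring.
exact: trick.
Qed.

Lemma dird0 X : dird X 0 = 0.
Proof. by rewrite /dird big1 // => k _; rewrite raddf0 mulr0. Qed.

(** A family of null fields closed under brackets is totally geodesic
    (Koszul's formula), which determines its curvature by Gauss' formula. *)
Section NullFamily.
Variables (B : 'I_4 -> 'cV[K]_4) (f : 'I_4 -> 'I_4 -> 'I_4 -> K).
Hypothesis B_null : forall a b, ip (B a) (B b) = 0.
Hypothesis B_brack : forall a b, brack (B a) (B b) = \sum_c f a b c *: B c.

Lemma cov_null_family a b c : ip (cov (B a) (B b)) (B c) = 0.
Proof.
pose T a b c := ip (cov (B a) (B b)) (B c).
have T1 p q r : T p q r = - T p r q.
  apply/eqP; rewrite -addr_eq0 /T [X in _ + X]ipC; apply/eqP.
  by rewrite -ip_cov B_null dird0.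
have T2 p q r : T p q r = T q p r.
  apply/eqP; rewrite -subr_eq0 /T ipC [X in _ - X]ipC -raddfB /= cov_torsion B_brack.
  by rewrite ip_sumr big1 // => e _; rewrite ipZr B_null mulr0.
(* [T] is skew in its last two slots and symmetric in its first two; running through the orderings
   returns it with the opposite sign. *)
have E : T a b c = - T a b c by rewrite {1}T2 T1 T2 T1 opprK T2 T1.
by rewrite -/(T a b c) -[LHS]mul1r -hfE mulrDl {2}E mulrN subrr.
Qed.

Lemma cov_sumZl (g' : 'I_4 -> K) Y :
  cov (\sum_c g' c *: B c) Y = \sum_c g' c *: cov (B c) Y.
Proof.
rewrite /cov; under [RHS]eq_bigr do rewrite scaler_sumr.
rewrite exchange_big; apply: eq_bigr => k _; rewrite summxE scaler_suml.
by apply: eq_bigr => c _; rewrite scalerA mxZE.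
Qed.

(** A covariant derivative moves across [ip] with a sign when the vector is orthogonal to the
    family. The bracket term drops since every [cov (B c) (B a)] is orthogonal to [B b]. *)
Lemma ip_curv_null_family a b :
  ip (curv (B a) (B b) *m B a) (B b) =
  ip (cov (B a) (B a)) (cov (B b) (B b)) - ip (cov (B b) (B a)) (cov (B a) (B b)).
Proof.
have E p V : (forall c, ip V (B c) = 0) -> ip (cov (B p) V) (B b) = - ip V (cov (B p) (B b)).
  by move=> V0; apply/eqP; rewrite -addr_eq0 -ip_cov V0 dird0.
have F : ip (B b) (\sum_c f a b c *: cov (B c) (B a)) = 0.
  by rewrite ip_sumr big1 // => c _; rewrite ipZr ipC cov_null_family mulr0.
rewrite cov_curv B_brack cov_sumZl ipC !raddfB /= F subr0 ![ip (B b) _]ipC.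
by rewrite !E ?opprK 1?addrC // => c; exact: cov_null_family.
Qed.

End NullFamily.

End LeviCivita.

(** * Two-forms in dimension four *)

Section Matrix4.
Variable K : comNzRingType.
Implicit Types (A O : 'M[K]_4).

Definition mx4 (s : seq (seq K)) : 'M[K]_4 :=
  \matrix_(i, j) nth 0 (nth [::] s i) j.

Definition skew A := forall i j, A i j = - A j i.
Definition alternating A := skew A /\ forall i, A i i = 0.

(** [hat O] is half the contraction of [O] with the Levi-Civita symbol. *)
Definition hat O : 'M[K]_4 := mx4
  [:: [:: 0; O o2 o3; - O o1 o3; O o1 o2];
      [:: - O o2 o3; 0; O o0 o3; - O o0 o2];
      [:: O o1 o3; - O o0 o3; 0; O o0 o1];
      [:: - O o1 o2; O o0 o2; - O o0 o1; 0]].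

Definition pfaffian O := O o0 o1 * O o2 o3 - O o0 o2 * O o1 o3 + O o0 o3 * O o1 o2.

Lemma hat_alternating O : alternating (hat O).
Proof.
split; last by apply: ord4P; rewrite mxE.
by apply: ord4P; apply: ord4P; rewrite !mxE /= ?opprK ?oppr0.
Qed.

Lemma mulmx4E m n (A : 'M[K]_(m, 4)) (B : 'M[K]_(4, n)) i j : (A *m B) i j =
  A i o0 * B o0 j + A i o1 * B o1 j + A i o2 * B o2 j + A i o3 * B o3 j.
Proof. by rewrite mxE sum4. Qed.

Lemma mul_hat O : alternating O -> hat O *m O = (- pfaffian O)%:M.
Proof.
move=> [Os O0]; apply/matrixP.
have := (Os o1 o0, Os o2 o0, Os o3 o0, Os o2 o1, Os o3 o1, Os o3 o2) => E.
by apply: ord4P; apply: ord4P; rewrite mulmx4E !mxE /= ?O0 ?E /pfaffian; ring.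
Qed.

(** An alternating array with three indices has four independent components in dimension four, so
    four computations replace sixty-four. *)
Lemma alternating3_eq0 (J : 'I_4 -> 'I_4 -> 'I_4 -> K) :
    (forall i j k, J i j k = J j k i) -> (forall i k, J i i k = 0) ->
    (forall i j k, J j i k = - J i j k) ->
    J o0 o1 o2 = 0 -> J o0 o1 o3 = 0 -> J o0 o2 o3 = 0 -> J o1 o2 o3 = 0 ->
  forall i j k, J i j k = 0.
Proof.
move=> cyc rep swp J012 J013 J023 J123.
have base i j k : J i j k = 0 -> [/\ J i k j = 0, J j i k = 0, J j k i = 0,
    J k i j = 0 & J k j i = 0].
  move=> E; have E1 : J j k i = 0 by rewrite -cyc.
  have E2 : J k i j = 0 by rewrite -cyc.
  by split; rewrite ?E // swp (E, E1, E2) oppr0.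
have [a1 a2 a3 a4 a5] := base _ _ _ J012.
have [b1 b2 b3 b4 b5] := base _ _ _ J013.
have [c1 c2 c3 c4 c5] := base _ _ _ J023.
have [d1 d2 d3 d4 d5] := base _ _ _ J123.
have rep2 i k : J k i i = 0 by rewrite cyc rep.
have rep3 i k : J i k i = 0 by rewrite -cyc rep.
by apply: ord4P; apply: ord4P; apply: ord4P; rewrite ?rep ?rep2 ?rep3.
Qed.

(** A vector of the kernel of [O] has zero exterior product with the dual
    bivector of [O]. *)
Lemma ker_wedge_hat O (V : 'cV[K]_4) : alternating O -> V^T *m O = 0 ->
  forall i j k, V i 0 * hat O j k + V j 0 * hat O k i + V k 0 * hat O i j = 0.
Proof.
move=> [Os O0] VO; have [Hs H0] := hat_alternating O.
have E i : (V^T *m O) 0 i = 0 by rewrite VO mxE.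
apply: alternating3_eq0.
- by move=> i j k; ring.
- by move=> i k; rewrite H0 (Hs k i); ring.
- by move=> i j k; rewrite (Hs j i) (Hs i k) (Hs k j); ring.
- by rewrite -(E o3) mulmx4E !mxE /= O0; ring.
- by rewrite -[RHS]oppr0 -(E o2) mulmx4E !mxE /= O0 (Os o3 o2); ring.
- by rewrite -(E o1) mulmx4E !mxE /= O0 (Os o3 o1) (Os o2 o1); ring.
- by rewrite -[RHS]oppr0 -(E o0) mulmx4E !mxE /= O0 (Os o3 o0) (Os o2 o0) (Os o1 o0); ring.
Qed.

(** When the Pfaffian is zero, [mul_hat] puts the rows of [hat O] into the kernel of [O]. *)
Lemma plucker O : alternating O -> pfaffian O = 0 -> forall a i j k,
  hat O a i * hat O j k + hat O a j * hat O k i + hat O a k * hat O i j = 0.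
Proof.
move=> Oa pf a i j k; have := @ker_wedge_hat O (row a (hat O))^T Oa.
rewrite trmxK -row_mul mul_hat // pf oppr0 => /(_ _ i j k); rewrite !mxE.
by apply; apply/rowP => l; rewrite !mxE mul0rn.
Qed.

End Matrix4.

(** A totally null distribution given as the kernel of a closed 2-form [O] of
    rank two with [h O h = kappa hat(O)]. *)
Section NullTwoForm.
Variables (K : comNzRingType) (d : derivations K) (hf : K).
Hypothesis hfE : hf + hf = 1.
Variables (g h O : 'M[K]_4) (kappa kappa' : K).
Hypotheses (gT : g^T = g) (gh : g *m h = 1%:M).
Hypotheses (Oalt : alternating O) (pfO : pfaffian O = 0).
Hypothesis closedO : forall i j k, i != j -> j != k -> i != k ->
  d i (O j k) + d j (O k i) + d k (O i j) = 0.
Hypotheses (hOh : h *m O *m h = kappa *: hat O) (kappaV : kappa' * kappa = 1).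

Local Notation B := (hat O).
Local Notation Bv a := ((row a (hat O))^T).
Local Notation Rmg := (Rm d hf g h).
Local Notation ip := (ip g).

Lemma hg : h *m g = 1%:M. Proof. exact: mulmx1C gh. Qed.

(** The distribution contains its own orthogonal complement: by [hOh], lowering both indices of
    [kappa *: hat O] gives back [O]. *)
Lemma ip_Bv (V : 'cV_4) : (forall c, ip V (Bv c) = 0) -> V^T *m O = 0.
Proof.
move=> VB; have : V^T *m g *m B^T = 0.
  apply/rowP => c; rewrite [RHS]mxE -(VB c) /ip tr_row !mxE.
  by apply: eq_bigr => i _; rewrite !mxE.
have [Bs _] := hat_alternating O.
have -> : B^T = - B by apply/matrixP => i j; rewrite mxE mxNE -Bs.
move=> /(congr1 (fun X => (- kappa) *: (X *m g))).
rewrite mulmxN mulNmx scalerN scaleNr opprK mul0mx scaler0.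
by rewrite -mulmxA scalemxAr scalemxAl -hOh -!mulmxA hg mulmx1 (mulmxA g) gh mul1mx.
Qed.

Lemma ip_Bv0 a b : ip (Bv a) (Bv b) = 0.
Proof.
have [Bs _] := hat_alternating O.
have BT : B^T = - B by apply/matrixP => i j; rewrite mxE mxNE -Bs.
suff E : B *m g *m B = 0.
  rewrite /ip trmxK -row_mul tr_row.
  have -> : (row a (B *m g) *m col b B^T) 0 0 = (B *m g *m B^T) a b.
    by rewrite !mxE; apply: eq_bigr => i _; rewrite !mxE.
  by rewrite BT mulmxN E oppr0 mxE.
suff E : kappa *: (B *m (g *m B)) = 0.
  by rewrite -[LHS]scale1r -kappaV -scalerA -mulmxA E scaler0.
rewrite !scalemxAr -hOh -!mulmxA (mulmxA g) gh mul1mx (mulmxA B) mul_hat // pfO.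
by rewrite oppr0 raddf0 mul0mx.
Qed.

(** The Jacobi identity of the bivector [hat O]. Each independent component is a combination of
    three closedness equations, with entries of [O] as coefficients, and of one derivative of the
    Pfaffian. *)
Lemma poisson a b c : \sum_k (B a k * d k (B b c) + B b k * d k (B c a)
  + B c k * d k (B a b)) = 0.
Proof.
have [Bs B0] := hat_alternating O; have [Os O0] := Oalt.
have dBs k i j : d k (B i j) = - d k (B j i) by rewrite Bs raddfN.
have dP k : d k (pfaffian O) = 0 by rewrite pfO raddf0.
have dPf k : d k (pfaffian O) = d k (O o0 o1) * O o2 o3 + O o0 o1 * d k (O o2 o3)
   - (d k (O o0 o2) * O o1 o3 + O o0 o2 * d k (O o1 o3))
   + (d k (O o0 o3) * O o1 o2 + O o0 o3 * d k (O o1 o2)).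
  by rewrite /pfaffian raddfD raddfB /= !derM.
have C012 := @closedO o0 o1 o2 isT isT isT.
have C013 := @closedO o0 o1 o3 isT isT isT.
have C023 := @closedO o0 o2 o3 isT isT isT.
have C123 := @closedO o1 o2 o3 isT isT isT.
have cmb4 t0 t1 t2 t3 y z0 z1 z2 z3 : z0 = 0 -> z1 = 0 -> z2 = 0 -> z3 = 0 ->
    y = t0 * z0 + t1 * z1 + t2 * z2 + t3 * z3 -> y = 0 :> K.
  by move=> -> -> -> ->; rewrite !mulr0 !addr0.
move: a b c; apply: alternating3_eq0.
- by move=> a b c; apply: eq_bigr => k _; ring.
- move=> a c; apply: big1 => k _; rewrite B0 raddf0 (dBs k c a); ring.
- move=> a b c; rewrite -sumrN; apply: eq_bigr => k _.
  by rewrite (dBs k a c) (dBs k c b) (dBs k b a); ring.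
- apply: (@cmb4 (1) (- O o2 o3) (O o1 o3) (- O o0 o3) _ _ _ _ _ (dP o3) C013 C023 C123).
  rewrite dPf ?(Os o2 o0) ?(Os o3 o0) ?(Os o3 o1) sum4 !mxE /= ?raddfN ?raddf0 /=; ring.
- apply: (@cmb4 (-1) (O o2 o3) (- O o1 o2) (O o0 o2) _ _ _ _ _ (dP o2) C012 C023 C123).
  rewrite dPf ?(Os o2 o0) ?(Os o3 o0) ?(Os o3 o1) sum4 !mxE /= ?raddfN ?raddf0 /=; ring.
- apply: (@cmb4 (1) (- O o1 o3) (O o1 o2) (- O o0 o1) _ _ _ _ _ (dP o1) C012 C013 C123).
  rewrite dPf ?(Os o2 o0) ?(Os o3 o0) ?(Os o3 o1) sum4 !mxE /= ?raddfN ?raddf0 /=; ring.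
- apply: (@cmb4 (-1) (O o0 o3) (- O o0 o2) (O o0 o1) _ _ _ _ _ (dP o0) C012 C013 C023).
  rewrite dPf ?(Os o2 o0) ?(Os o3 o0) ?(Os o3 o1) sum4 !mxE /= ?raddfN ?raddf0 /=; ring.
Qed.

Lemma BvE a k : Bv a k 0 = B a k.
Proof. by rewrite mxTE [LHS]mxE. Qed.

(** Up to sign [Bv a] is the Hamiltonian field of the coordinate [a], so a bracket of two of them is
    the Hamiltonian field of their Poisson bracket [B a b]. *)
Lemma brack_Bv a b : brack d (Bv a) (Bv b) = \sum_c d c (B a b) *: Bv c.
Proof.
have [Bs B0] := hat_alternating O.
apply/colP => i; rewrite mxDE mxNE !summxE -sumrB.
apply/eqP; rewrite -subr_eq0 -sumrB -[X in _ == X](poisson a b i).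
apply/eqP; apply: eq_bigr => k _; rewrite !mxZE ![dermx _ _ _ _ _]mxE !BvE.
by rewrite (Bs k i) (Bs i a) raddfN; ring.
Qed.

(** By Gauss' formula the curvature is a difference of products of two vectors orthogonal to the
    distribution. Such a vector lies in the kernel of [O], and multiplied by [B a b] it becomes a
    combination of [Bv a] and [Bv b], which is orthogonal to the other factor. *)
Lemma curv_Bv a b : B a b * ip (curv d hf g h (Bv a) (Bv b) *m Bv a) (Bv b) = 0.
Proof.
have [Bs B0] := hat_alternating O.
have N := cov_null_family hfE gT gh ip_Bv0 brack_Bv.
rewrite (ip_curv_null_family hfE gT gh ip_Bv0 brack_Bv).
have E V V' : (forall c, ip V (Bv c) = 0) -> (forall c, ip V' (Bv c) = 0) -> B a b * ip V V' = 0.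
  move=> V0 /ip_Bv V'O; rewrite -ipZr.
  have -> : B a b *: V' = V' b 0 *: Bv a - V' a 0 *: Bv b.
    apply/colP => i; have := ker_wedge_hat Oalt V'O i a b.
    rewrite (Bs i a) => /eqP; rewrite -subr_eq0 mxDE mxNE !mxZE !BvE => /eqP W.
    by apply/eqP; rewrite -subr_eq0 -[X in _ == X]W; apply/eqP; ring.
  by rewrite raddfB /= !ipZr !V0 !mulr0 subrr.
by rewrite mulrBr !E ?subrr.
Qed.

Lemma skew_double_sum (T : 'I_4 -> 'I_4 -> K) (x y : 'I_4 -> K) :
  (forall i j, T i j = - T j i) ->
  2 * (\sum_i \sum_j x i * y j * T i j) =
  \sum_i \sum_j (x i * y j - x j * y i) * T i j.
Proof.
move=> Ts; rewrite mulr2n mulrDl mul1r {2}exchange_big -big_split /=.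
apply: eq_bigr => i _; rewrite -big_split; apply: eq_bigr => j _.
by rewrite /= (Ts j i); ring.
Qed.

(** The wedge product of [Bv a] and [Bv b] is [B a b] times [hat O]. It occurs twice in the
    curvature, which gives two of the three factors; the third comes from [curv_Bv]. *)
Lemma curv_hat a b : B a b ^+ 3 *
  (\sum_k \sum_l B k l * \sum_i \sum_j B i j * (g *m Rmg k l) i j) = 0.
Proof.
have [Bs B0] := hat_alternating O.
set X := \sum_k _.
have Pl i j : B a i * B b j - B a j * B b i = B a b * B i j.
  have := plucker Oalt pfO a b i j; rewrite (Bs j b) => W.
  by apply/eqP; rewrite -subr_eq0 -oppr0 -W; apply/eqP; ring.
pose Y k l := ip (Rmg k l *m Bv a) (Bv b).
have YE k l : 2 * Y k l = - B a b * \sum_i \sum_j B i j * (g *m Rmg k l) i j.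
  have -> : Y k l = \sum_i \sum_j B b i * B a j * (g *m Rmg k l) i j.
    rewrite /Y ipC // /ip mulmxA -(mulmxA _ g) mxE.
    under eq_bigr do rewrite mxE mulr_suml.
    rewrite exchange_big; apply: eq_bigr => i _; apply: eq_bigr => j _ /=.
    by rewrite trmxK [row _ _ _ _]mxE BvE; ring.
  rewrite skew_double_sum; last first.
    move=> i j; have := g_Rm_antisym d hfE gT gh k l.
    by move=> /matrixP/(_ j i); rewrite mxTE mxNE.
  rewrite mulr_sumr; apply: eq_bigr => i _; rewrite mulr_sumr; apply: eq_bigr => j _.
  by rewrite mulrA mulNr -Pl; congr (_ * _); ring.
have Z : 4 * ip (curv d hf g h (Bv a) (Bv b) *m Bv a) (Bv b) = - B a b ^+ 2 * X.
  transitivity (2 * \sum_k \sum_l B a k * B b l * (2 * Y k l)).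
    rewrite ipC // /curv mulmx_suml ip_sumr !mulr_sumr.
    apply: eq_bigr => k _; rewrite mulmx_suml ip_sumr !mulr_sumr.
    by apply: eq_bigr => l _; rewrite -scalemxAl ipZr !BvE ipC // /Y; ring.
  rewrite skew_double_sum; last first.
    move=> k l; rewrite -mulrN; congr (_ * _); rewrite /Y ipC // [in RHS]ipC // -raddfN.
    by rewrite /= -mulNmx (_ : - Rmg l k = Rmg k l) // /Rm opprD !opprB.
  rewrite mulr_sumr; apply: eq_bigr => i _; rewrite mulr_sumr; apply: eq_bigr => j _.
  by rewrite Pl YE; ring.
transitivity (- (B a b) * (- B a b ^+ 2 * X)); first by ring.
by rewrite -Z mulNr mulrCA curv_Bv mulr0 oppr0.
Qed.

End NullTwoForm.

(** * The 2-forms attached to a solution and their duality *)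

Section HeavenlyForms.
Variable K : comNzRingType.
Implicit Types (x s : 'I_4 -> K) (U : 'M[K]_4).

Definition c12 x := (x o0 - x o1) * (x o2 - x o3).
Definition c13 x := (x o2 - x o0) * (x o1 - x o3).
Definition c14 x := (x o1 - x o2) * (x o0 - x o3).

Lemma c_sum x : c12 x + c13 x + c14 x = 0.
Proof. by rewrite /c12 /c13 /c14; ring. Qed.

Definition heav (a b c : K) U :=
  a * U o0 o1 * U o2 o3 + b * U o0 o2 * U o1 o3 + c * U o1 o2 * U o0 o3.

Definition symbol (a b c : K) U : 'M[K]_4 := mx4
  [:: [:: 0; a * U o2 o3; b * U o1 o3; c * U o1 o2];
      [:: a * U o2 o3; 0; c * U o0 o3; b * U o0 o2];
      [:: b * U o1 o3; c * U o0 o3; 0; a * U o0 o1];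
      [:: c * U o1 o2; b * U o0 o2; a * U o0 o1; 0]].

(** The 2-forms [\sum_i s_i dx_i /\ du_i]; they are closed if [s_i] depends on
    [x_i] only, and anti-self-dual on solutions. *)
Definition Om s U : 'M[K]_4 := \matrix_(i, j) ((s i - s j) * U i j).

(** Let X, Y, Z be the products multiplied by a, b, c in the equation. Over a field and for nonzero
    a, b, c with zero sum, the equation makes (Y - Z, Z - X, X - Y) a multiple t of (a, b, c). Then
    [kap] is - a b c t, which treats the three coefficients alike. *)
Definition kap (a b : K) U := a * b * (U o0 o2 * U o1 o3 - U o0 o1 * U o2 o3).

Lemma symbol_sym a b c U : (symbol a b c U)^T = symbol a b c U.
Proof. by apply/matrixP; apply: ord4P; apply: ord4P; rewrite !mxE. Qed.

Lemma Om_alternating s U : U^T = U -> alternating (Om s U).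
Proof.
move=> UT; split=> [i j|i]; rewrite !mxE ?subrr ?mul0r //.
by rewrite -mulNr opprB -{1}UT mxTE.
Qed.

Lemma pfaffian_Om_delta i U : pfaffian (Om (fun j => (i == j)%:R) U) = 0.
Proof.
by move: i; apply: ord4P; rewrite /pfaffian !mxE /=; ring.
Qed.

Lemma pfaffian_Om_x x U : U^T = U ->
  pfaffian (Om x U) = heav (c12 x) (c13 x) (c14 x) U.
Proof.
by move=> UT; rewrite /pfaffian /heav /c12 /c13 /c14 !mxE; ring.
Qed.

Lemma symbol_Om a b c s U : U^T = U -> a + b + c = 0 -> heav a b c U = 0 ->
  symbol a b c U *m Om s U *m symbol a b c U = kap a b U *: hat (Om s U).
Proof.
move=> UT abc F0; have Us i j : U i j = U j i by rewrite -{1}UT mxTE.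
have cE : c = - (a + b) by rewrite -[RHS]add0r -abc; ring.
have [Os O0] := Om_alternating s UT.
have [Hs H0] := hat_alternating (Om s U).
(* Each [q] supplied below is the cofactor of the equation in the difference of the two entries,
   once [c] is eliminated. *)
have key (q y z : K) : y - z = q * heav a b c U -> y = z.
  by rewrite F0 mulr0 => /eqP; rewrite subr_eq0 => /eqP.
set L := symbol _ _ _ _ *m _ *m _.
have Ls i j : L i j = - L j i.
  have LT : L = - L^T.
    have OT : (Om s U)^T = - Om s U.
      by apply/matrixP => k l; rewrite mxTE mxNE Os.
    by rewrite /L !trmx_mul symbol_sym OT mulNmx mulmxN opprK mulmxA.
  by rewrite {1}LT mxNE mxTE.
have L0 i : L i i = 0.
  move: i; apply: ord4P; rewrite /L mulmx4E ![(symbol _ _ _ _ *m _) _ _]mulmx4E !mxE /= subrr;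
    rewrite ?(Us o1 o0) ?(Us o2 o0) ?(Us o3 o0) ?(Us o2 o1) ?(Us o3 o1) ?(Us o3 o2); ring.
suff E (i j : 'I_4) : (i < j)%N -> L i j = kap a b U * hat (Om s U) i j.
  apply/matrixP => i j; rewrite mxZE.
  case: (ltngtP i j) => [/E //|ji|/val_inj ->]; last by rewrite L0 H0 mulr0.
  by rewrite Ls (E _ _ ji) Hs mulrN opprK.
rewrite /L mulmx4E ![(symbol _ _ _ _ *m _) _ _]mulmx4E.
move: i j; apply: ord4P; apply: ord4P => // _.
- apply: (key (- U o2 o3 * (a * (s o0 - s o1) - b * (s o2 - s o3)))).
  rewrite !mxE /= cE /heav /kap;
  rewrite ?(Us o1 o0) ?(Us o2 o0) ?(Us o3 o0) ?(Us o2 o1) ?(Us o3 o1) ?(Us o3 o2); ring.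
- apply: (key (U o1 o3 * (a * (s o1 - s o3) - b * (s o0 - s o2)))).
  rewrite !mxE /= cE /heav /kap;
  rewrite ?(Us o1 o0) ?(Us o2 o0) ?(Us o3 o0) ?(Us o2 o1) ?(Us o3 o1) ?(Us o3 o2); ring.
- apply: (key (U o1 o2 * (a + b) * (s o0 - s o3))).
  rewrite !mxE /= cE /heav /kap;
  rewrite ?(Us o1 o0) ?(Us o2 o0) ?(Us o3 o0) ?(Us o2 o1) ?(Us o3 o1) ?(Us o3 o2); ring.
- apply: (key (U o0 o3 * (a + b) * (s o1 - s o2))).
  rewrite !mxE /= cE /heav /kap;
  rewrite ?(Us o1 o0) ?(Us o2 o0) ?(Us o3 o0) ?(Us o2 o1) ?(Us o3 o1) ?(Us o3 o2); ring.
- apply: (key (U o0 o2 * (a * (s o0 - s o2) - b * (s o1 - s o3)))).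
  rewrite !mxE /= cE /heav /kap;
  rewrite ?(Us o1 o0) ?(Us o2 o0) ?(Us o3 o0) ?(Us o2 o1) ?(Us o3 o1) ?(Us o3 o2); ring.
- apply: (key (- U o0 o1 * (a * (s o2 - s o3) - b * (s o0 - s o1)))).
  rewrite !mxE /= cE /heav /kap;
  rewrite ?(Us o1 o0) ?(Us o2 o0) ?(Us o3 o0) ?(Us o2 o1) ?(Us o3 o1) ?(Us o3 o2); ring.
Qed.

End HeavenlyForms.

Section MapForms.
Variables (K L : comNzRingType) (f : {rmorphism K -> L}).

Lemma map_symbol a b c U :
  map_mx f (symbol a b c U) = symbol (f a) (f b) (f c) (map_mx f U).
Proof.
by apply/matrixP; apply: ord4P; apply: ord4P; rewrite !mxE /= ?rmorph0 ?rmorphM.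
Qed.

Lemma map_heav a b c U : f (heav a b c U) = heav (f a) (f b) (f c) (map_mx f U).
Proof. by rewrite /heav !rmorphD !rmorphM !mxE. Qed.

End MapForms.

Section HeavenlyCurvature.
Variables (K : comNzRingType) (d : derivations K) (hf : K).
Hypothesis hfE : hf + hf = 1.
Variables (x : 'I_4 -> K) (U g : 'M[K]_4) (kappa' : K).
Hypotheses (UT : U^T = U) (dx : forall i j, d i (x j) = (i == j)%:R).
Hypothesis dU : forall i j k, d i (U j k) = d j (U i k).
Hypothesis F0 : heav (c12 x) (c13 x) (c14 x) U = 0.
Local Notation h := (hf *: symbol (c12 x) (c13 x) (c14 x) U).
Hypotheses (gT : g^T = g) (gh : g *m h = 1%:M).
Hypothesis kappaV : kappa' * (hf ^+ 2 * kap (c12 x) (c13 x) U) = 1.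

Lemma curv_Om s a b :
    (forall i j, i != j -> d i (s j) = 0) -> pfaffian (Om s U) = 0 ->
  hat (Om s U) a b ^+ 3 * (\sum_k \sum_l hat (Om s U) k l *
    \sum_i \sum_j hat (Om s U) i j * (g *m Rm d hf g h k l) i j) = 0.
Proof.
move=> ds pf; have Us i j : U i j = U j i by rewrite -{1}UT mxTE.
apply: (@curv_hat _ d hf hfE g h (Om s U) (hf ^+ 2 * kap (c12 x) (c13 x) U) kappa') => //.
- exact: Om_alternating.
- move=> i j k ij jk ik; rewrite !mxE !derM !raddfB /=.
  rewrite !ds // 1?eq_sym // (Us k i) (dU j i k) (dU k i j) (Us k j); ring.
- rewrite -!scalemxAl -scalemxAr scalerA symbol_Om ?scalerA //; exact: c_sum.
Qed.

End HeavenlyCurvature.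

(** * Behaviour of [hat] under a change of frame, and its link with the Levi-Civita symbol *)

Section Determinant4.
Variable K : comNzRingType.

Lemma det3 (A : 'M[K]_3) (B : nat -> nat -> K) : (forall i j, A i j = B i j) ->
  \det A = B 0 0 * (B 1 1 * B 2 2 - B 1 2 * B 2 1)
         - B 0 1 * (B 1 0 * B 2 2 - B 1 2 * B 2 0)
         + B 0 2 * (B 1 0 * B 2 1 - B 1 1 * B 2 0).
Proof.
move=> AB; rewrite (expand_det_row _ ord0) !big_ord_recl big_ord0 /cofactor.
do 2 (rewrite !(expand_det_row _ ord0) !big_ord_recl !big_ord0 /cofactor).
rewrite !det_mx00 !mxE !AB /= /bump /=.
ring.
Qed.

Lemma det4 (A : 'M[K]_4) : \det A =
    A o0 o0 * (A o1 o1 * (A o2 o2 * A o3 o3 - A o2 o3 * A o3 o2)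
             - A o1 o2 * (A o2 o1 * A o3 o3 - A o2 o3 * A o3 o1)
             + A o1 o3 * (A o2 o1 * A o3 o2 - A o2 o2 * A o3 o1))
  - A o0 o1 * (A o1 o0 * (A o2 o2 * A o3 o3 - A o2 o3 * A o3 o2)
             - A o1 o2 * (A o2 o0 * A o3 o3 - A o2 o3 * A o3 o0)
             + A o1 o3 * (A o2 o0 * A o3 o2 - A o2 o2 * A o3 o0))
  + A o0 o2 * (A o1 o0 * (A o2 o1 * A o3 o3 - A o2 o3 * A o3 o1)
             - A o1 o1 * (A o2 o0 * A o3 o3 - A o2 o3 * A o3 o0)
             + A o1 o3 * (A o2 o0 * A o3 o1 - A o2 o1 * A o3 o0))
  - A o0 o3 * (A o1 o0 * (A o2 o1 * A o3 o2 - A o2 o2 * A o3 o1)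
             - A o1 o1 * (A o2 o0 * A o3 o2 - A o2 o2 * A o3 o0)
             + A o1 o2 * (A o2 o0 * A o3 o1 - A o2 o1 * A o3 o0)).
Proof.
pose B (i j : nat) := A (inord i) (inord j).
have AB i j : A i j = B i j by rewrite /B !inord_val.
rewrite (expand_det_row _ o0) sum4 /cofactor !AB.
rewrite (@det3 _ (fun i j => B i.+1 j.+1)); last by move=> i j; rewrite !mxE AB.
rewrite (@det3 _ (fun i j => B i.+1 (bump 1 j))); last by move=> i j; rewrite !mxE AB.
rewrite (@det3 _ (fun i j => B i.+1 (bump 2 j))); last by move=> i j; rewrite !mxE AB.
rewrite (@det3 _ (fun i j => B i.+1 (bump 3 j))); last by move=> i j; rewrite !mxE AB.
rewrite /bump /=; ring.
Qed.

(** Contraction with the Levi-Civita symbol is a tensor density, so a change of frame costs its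
    determinant. *)
Lemma mul_hat_congr (E : 'M[K]_4) (b : 'M[K]_4) : alternating b ->
  E^T *m hat (E *m b *m E^T) *m E = \det E *: hat b.
Proof.
move=> [bs b0].
have BT : (E *m b *m E^T)^T = - (E *m b *m E^T).
  have bT : b^T = - b by apply/matrixP => i j; rewrite mxNE mxTE bs.
  by rewrite !trmx_mul trmxK bT mulNmx mulmxN mulmxA.
set L := E^T *m _ *m _; have [hs h0] := hat_alternating (E *m b *m E^T).
have [cs c0] := hat_alternating b.
have Ls i j : L i j = - L j i.
  have LT : L = - L^T.
    have HT : (hat (E *m b *m E^T))^T = - hat (E *m b *m E^T).
      by apply/matrixP => k l; rewrite mxTE mxNE hs.
    by rewrite /L !trmx_mul HT trmxK mulNmx mulmxN opprK mulmxA.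
  by rewrite {1}LT mxNE mxTE.
have L0 i : L i i = 0.
  rewrite /L mulmx4E ![(E^T *m _) _ _]mulmx4E ![E^T _ _]mxTE !h0.
  by rewrite (hs o1 o0) (hs o2 o0) (hs o3 o0) (hs o2 o1) (hs o3 o1) (hs o3 o2); ring.
suff W (i j : 'I_4) : (i < j)%N -> L i j = \det E * hat b i j.
  apply/matrixP => i j; rewrite mxZE.
  case: (ltngtP i j) => [/W //|ji|/val_inj ->]; last by rewrite L0 c0 mulr0.
  by rewrite Ls (W _ _ ji) cs mulrN opprK.
have Q k l : (E *m b *m E^T) k l = b o0 o1 * (E k o0 * E l o1 - E k o1 * E l o0) +
   b o0 o2 * (E k o0 * E l o2 - E k o2 * E l o0) + b o0 o3 * (E k o0 * E l o3 - E k o3 * E l o0)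
  + b o1 o2 * (E k o1 * E l o2 - E k o2 * E l o1) + b o1 o3 * (E k o1 * E l o3 - E k o3 * E l o1)
  + b o2 o3 * (E k o2 * E l o3 - E k o3 * E l o2).
  rewrite mulmx4E ![(E *m b) _ _]mulmx4E ![E^T _ _]mxTE !b0.
  rewrite (bs o1 o0) (bs o2 o0) (bs o3 o0) (bs o2 o1) (bs o3 o1) (bs o3 o2); ring.
rewrite /L mulmx4E ![(E^T *m _) _ _]mulmx4E ![E^T _ _]mxTE ![hat _ _ _]mxE /= !Q.
move: i j; apply: ord4P; apply: ord4P => // _.
- by rewrite /= det4; ring.
all: by rewrite /= det4; ring.
Qed.

End Determinant4.

Section LeviCivitaSymbol.
Variable R : realType.

Lemma levi_civita_contract (X : 'M[R]_4) a j : alternating X ->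
  \sum_b \sum_e levi_civita R a j b e * X e b = - (2 * hat X a j).
Proof.
move=> [Xs X0].
pose D (a s : 'I_4) : R := (a == s)%:R.
have sel (p q r t s k : 'I_4) : (\matrix_(u < 4, v < 4)
    ((tnth [tuple p; q; r; t] u == v)%:R : R)) s k =
  D (nth o0 [:: p; q; r; t] s) k by rewrite mxE (tnth_nth o0).
under eq_bigr do under eq_bigr do rewrite /levi_civita det4 !sel /=.
move: a j; apply: ord4P; apply: ord4P.
all: rewrite !sum4 /D /= !mxE /= ?X0
  ?(Xs o1 o0) ?(Xs o2 o0) ?(Xs o3 o0) ?(Xs o2 o1) ?(Xs o3 o1) ?(Xs o3 o2); ring.
Qed.

End LeviCivitaSymbol.

(** * The Weyl tensor in a null frame *)

Section Frames.
Variable F : realFieldType.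
Implicit Types (E g h : 'M[F]_4) (T : 'I_4 -> 'I_4 -> 'I_4 -> 'I_4 -> F).

Definition fr E T a b c e := \sum_i \sum_j \sum_k \sum_l
  E i a * E j b * E k c * E l e * T i j k l.

Lemma eq_fr E T T' a b c e : (forall i j k l, T i j k l = T' i j k l) ->
  fr E T a b c e = fr E T' a b c e.
Proof. by move=> TT; do 4 (apply: eq_bigr => ? _); rewrite TT. Qed.

Lemma fr_swap12 E T a b c e : fr E (fun i j => T j i) a b c e = fr E T b a c e.
Proof.
rewrite /fr exchange_big; do 4 (apply: eq_bigr => ? _).
by rewrite [E _ a * _]mulrC.
Qed.

Lemma fr_swap34 E T a b c e : fr E (fun i j k l => T i j l k) a b c e = fr E T a b e c.
Proof.
rewrite /fr; do 2 (apply: eq_bigr => ? _).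
by rewrite exchange_big; do 2 (apply: eq_bigr => ? _); rewrite [_ * _ * E _ c * _]mulrAC.
Qed.

Lemma fr_swap23 E T a b c e : fr E (fun i j k l => T i k j l) a b c e = fr E T a c b e.
Proof.
rewrite /fr; apply: eq_bigr => ? _.
by rewrite exchange_big; do 3 (apply: eq_bigr => ? _); rewrite [_ * E _ b * _]mulrAC.
Qed.

Lemma frD E T T' a b c e :
  fr E (fun i j k l => T i j k l + T' i j k l) a b c e = fr E T a b c e + fr E T' a b c e.
Proof.
rewrite /fr; do 4 (rewrite -big_split /=; apply: eq_bigr => ? _).
by rewrite mulrDr.
Qed.

Lemma frZ E (x : F) T a b c e :
  fr E (fun i j k l => x * T i j k l) a b c e = x * fr E T a b c e.
Proof.
rewrite /fr; do 4 (rewrite mulr_sumr; apply: eq_bigr => ? _).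
by rewrite mulrCA.
Qed.

Lemma frN E T a b c e : fr E (fun i j k l => - T i j k l) a b c e = - fr E T a b c e.
Proof. by rewrite -mulN1r -frZ; apply: eq_fr => *; rewrite mulN1r. Qed.

Lemma fr0 E a b c e : fr E (fun _ _ _ _ => 0) a b c e = 0.
Proof. by rewrite /fr; do 4 (apply: big1 => ? _); rewrite mulr0. Qed.

Lemma congrmxE (E A : 'M[F]_4) a b :
  (E^T *m A *m E) a b = \sum_i \sum_j E i a * E j b * A i j.
Proof.
rewrite mxE; under eq_bigr do rewrite mxE mulr_suml.
rewrite exchange_big; apply: eq_bigr => i _; apply: eq_bigr => j _ /=.
by rewrite mxTE; ring.
Qed.

Lemma fr_mulmx E T a b c e :
  fr E T a b c e = \sum_i \sum_j E i a * E j b * (E^T *m \matrix_(k, l) T i j k l *m E) c e.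
Proof.
rewrite /fr; apply: eq_bigr => i _; apply: eq_bigr => j _; rewrite congrmxE.
do 2 (rewrite mulr_sumr; apply: eq_bigr => ? _).
by rewrite [(\matrix_(_, _) _) _ _]mxE !mulrA.
Qed.

Lemma fr_prod E (A B : 'M[F]_4) a b c e :
  fr E (fun i j k l => A i j * B k l) a b c e = (E^T *m A *m E) a b * (E^T *m B *m E) c e.
Proof.
rewrite fr_mulmx congrmxE mulr_suml; apply: eq_bigr => i _; rewrite mulr_suml.
apply: eq_bigr => j _; rewrite -[RHS]mulrA; congr (_ * _).
have -> : \matrix_(k, l) (A i j * B k l) = A i j *: B by apply/matrixP => k l; rewrite !mxE.
by rewrite -scalemxAr -scalemxAl mxZE.
Qed.

Definition curvature_like T := [/\ forall i j k l, T i j k l = - T j i k l,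
  forall i j k l, T i j k l = - T i j l k &
  forall i j k l, T i j k l + T i k l j + T i l j k = 0].

Lemma curvature_like_fr E T : curvature_like T -> curvature_like (fr E T).
Proof.
move=> [T1 T2 T3]; split => a b c e.
- by rewrite -fr_swap12 -frN; apply: eq_fr => *; rewrite -T1.
- by rewrite -fr_swap34 -frN; apply: eq_fr => *; rewrite -T2.
- rewrite -[fr E T a c e b]fr_swap34 -[fr E _ a c b e]fr_swap23.
  rewrite -[fr E T a e b c]fr_swap23 -[fr E _ a b e c]fr_swap34 -!frD.
  by rewrite -[RHS](fr0 E a b c e); apply: eq_fr => i j k l; rewrite -(T3 i j k l) addrAC; ring.
Qed.

(** The usual octahedron argument: a linear combination of four Bianchi identities. *)
Lemma curvature_like_pair T : curvature_like T -> forall i j k l, T i j k l = T k l i j.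
Proof.
move=> [T1 T2 T3] i j k l.
have := T3 i j k l; have := T3 j k l i; have := T3 k l i j; have := T3 l i j k.
rewrite (T1 j i k l) (T1 l k i j) (T1 k i j l) (T2 i k j l) (T1 j l i k) (T2 l j k i).
rewrite (T1 l i j k) (T1 k j l i) (T2 j k l i).
lra.
Qed.

Definition lric h T j l := \sum_i \sum_k h i k * T k j i l.
Definition lscal h T := \sum_j \sum_l h j l * lric h T j l.
Definition lweyl g h T i j k l := T i j k l
  - 2^-1 * (g i k * lric h T j l - g i l * lric h T j k
            + g j l * lric h T i k - g j k * lric h T i l)
  + 6^-1 * lscal h T * (g i k * g j l - g i l * g j k).

Lemma dot_congr E (J S : 'M[F]_4) :
  \sum_i \sum_k (E *m J *m E^T) i k * S i k = \sum_a \sum_c J a c * (E^T *m S *m E) a c.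
Proof.
have dotE (X Y : 'M[F]_4) : \sum_i \sum_k X i k * Y i k = \tr (X^T *m Y).
  rewrite exchange_big; apply: eq_bigr => k _; rewrite mxE.
  by apply: eq_bigr => i _; rewrite mxTE.
by rewrite !dotE !trmx_mul trmxK -!mulmxA mxtrace_mulC -!mulmxA.
Qed.

Lemma lric_fr E J T b e :
  (E^T *m (\matrix_(j, l) lric (E *m J *m E^T) T j l) *m E) b e = lric J (fr E T) b e.
Proof.
pose S := \matrix_(i, k) \sum_j \sum_l E j b * E l e * T k j i l.
transitivity (\sum_i \sum_k (E *m J *m E^T) i k * S i k).
  rewrite congrmxE.
  transitivity (\sum_j \sum_l \sum_i \sum_k (E *m J *m E^T) i k * (E j b * E l e * T k j i l)).
    do 2 (apply: eq_bigr => ? _); rewrite mxE /lric.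
    by do 2 (rewrite mulr_sumr; apply: eq_bigr => ? _); rewrite mulrCA.
  under eq_bigr do rewrite exchange_big; rewrite exchange_big.
  apply: eq_bigr => i _; under eq_bigr do rewrite exchange_big; rewrite exchange_big.
  apply: eq_bigr => k _; rewrite [S _ _]mxE.
  by do 2 (rewrite mulr_sumr; apply: eq_bigr => ? _).
rewrite dot_congr; apply: eq_bigr => a _; apply: eq_bigr => c _.
congr (_ * _); rewrite congrmxE exchange_big; apply: eq_bigr => k _.
transitivity (\sum_i \sum_j \sum_l E k c * E j b * E i a * E l e * T k j i l).
  apply: eq_bigr => i _; rewrite mxE mulr_sumr; apply: eq_bigr => j _.
  by rewrite mulr_sumr; apply: eq_bigr => l _; ring.
by rewrite exchange_big.
Qed.

(** The inverse metric is written [E *m J *m E^T] because this is how a frame supplies it; [J] is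
    then the inverse metric in the frame. *)
Lemma lweyl_fr E J g T a b c e :
  fr E (lweyl g (E *m J *m E^T) T) a b c e = lweyl (E^T *m g *m E) J (fr E T) a b c e.
Proof.
set h := E *m J *m E^T; pose Ric := \matrix_(j, l) lric h T j l.
have RicE b' e' : (E^T *m Ric *m E) b' e' = lric J (fr E T) b' e' by exact: lric_fr.
have sE : lscal h T = lscal J (fr E T).
  transitivity (\sum_i \sum_k h i k * Ric i k).
    by do 2 (apply: eq_bigr => ? _); rewrite [Ric _ _]mxE.
  by rewrite dot_congr; do 2 (apply: eq_bigr => ? _); rewrite RicE.
rewrite /lweyl -sE -!RicE.
transitivity (fr E (fun i j k l => T i j k l + ((- 2^-1) * ((g i k * Ric j l + - (g i l * Ric j k))
    + (g j l * Ric i k + - (g j k * Ric i l)))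
    + (6^-1 * lscal h T) * (g i k * g j l + - (g i l * g j k)))) a b c e).
  by apply: eq_fr => i j k l; rewrite ![Ric _ _]mxE; ring.
have P1 (A B : 'M[F]_4) c' : fr E (fun i j k l => A i k * B j l) a b c' e = (E^T *m A *m
  E) a c' * (E^T *m B *m E) b e.
  by rewrite -fr_prod -fr_swap23.
have P2 (A B : 'M[F]_4) : fr E (fun i j k l => A i l * B j k) a b c e = (E^T *m A *m E)
  a e * (E^T *m B *m E) b c.
  have P1' (c' e' : 'I_4) : fr E (fun i j k l => A i k * B j l) a b c' e' = (E^T *m A *m
    E) a c' * (E^T *m B *m E) b e'.
    by rewrite -fr_prod -fr_swap23.
  by rewrite -P1' -fr_swap34.
have P3 (A B : 'M[F]_4) : fr E (fun i j k l => A j l * B i k) a b c e = (E^T *m A *m E)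
  b e * (E^T *m B *m E) a c.
  by rewrite mulrC -P1 //; apply: eq_fr => *; rewrite mulrC.
have P4 (A B : 'M[F]_4) : fr E (fun i j k l => A j k * B i l) a b c e = (E^T *m A *m E)
  b c * (E^T *m B *m E) a e.
  by rewrite mulrC -P2 //; apply: eq_fr => *; rewrite mulrC.
rewrite !(frD, frZ, frN) !P1 // !P2 !P3 !P4; ring.
Qed.

End Frames.

(** Gram matrix of a frame of null vectors in which [e_0] is dual to [e_2] and [e_1] to [e_3]. It is
    its own inverse, so it serves both as metric and as inverse metric. *)
Definition nullJ (F : comNzRingType) : 'M[F]_4 := mx4
  [:: [:: 0; 0; 1; 0]; [:: 0; 0; 0; 1]; [:: 1; 0; 0; 0]; [:: 0; 1; 0; 0]].

Section NullFrame.
Variable F : realFieldType.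
Local Notation J := (nullJ F).
Variable r : 'I_4 -> 'I_4 -> 'I_4 -> 'I_4 -> F.
Hypothesis rC : curvature_like r.

Lemma lric_J j l : lric J r j l = r o2 j o0 l + r o0 j o2 l + r o3 j o1 l + r o1 j o3 l.
Proof. by rewrite /lric !sum4 !mxE /=; ring. Qed.

Lemma lscal_J : lscal J r = 2 * (lric J r o0 o2 + lric J r o1 o3).
Proof.
have ricC j l : lric J r j l = lric J r l j.
  have P := curvature_like_pair rC.
  by rewrite !lric_J (P o2 j) (P o0 j) (P o3 j) (P o1 j); ring.
by rewrite /lscal !sum4 !mxE /= (ricC o2 o0) (ricC o3 o1); ring.
Qed.

(** The five components of the quartic [r] on the totally null planes of the
    family containing [<e_0, e_1>] and [<e_2, e_3>]. *)
Hypothesis q0 : r o0 o1 o0 o1 = 0.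
Hypothesis q1 : r o0 o1 o0 o2 + r o0 o1 o1 o3 = 0.
Hypothesis q2 : 2 * r o0 o1 o2 o3 + (r o0 o2 o0 o2 + 2 * r o0 o2 o1 o3 + r o1 o3 o1 o3) = 0.
Hypothesis q3 : r o2 o3 o0 o2 + r o2 o3 o1 o3 = 0.
Hypothesis q4 : r o2 o3 o2 o3 = 0.

(** The three combinations are the pairings of the Weyl tensor with a basis of one duality space of
    bivectors. There the Weyl tensor is a trace-free quadratic form, given by the five components of
    the quartic, and it never pairs the two duality spaces. *)
Lemma lweyl_J_null c e : [/\ lweyl J J r o0 o1 c e = 0, lweyl J J r o2 o3 c e = 0 &
   lweyl J J r o0 o2 c e + lweyl J J r o1 o3 c e = 0].
Proof.
have P := curvature_like_pair rC; have [T1 T2 T3] := rC.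
have D1 i k l : r i i k l = 0 by have := T1 i i k l; lra.
have D2 i k l : r k l i i = 0 by have := T2 k l i i; lra.
have S1 := (T1 o1 o0, T1 o2 o0, T1 o3 o0, T1 o2 o1, T1 o3 o1, T1 o3 o2).
have S2 i j := (T2 i j o1 o0, T2 i j o2 o0, T2 i j o3 o0, T2 i j o2 o1, T2 i j o3 o1, T2 i j o3 o2).
have S3 := (P o0 o2 o0 o1, P o0 o3 o0 o1, P o1 o2 o0 o1, P o1 o3 o0 o1, P o2 o3 o0 o1,
  P o0 o3 o0 o2, P o1 o2 o0 o2, P o1 o3 o0 o2, P o2 o3 o0 o2,
  P o1 o2 o0 o3, P o1 o3 o0 o3, P o2 o3 o0 o3, P o1 o3 o1 o2, P o2 o3 o1 o2, P o2 o3 o1 o3).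
have B := T3 o0 o1 o2 o3.
move: q0 q1 q2 q3 q4 B.
rewrite ?S1 ?S2 ?S3 => h0 h1 h2 h3 h4 B.
split; move: c e; apply: ord4P; apply: ord4P; rewrite /lweyl lscal_J !lric_J !mxE /= ?D1
  ?D2 ?S1 ?S2 ?S3 ?D1 ?D2; lra.
Qed.

End NullFrame.

Section HodgeFrame.
Variable R : realType.
Local Notation J := (nullJ R).
Variables (g h E : 'M[R]_4) (W : 'I_4 -> 'I_4 -> 'I_4 -> 'I_4 -> R).
Hypotheses (gT : g^T = g) (gh : g *m h = 1%:M) (EgE : E^T *m g *m E = J).
Local Notation Wl := (fun i j k l => \sum_m g i m * W m j k l).
Hypothesis Ws : forall i j k l, Wl i j k l = - Wl j i k l.
Hypothesis W01 : forall c e, fr E Wl o0 o1 c e = 0.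
Hypothesis W23 : forall c e, fr E Wl o2 o3 c e = 0.
Hypothesis W02 : forall c e, fr E Wl o0 o2 c e + fr E Wl o1 o3 c e = 0.

Lemma nullJ_sq : J *m J = 1%:M.
Proof.
by apply/matrixP; apply: ord4P; apply: ord4P; rewrite mulmx4E !mxE /=; ring.
Qed.

Lemma nullJ_sym : J^T = J.
Proof. by apply/matrixP; apply: ord4P; apply: ord4P; rewrite !mxE. Qed.

Lemma frame_inv : E *m J *m E^T = h.
Proof.
have JE : J *m E^T *m g *m E = 1%:M by rewrite -!mulmxA (mulmxA E^T) EgE nullJ_sq.
have := mulmx1C JE; rewrite !mulmxA => {}JE.
by rewrite -[LHS]mulmx1 -gh mulmxA JE mul1mx.
Qed.

Lemma frame_dual : E^T *m (g *m E *m J) = 1%:M.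
Proof. by rewrite !mulmxA EgE nullJ_sq. Qed.

Lemma fr_swap_pairs T a b c e : fr E T a b c e =
  (E^T *m (\matrix_(k, l) (E^T *m \matrix_(i, j) T i j k l *m E) a b) *m E) c e.
Proof.
rewrite congrmxE /fr.
under eq_bigr do rewrite exchange_big; rewrite exchange_big; apply: eq_bigr => k _.
under eq_bigr do rewrite exchange_big; rewrite exchange_big; apply: eq_bigr => l _.
rewrite mxE congrmxE mulr_sumr; apply: eq_bigr => i _.
by rewrite mulr_sumr; apply: eq_bigr => j _; rewrite mxE; ring.
Qed.

Lemma congrmx_eq0 (N : 'M[R]_4) : (forall c e, (E^T *m N *m E) c e = 0) -> N = 0.
Proof.
move=> N0; have N1 : E^T *m N *m E = 0 by apply/matrixP => c e; rewrite N0 mxE.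
have D := frame_dual; have D' := mulmx1C D.
have DT : E *m (g *m E *m J)^T = 1%:M by rewrite -[E]trmxK -trmx_mul trmxK D' trmx1.
rewrite -[N]mulmx1 -DT -[N]mul1mx -D' !mulmxA.
have -> : g *m E *m J *m E^T *m N *m E = g *m E *m J *m (E^T *m N *m E) by rewrite !mulmxA.
by rewrite N1 mulmx0 mul0mx.
Qed.

Lemma alternating_congr (X b : 'M[R]_4) : alternating b -> alternating (X *m b *m X^T).
Proof.
move=> [bs b0]; have bT : b^T = - b by apply/matrixP => i j; rewrite mxNE mxTE bs.
have S i j : (X *m b *m X^T) i j = - (X *m b *m X^T) j i.
  by rewrite -[X in _ = - X]mxTE !trmx_mul trmxK bT mulNmx mulmxN mxNE opprK mulmxA.
by split=> // i; have := S i i; lra.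
Qed.

(** For fixed [k] and [l] the hypotheses say that the first index pair, read in the frame, lies in
    one duality space, where [hat] composed with [J] is minus the identity. Returning to coordinates
    brings the factor [\det E], while [sqrt (det g)] is the inverse of its absolute value; only the
    orientation of the frame survives. *)
Lemma hodge_frame i j k l :
  2^-1 * Num.sqrt (\det g) * (\sum_a \sum_b \sum_c \sum_e
    h i a * h b c * levi_civita R a j b e * W e c k l) = Num.sg (\det E) * W i j k l.
Proof.
pose A : 'M[R]_4 := \matrix_(i', j') Wl i' j' k l.
pose al := E^T *m A *m E.
have hT : h^T = h.
  have hg := mulmx1C gh; have : h^T *m g = 1%:M by rewrite -{1}gT -trmx_mul gh trmx1.
  by move=> E1; rewrite -[LHS]mulmx1 -gh mulmxA E1 mul1mx.
have As i' j' : A i' j' = - A j' i' by rewrite !mxE Ws.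
have als a b : al a b = - al b a.
  rewrite -[al b a]mxTE /al !trmx_mul trmxK -mulmxA.
  have -> : A^T = - A by apply/matrixP => i' j'; rewrite mxTE mxNE As.
  by rewrite mulNmx mulmxN mxNE opprK.
have al0 a : al a a = 0 by have := als a a; lra.
have al01 : al o0 o1 = 0.
  have N0 : \matrix_(k', l') (E^T *m \matrix_(i', j') Wl i' j' k' l' *m E) o0 o1 = 0.
    by apply: congrmx_eq0 => c e; rewrite -fr_swap_pairs.
  by move/matrixP/(_ k l): N0; rewrite !mxE.
have al23 : al o2 o3 = 0.
  have N0 : \matrix_(k', l') (E^T *m \matrix_(i', j') Wl i' j' k' l' *m E) o2 o3 = 0.
    by apply: congrmx_eq0 => c e; rewrite -fr_swap_pairs.
  by move/matrixP/(_ k l): N0; rewrite !mxE.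
have al02 : al o0 o2 = - al o1 o3.
  have N0 : (\matrix_(k', l') (E^T *m \matrix_(i', j') Wl i' j' k' l' *m E) o0 o2)
    + (\matrix_(k', l') (E^T *m \matrix_(i', j') Wl i' j' k' l' *m E) o1 o3) = 0.
    by apply: congrmx_eq0 => c e; rewrite mulmxDr mulmxDl mxDE -!fr_swap_pairs.
  by move/matrixP/(_ k l): N0; rewrite !mxE => /eqP; rewrite addr_eq0 => /eqP.
have JalJ : alternating (J *m al *m J) /\ hat (J *m al *m J) = - al.
  have e1 := (als o1 o0, als o2 o0, als o3 o0, als o2 o1, als o3 o1, als o3 o2).
  have Je a b : (J *m al *m J) a b = al (nth o0 [:: o2; o3; o0; o1] a) (nth o0 [:: o2;
    o3; o0; o1] b).
    rewrite mulmx4E ![(J *m al) _ _]mulmx4E ![J _ _]mxE.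
    by move: a b; apply: ord4P; apply: ord4P; rewrite /=; ring.
  split; first by split=> [a b|a]; rewrite !Je ?al0 // als.
  apply/matrixP; apply: ord4P; apply: ord4P; rewrite mxNE mxE /= ?Je /= ?al0 ?e1 ?al01
    ?al23 ?al02 ?opprK ?oppr0 //.
have [Jalt Jhat] := JalJ.
have X := frame_dual; have X' := mulmx1C X; set D := g *m E *m J in X X'.
have DT : E *m D^T = 1%:M by rewrite -[E]trmxK -trmx_mul X' trmx1.
have DT' := mulmx1C DT.
have AE : A = D *m al *m D^T by rewrite /al !mulmxA X' mul1mx -mulmxA DT mulmx1.
have hAh : h *m A *m h = E *m (J *m al *m J) *m E^T.
  rewrite AE /D !trmx_mul gT nullJ_sym; have hg := mulmx1C gh.
  by rewrite !mulmxA hg mul1mx -!mulmxA gh mulmx1.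
have hatA : hat (h *m A *m h) = - \det E *: A.
  have := mul_hat_congr E Jalt; rewrite -hAh Jhat => H.
  have -> : hat (h *m A *m h) = D *m (E^T *m hat (h *m A *m h) *m E) *m D^T.
    by move: (hat _) => Hh; rewrite !mulmxA X' mul1mx -mulmxA DT mulmx1.
  by rewrite H -scalemxAr -scalemxAl mulmxN mulNmx scalerN -scaleNr -AE.
have WA e c : W e c k l = (h *m A) e c.
  have hg := mulmx1C gh.
  have -> : A = g *m \matrix_(i', j') W i' j' k l.
    by apply/matrixP => i' j'; rewrite !mxE; apply: eq_bigr => m _; rewrite mxE.
  by rewrite mulmxA hg mul1mx mxE.
have halt : alternating (h *m A *m h).
  by rewrite hAh; exact: alternating_congr.
have -> : \sum_a \sum_b \sum_c \sum_e h i a * h b c * levi_civita R a j b e * W e c k l =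
    2 * \det E * W i j k l.
  transitivity (\sum_a h i a * \sum_b \sum_e levi_civita R a j b e * (h *m A *m h) e b).
    apply: eq_bigr => a _; rewrite mulr_sumr; apply: eq_bigr => b _.
    rewrite exchange_big mulr_sumr; apply: eq_bigr => e _ /=.
    rewrite [(h *m A *m h) e b]mxE !mulr_sumr; apply: eq_bigr => c _.
    by rewrite WA -[h b c]mxTE hT; ring.
  rewrite WA [(h *m A) i j]mxE mulr_sumr; apply: eq_bigr => a _.
  by rewrite levi_civita_contract // hatA mxZE; ring.
have dg : \det g * \det E ^+ 2 = 1.
  have := congr1 determinant EgE; rewrite !det_mulmx det_tr.
  have -> : \det J = 1 by rewrite det4 !mxE /=; ring.
  by move=> <-; ring.
have E0 : \det E != 0 by apply/eqP => E0; move: dg; rewrite E0 expr0n mulr0 => /eqP;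
  rewrite eq_sym oner_eq0.
have -> : Num.sqrt (\det g) = `|\det E|^-1.
  rewrite (_ : \det g = (\det E)^-1 ^+ 2) ?sqrtr_sqr ?normfV //.
  by rewrite -[LHS]mulr1 -(mulfV (expf_neq0 2 E0)) mulrA dg mul1r exprVn.
have N0 : `|\det E| != 0 by rewrite normr_eq0.
rewrite mulrA; congr (_ * _).
transitivity (`|\det E|^-1 * (Num.sg (\det E) * `|\det E|)); last by field.
by rewrite -numEsg; field.
Qed.

End HodgeFrame.

(** * Explicit matrices, and the curvature as a form on bivectors *)

Section ExplicitMatrices.
Variables (K : comNzRingType) (x x00 x01 x02 x03 x10 x11 x12 x13 x20 x21 x22 x23 x30 x31
  x32 x33 y00 y01 y02 y03 y10 y11 y12 y13 y20 y21 y22 y23 y30 y31 y32 y33 : K).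

Lemma mul_mx4 : mx4 [:: [:: x00; x01; x02; x03]; [:: x10; x11; x12; x13]; [:: x20; x21;
  x22; x23]; [:: x30; x31; x32; x33]] *m mx4 [:: [:: y00; y01; y02; y03]; [:: y10; y11;
  y12; y13]; [:: y20; y21; y22; y23]; [:: y30; y31; y32; y33]] = mx4 [:: [:: x00 * y00 +
  x01 * y10 + x02 * y20 + x03 * y30; x00 * y01 + x01 * y11 + x02 * y21 + x03 * y31; x00
  * y02 + x01 * y12 + x02 * y22 + x03 * y32; x00 * y03 + x01 * y13 + x02 * y23 + x03 *
  y33]; [:: x10 * y00 + x11 * y10 + x12 * y20 + x13 * y30; x10 * y01 + x11 * y11 + x12 *
  y21 + x13 * y31; x10 * y02 + x11 * y12 + x12 * y22 + x13 * y32; x10 * y03 + x11 * y13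
  + x12 * y23 + x13 * y33]; [:: x20 * y00 + x21 * y10 + x22 * y20 + x23 * y30; x20 * y01
  + x21 * y11 + x22 * y21 + x23 * y31; x20 * y02 + x21 * y12 + x22 * y22 + x23 * y32;
  x20 * y03 + x21 * y13 + x22 * y23 + x23 * y33]; [:: x30 * y00 + x31 * y10 + x32 * y20
  + x33 * y30; x30 * y01 + x31 * y11 + x32 * y21 + x33 * y31; x30 * y02 + x31 * y12 +
  x32 * y22 + x33 * y32; x30 * y03 + x31 * y13 + x32 * y23 + x33 * y33]].
Proof. by apply/matrixP; apply: ord4P; apply: ord4P; rewrite mulmx4E !mxE. Qed.

Lemma tr_mx4 : (mx4 [:: [:: x00; x01; x02; x03]; [:: x10; x11; x12; x13]; [:: x20; x21;
  x22; x23]; [:: x30; x31; x32; x33]])^T = mx4 [:: [:: x00; x10; x20; x30]; [:: x01;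
  x11; x21; x31]; [:: x02; x12; x22; x32]; [:: x03; x13; x23; x33]].
Proof. by apply/matrixP; apply: ord4P; apply: ord4P; rewrite !mxE. Qed.

Lemma scale_mx4 : x *: mx4 [:: [:: x00; x01; x02; x03]; [:: x10; x11; x12; x13]; [::
  x20; x21; x22; x23]; [:: x30; x31; x32; x33]] = mx4 [:: [:: x * x00; x * x01; x * x02;
  x * x03]; [:: x * x10; x * x11; x * x12; x * x13]; [:: x * x20; x * x21; x * x22; x *
  x23]; [:: x * x30; x * x31; x * x32; x * x33]].
Proof. by apply/matrixP; apply: ord4P; apply: ord4P; rewrite !mxE. Qed.

End ExplicitMatrices.

Section CurvatureForm.
Variable F : realFieldType.
Variable T : 'I_4 -> 'I_4 -> 'I_4 -> 'I_4 -> F.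
Implicit Types (X Y : 'M[F]_4).

Definition curv_form X Y := \sum_k \sum_l X k l * \sum_i \sum_j Y i j * T i j k l.

Lemma curv_formZl x X Y : curv_form (x *: X) Y = x * curv_form X Y.
Proof.
rewrite /curv_form; do 2 (rewrite mulr_sumr; apply: eq_bigr => ? _).
by rewrite mxE mulrA.
Qed.

Lemma curv_formZr x X Y : curv_form X (x *: Y) = x * curv_form X Y.
Proof.
rewrite /curv_form; do 2 (rewrite mulr_sumr; apply: eq_bigr => ? _).
rewrite mulrCA; congr (_ * _); do 2 (rewrite mulr_sumr; apply: eq_bigr => ? _).
by rewrite mxE mulrA.
Qed.

Lemma curv_form_suml (Z : 'I_4 -> 'M[F]_4) Y :
  curv_form (\sum_s Z s) Y = \sum_s curv_form (Z s) Y.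
Proof.
rewrite /curv_form exchange_big; under [RHS]eq_bigr do rewrite exchange_big.
rewrite [RHS]exchange_big; apply: eq_bigr => l _; rewrite exchange_big.
by apply: eq_bigr => k _; rewrite summxE mulr_suml.
Qed.

Lemma curv_formC X Y : curvature_like T -> curv_form X Y = curv_form Y X.
Proof.
move=> TC; rewrite /curv_form.
transitivity (\sum_k \sum_l \sum_i \sum_j X k l * (Y i j * T i j k l)).
  by do 2 (apply: eq_bigr => ? _); rewrite mulr_sumr; apply: eq_bigr => ? _; rewrite mulr_sumr.
under eq_bigr do rewrite exchange_big; rewrite exchange_big.
apply: eq_bigr => i _; under eq_bigr do rewrite exchange_big; rewrite exchange_big.
apply: eq_bigr => j _; rewrite mulr_sumr; apply: eq_bigr => k _.
rewrite mulr_sumr; apply: eq_bigr => l _; rewrite (curvature_like_pair TC i j).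
by ring.
Qed.

Lemma curv_form_sumr X (Z : 'I_4 -> 'M[F]_4) : curvature_like T ->
  curv_form X (\sum_s Z s) = \sum_s curv_form X (Z s).
Proof.
by move=> TC; rewrite curv_formC // curv_form_suml; apply: eq_bigr => s _; rewrite curv_formC.
Qed.

Lemma curv_form_fr (E X Y : 'M[F]_4) :
  curv_form (E *m X *m E^T) (E *m Y *m E^T) =
  \sum_c \sum_e X c e * \sum_a \sum_b Y a b * fr E T a b c e.
Proof.
pose S : 'M[F]_4 := \matrix_(k, l) \sum_i \sum_j (E *m Y *m E^T) i j * T i j k l.
transitivity (\sum_k \sum_l (E *m X *m E^T) k l * S k l).
  by do 2 (apply: eq_bigr => ? _); rewrite [S _ _]mxE.
rewrite dot_congr; apply: eq_bigr => c _; apply: eq_bigr => e _; congr (_ * _).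
rewrite congrmxE.
transitivity (\sum_k \sum_l \sum_a \sum_b Y a b * (E k c * E l e *
   (E^T *m \matrix_(i, j) T i j k l *m E) a b)).
  apply: eq_bigr => k _; apply: eq_bigr => l _; rewrite [S _ _]mxE.
  transitivity (E k c * E l e * \sum_i \sum_j (E *m Y *m E^T) i j * (\matrix_(i, j) T i j k l) i j).
    by congr (_ * _); do 2 (apply: eq_bigr => ? _); rewrite [(\matrix_(_, _) _) _ _]mxE.
  rewrite dot_congr mulr_sumr; apply: eq_bigr => a _.
  by rewrite mulr_sumr; apply: eq_bigr => b _; rewrite mulrCA.
under eq_bigr do rewrite exchange_big; rewrite exchange_big.
apply: eq_bigr => a _; under eq_bigr do rewrite exchange_big; rewrite exchange_big.
apply: eq_bigr => b _; rewrite /fr.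
transitivity (Y a b * \sum_k \sum_l E k c * E l e * (E^T *m \matrix_(i, j) T i j k l *m E) a b).
  by do 2 (rewrite mulr_sumr; apply: eq_bigr => ? _).
congr (_ * _).
transitivity (\sum_k \sum_l \sum_i \sum_j E i a * E j b * E k c * E l e * T i j k l).
  apply: eq_bigr => k _; apply: eq_bigr => l _; rewrite congrmxE mulr_sumr.
  apply: eq_bigr => i _; rewrite mulr_sumr; apply: eq_bigr => j _.
  by rewrite mxE; ring.
under eq_bigr do rewrite exchange_big; rewrite exchange_big.
apply: eq_bigr => i _; under eq_bigr do rewrite exchange_big; rewrite exchange_big.
by [].
Qed.

End CurvatureForm.

(** * An explicit null frame on a solution, and the five components of the quartic *)

Section NullFrameOfSolution.
Variable F : realFieldType.
Variables (x : 'I_4 -> F) (U g h : 'M[F]_4).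
Hypothesis UT : U^T = U.
Local Ltac mx4_eq := congr (mx4 [:: [:: _; _; _; _]; [:: _; _; _; _];
  [:: _; _; _; _]; [:: _; _; _; _]]).
Local Notation a := (c12 x).
Local Notation b := (c13 x).
Local Notation c := (c14 x).
Hypothesis F0 : heav a b c U = 0.
Hypothesis hE : h = 2^-1 *: symbol a b c U.
Hypotheses (gT : g^T = g) (gh : g *m h = 1%:M).
Let kappa := 4^-1 * kap a b U.
Hypothesis kappa0 : kappa != 0.

(** On a solution [delta] is the determinant of the Gram block [G00], [G01], [G10], [G11] between
    the two null pairs of covectors. The equation gives it this form, in which [b * c * delta] is a
    square. *)
Let q := U o0 o2 * U o1 o3 - U o0 o3 * U o1 o2.
Let delta := 4^-1 * b * c * q ^+ 2.

Let G00 := 2^-1 * a * U o2 o3.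
Let G01 := - (2^-1 * a * U o1 o2 * U o1 o3).
Let G10 := - (2^-1 * a * U o0 o2 * U o0 o3).
Let G11 := 2^-1 * a * U o0 o1 *
  (- U o0 o1 * U o2 o3 + U o0 o2 * U o1 o3 + U o0 o3 * U o1 o2).

(** The rows are the covectors [dx_1], [du_1 - u_11 dx_1], [dx_2] and
    [du_2 - u_22 dx_2]. *)
Let Th : 'M[F]_4 := mx4
  [:: [:: 1; 0; 0; 0]; [:: 0; U o0 o1; U o0 o2; U o0 o3];
      [:: 0; 1; 0; 0]; [:: U o0 o1; 0; U o1 o2; U o1 o3]].

(** The lower right block is the inverse of the Gram block. It normalises the second null pair
    against the first, so that the Gram matrix becomes [nullJ]. *)
Let P : 'M[F]_4 := mx4
  [:: [:: 1; 0; 0; 0]; [:: 0; 1; 0; 0];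
      [:: 0; 0; G11 / delta; - (G01 / delta)];
      [:: 0; 0; - (G10 / delta); G00 / delta]].

(** [S01], [S23] and [Sf] are the bivectors [e_0 /\ e_1], [e_2 /\ e_3] and
    [e_0 /\ e_2 + e_1 /\ e_3], a basis of one duality space. *)
Definition S01 : 'M[F]_4 := mx4
  [:: [:: 0; 1; 0; 0]; [:: -1; 0; 0; 0]; [:: 0; 0; 0; 0]; [:: 0; 0; 0; 0]].
Definition S23 : 'M[F]_4 := mx4
  [:: [:: 0; 0; 0; 0]; [:: 0; 0; 0; 0]; [:: 0; 0; 0; 1]; [:: 0; 0; -1; 0]].
Definition Sf : 'M[F]_4 := mx4
  [:: [:: 0; 0; 1; 0]; [:: 0; 0; 0; 1]; [:: -1; 0; 0; 0]; [:: 0; -1; 0; 0]].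

Lemma sum_S01 (f : 'I_4 -> 'I_4 -> F) :
  \sum_k \sum_l S01 k l * f k l = f o0 o1 - f o1 o0.
Proof. by rewrite !sum4 !mxE /=; ring. Qed.

Lemma sum_S23 (f : 'I_4 -> 'I_4 -> F) :
  \sum_k \sum_l S23 k l * f k l = f o2 o3 - f o3 o2.
Proof. by rewrite !sum4 !mxE /=; ring. Qed.

Lemma sum_Sf (f : 'I_4 -> 'I_4 -> F) :
  \sum_k \sum_l Sf k l * f k l = f o0 o2 + f o1 o3 - f o2 o0 - f o3 o1.
Proof. by rewrite !sum4 !mxE /=; ring. Qed.

Let E := h *m Th^T *m P.

Let cE : c = - (a + b). Proof. by rewrite -[RHS]add0r -(c_sum x); ring. Qed.

Let key (p y z : F) : y - z = p * heav a b c U -> y = z.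
Proof. by rewrite F0 mulr0 => /eqP; rewrite subr_eq0 => /eqP. Qed.

(** The equation turns [a] times the last factor of [kap] into [- (c * q)], so [kappa0] also
    controls [c] and [q]. *)
Let abq : [/\ a != 0, b != 0, c != 0 & q != 0].
Proof.
have : kappa != 0 by [].
rewrite /kappa /kap mulf_eq0 negb_or => /andP[_].
rewrite mulf_eq0 negb_or => /andP[]; rewrite mulf_eq0 negb_or => /andP[a0 b0] AB.
have W : a * (U o0 o1 * U o2 o3 - U o0 o2 * U o1 o3) = c * q.
  by apply: (key (p := 1)); rewrite /q /heav cE; ring.
have : c * q != 0.
  by rewrite -W; apply: mulf_neq0 => //; rewrite -oppr_eq0 opprB.
by rewrite mulf_eq0 negb_or => /andP[].
Qed.

Let Us i j : U i j = U j i. Proof. by rewrite -{1}UT mxTE. Qed.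
Let Us' := (Us o1 o0, Us o2 o0, Us o3 o0, Us o2 o1, Us o3 o1, Us o3 o2).

Let delta0 : delta != 0.
Proof.
have [a0 b0 c0 q0] := abq.
apply: mulf_neq0; last exact: expf_neq0.
by apply: mulf_neq0 => //; apply: mulf_neq0 => //; rewrite invr_eq0 pnatr_eq0.
Qed.

Let detG : G00 * G11 - G01 * G10 = delta.
Proof.
apply: (key (p := 4^-1 * (- U o0 o1 * U o2 o3 * a + U o0 o2 * U o1 o3 * a + U o0 o2 * U o1 o3 * b
  - U o1 o2 * U o0 o3 * b))).
by rewrite /G00 /G11 /G01 /G10 /delta /q /heav cE; field.
Qed.

Let gram : Th *m h *m Th^T = mx4
  [:: [:: 0; 0; G00; G01]; [:: 0; 0; G10; G11]; [:: G00; G10; 0; 0]; [:: G01; G11; 0; 0]].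
Proof.
have hT : h^T = h by rewrite hE linearZ /= symbol_sym.
set L := LHS; have Ls i j : L i j = L j i.
  by rewrite -[RHS]mxTE /L !trmx_mul trmxK hT mulmxA.
set N := RHS; have Ns i j : N i j = N j i.
  by move: i j; apply: ord4P; apply: ord4P; rewrite !mxE.
suff W (i j : 'I_4) : (i <= j)%N -> L i j = N i j.
  by apply/matrixP => i j; case: (leqP i j) => [/W //|/ltnW ij]; rewrite Ls Ns W.
rewrite /L hE -scalemxAr -scalemxAl mxZE mulmx4E ![(Th *m _) _ _]mulmx4E !mxE.
move: i j; apply: ord4P; apply: ord4P => //= _; rewrite /G00 /G01 /G10 /G11 ?Us'.
all: try by rewrite ?cE; field.
- by apply: (key (p := 2^-1)); rewrite /heav; field.
- by apply: (key (p := U o0 o1)); rewrite /heav cE; field.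
- by apply: (key (p := 2^-1)); rewrite /heav; field.
Qed.

Let ThE : Th *m E = mx4
  [:: [:: 0; 0; 1; 0]; [:: 0; 0; 0; 1]; [:: G00; G10; 0; 0]; [:: G01; G11; 0; 0]].
Proof.
rewrite /E !mulmxA gram /P mul_mx4; mx4_eq; try by ring.
all: by rewrite -detG; field; rewrite ?detG ?delta0.
Qed.

Lemma null_frame_gram : E^T *m g *m E = nullJ F.
Proof.
have hT : h^T = h by rewrite hE linearZ /= symbol_sym.
have -> : E^T *m g *m E = P^T *m (Th *m E).
  rewrite /E !trmx_mul trmxK hT -!mulmxA; congr (_ *m (_ *m _)).
  by rewrite mulmxA (mulmx1C gh) mul1mx.
rewrite ThE /P tr_mx4 mul_mx4 /nullJ; mx4_eq; try by ring.
all: by rewrite -detG; field; rewrite ?detG ?delta0.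
Qed.

Let P_S01 : P *m S01 *m P^T = S01.
Proof. by rewrite /P /S01 tr_mx4 !mul_mx4; mx4_eq; ring. Qed.

Let P_S23 : P *m S23 *m P^T = delta^-1 *: S23.
Proof.
rewrite /P /S23 tr_mx4 !mul_mx4 scale_mx4; mx4_eq; try by ring.
all: by rewrite -detG; field; rewrite ?detG ?delta0.
Qed.

Let Phi : 'M[F]_4 := mx4
  [:: [:: 0; 0; G11; - G10]; [:: 0; 0; - G01; G00];
      [:: - G11; G01; 0; 0]; [:: G10; - G00; 0; 0]].

Let P_Sf : P *m Sf *m P^T = delta^-1 *: Phi.
Proof. by rewrite /P /Sf tr_mx4 !mul_mx4 scale_mx4; mx4_eq; ring. Qed.

Let dl (i j : 'I_4) : F := (i == j)%:R.

Let Om0 : Om (dl o0) U = Th^T *m S01 *m Th.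
Proof.
rewrite /Th /S01 tr_mx4 !mul_mx4; apply/matrixP; apply: ord4P; apply: ord4P.
all: by rewrite !mxE /dl /= ?Us'; ring.
Qed.

Let Om1 : Om (dl o1) U = Th^T *m S23 *m Th.
Proof.
rewrite /Th /S23 tr_mx4 !mul_mx4; apply/matrixP; apply: ord4P; apply: ord4P.
all: by rewrite !mxE /dl /= ?Us'; ring.
Qed.

(** The indicators of the first two coordinates give multiples of [S01] and [S23]. These values of
    [s] give a multiple of the remaining basis vector [Sf]. *)
Let sf (i : 'I_4) : F := nth 0 [:: - c; - b; a; 0] i.

Let Omf : q *: Om sf U = 2 *: (Th^T *m Phi *m Th).
Proof.
have PhiT : Phi^T = - Phi.
  by apply/matrixP; apply: ord4P; apply: ord4P; rewrite !mxE /= ?opprK ?oppr0.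
set L := LHS; have Ls i j : L i j = - L j i.
  by have [s _] := Om_alternating sf UT; rewrite !mxZE s mulrN.
have L0 i : L i i = 0 by have [_ s] := Om_alternating sf UT; rewrite mxZE s mulr0.
set N := RHS; have Ns i j : N i j = - N j i.
  rewrite -[X in _ = - X]mxTE linearZ /= !trmx_mul trmxK PhiT mulNmx mulmxN.
  by rewrite scalerN mxNE opprK mulmxA.
suff W (i j : 'I_4) : (i < j)%N -> L i j = N i j.
  apply/matrixP => i j; case: (ltngtP i j) => [/W //|ij|/val_inj ->].
    by rewrite Ls Ns W.
  by rewrite L0; have := Ns j j; lra.
rewrite /L /N !mxZE mulmx4E ![(Th^T *m _) _ _]mulmx4E !mxE.
move: i j; apply: ord4P; apply: ord4P => //= _; rewrite /G00 /G01 /G10 /G11 /q /sf /= ?Us' ?cE.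
- by apply: (key (p := 2 * U o0 o1)); rewrite /heav cE; field.
- by apply: (key (p := U o0 o2)); rewrite /heav cE; field.
- by apply: (key (p := U o0 o3)); rewrite /heav cE; field.
- by apply: (key (p := - U o1 o2)); rewrite /heav cE; field.
- by apply: (key (p := - U o1 o3)); rewrite /heav cE; field.
- by field.
Qed.

(** Compares the scale of [Sf] in the third form with the scale [delta] of [S23] in the second; the
    middle component of the quartic depends on it. *)
Lemma sqr_q_f : (2^-1 * b * c * q) ^+ 2 = b * c * delta.
Proof. by rewrite /delta; field. Qed.

Let gram_form (S : 'M[F]_4) (s : 'I_4 -> F) : Om s U = Th^T *m P *m S *m P^T *m Th ->
  h *m Om s U *m h = E *m S *m E^T.
Proof.
have hT : h^T = h by rewrite hE linearZ /= symbol_sym.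
by move=> ->; rewrite /E !trmx_mul trmxK hT !mulmxA.
Qed.

Lemma null_frame_Om0 : h *m Om (dl o0) U *m h = E *m S01 *m E^T.
Proof. by apply: gram_form; rewrite Om0 -{1}P_S01 !mulmxA. Qed.

Lemma null_frame_Om1 : h *m Om (dl o1) U *m h = E *m (delta *: S23) *m E^T.
Proof.
apply: gram_form; rewrite Om1 -!mulmxA; congr (_ *m _).
have -> : P *m ((delta *: S23) *m (P^T *m Th)) = (delta *: (P *m S23 *m P^T)) *m Th.
  by rewrite !mulmxA -scalemxAr -!scalemxAl.
by rewrite P_S23 scalerA mulfV // scale1r.
Qed.

Lemma null_frame_Omf : h *m Om sf U *m h = E *m ((2^-1 * b * c * q) *: Sf) *m E^T.
Proof.
have [a0 b0 c0 q0] := abq.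
apply: gram_form; apply: (scalerI q0); rewrite Omf -!mulmxA.
have -> (y : F) : Th^T *m (P *m ((y *: Sf) *m (P^T *m Th))) = y *: (Th^T *m (P *m Sf *m P^T) *m Th).
  by rewrite !mulmxA -scalemxAr -!scalemxAl.
rewrite P_Sf -!scalemxAr -!scalemxAl !scalerA mulmxA; congr (_ *: _).
rewrite mulrA (_ : q * (2^-1 * b * c * q) = 2 * delta); last by rewrite /delta; field.
by rewrite mulfK.
Qed.

(** The duality relation for the first form, read in the frame, gives [kappa * \det g * \det E = 1]
    in its entry (2, 3). The Gram matrix gives [\det g * \det E ^+ 2 = 1]. *)
Lemma null_frame_det : \det E = kappa.
Proof.
have hO : h *m Om (dl o0) U *m h = kappa *: hat (Om (dl o0) U).
  rewrite hE -scalemxAr -!scalemxAl scalerA symbol_Om //; last exact: c_sum.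
  by rewrite scalerA; congr (_ *: _); rewrite /kappa; field.
have OE : Om (dl o0) U = (g *m E) *m S01 *m (g *m E)^T.
  have -> : (g *m E) *m S01 *m (g *m E)^T = g *m (E *m S01 *m E^T) *m g.
    by rewrite trmx_mul gT !mulmxA.
  by rewrite -null_frame_Om0 !mulmxA gh mul1mx -mulmxA (mulmx1C gh) mulmx1.
have S01a : alternating S01.
  split; last by apply: ord4P; rewrite mxE.
  by apply: ord4P; apply: ord4P; rewrite !mxE /= ?opprK ?oppr0.
have := mul_hat_congr (g *m E) S01a; rewrite -OE.
move=> /(congr1 ( *:%R kappa)).
rewrite scalemxAl scalemxAr -hO null_frame_Om0.
have -> : (g *m E)^T *m (E *m S01 *m E^T) *m (g *m E) =
    (E^T *m g *m E) *m S01 *m (E^T *m g *m E) by rewrite trmx_mul gT !mulmxA.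
rewrite null_frame_gram => /matrixP/(_ o2 o3).
rewrite mulmx4E ![(_ *m S01) _ _]mulmx4E !mxE /= det_mulmx => e1.
have dg : \det g * \det E ^+ 2 = 1.
  have det_gram (X : 'M[F]_4) : X^T *m g *m X = nullJ F -> \det g * \det X ^+ 2 = 1.
    move=> /(congr1 determinant); rewrite !det_mulmx det_tr.
    have -> : \det (nullJ F) = 1 by rewrite det4 !mxE /=; ring.
    by move=> <-; ring.
  exact: det_gram null_frame_gram.
have E0 : \det E != 0 by apply/eqP => E0; move: dg; rewrite E0 expr0n mulr0 => /eqP;
  rewrite eq_sym oner_eq0.
have e2 : kappa * (\det g * \det E) = 1 by lra.
apply: (mulIf E0); have g0 : \det g != 0.
  by apply/eqP => g0; move: dg; rewrite g0 mul0r => /eqP; rewrite eq_sym oner_eq0.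
by apply: (mulfI g0); rewrite -expr2 dg -e2; ring.
Qed.

Section Quartic.
Variable T : 'I_4 -> 'I_4 -> 'I_4 -> 'I_4 -> F.
Hypothesis TC : curvature_like T.
Hypothesis T_delta : forall i,
  curv_form T (hat (Om (fun j => (i == j)%:R) U)) (hat (Om (fun j => (i == j)%:R) U)) = 0.
Hypothesis T_x : curv_form T (hat (Om x U)) (hat (Om x U)) = 0.

Let Z s := h *m Om s U *m h.
Let C s t := curv_form T (Z s) (Z t).
Let p i j := C (dl i) (dl j).

Let Z_hat s : Z s = kappa *: hat (Om s U).
Proof.
rewrite /Z hE -scalemxAr -!scalemxAl scalerA symbol_Om //; last exact: c_sum.
by rewrite scalerA; congr (_ *: _); rewrite /kappa; field.
Qed.

Let Z_sum s : Z s = \sum_i s i *: Z (dl i).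
Proof.
transitivity (h *m (\sum_i s i *: Om (dl i) U) *m h).
  congr (_ *m _ *m _); apply/matrixP => i j; rewrite summxE sum4 !mxE /dl.
  by move: i j; apply: ord4P; apply: ord4P; rewrite /=; ring.
rewrite mulmx_sumr mulmx_suml; apply: eq_bigr => i _.
by rewrite -scalemxAr -scalemxAl.
Qed.

Let C_sum s t : C s t = \sum_i \sum_j s i * t j * p i j.
Proof.
rewrite /C (Z_sum s) curv_form_suml; apply: eq_bigr => i _.
rewrite (Z_sum t) curv_form_sumr //; apply: eq_bigr => j _.
by rewrite curv_formZl curv_formZr mulrA.
Qed.

(** [C] is a quadratic form in [s] modulo constants, hence has six coefficients. Vanishing at the
    four indicators and at [x] leaves one free parameter, here [p o0 o1]: [C] is a multiple of the
    Pfaffian conic. *)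
Let quadric_eqs : [/\ p o0 o0 = 0, p o1 o1 = 0, a * p o0 o2 = b * p o0 o1,
  a * p o1 o2 = c * p o0 o1 & C sf sf = - 2 * b * c * p o0 o1].
Proof.
have [a0 b0 c0 q0] := abq.
have pC i j : p i j = p j i by rewrite /p /C curv_formC.
have p0 i : p i i = 0.
  by rewrite /p /C !Z_hat curv_formZl curv_formZr T_delta !mulr0.
have ps i : p i o0 + p i o1 + p i o2 + p i o3 = 0.
  have Z1 : Z (fun _ => 1) = 0.
    rewrite /Z (_ : Om _ U = 0) ?mulmx0 ?mul0mx //.
    by apply/matrixP => k l; rewrite !mxE subrr mul0r.
  have := C_sum (dl i) (fun _ => 1); rewrite {1}/C Z1.
  rewrite -(scale0r (0 : 'M[F]_4)) curv_formZr mul0r.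
  have dlE : \sum_k \sum_j dl i k * 1 * p k j = \sum_j p i j.
    by rewrite sum4 /dl !sum4; move: i; apply: ord4P => /=; ring.
  by rewrite dlE sum4.
have px : \sum_i \sum_j x i * x j * p i j = 0.
  by rewrite -C_sum /C !Z_hat curv_formZl curv_formZr T_x !mulr0.
have s0 := ps o0; have s1 := ps o1; have s2 := ps o2; have s3 := ps o3.
move: px s0 s1 s2 s3; rewrite !sum4 !p0.
rewrite (pC o1 o0) (pC o2 o0) (pC o3 o0) (pC o2 o1) (pC o3 o1) (pC o3 o2) => px s0 s1 s2 s3.
have e03 : p o0 o3 = - p o0 o1 - p o0 o2 by lra.
have e13 : p o1 o3 = - p o0 o1 - p o1 o2 by lra.
have e23 : p o2 o3 = - p o0 o2 - p o1 o2 by lra.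
have e12 : p o1 o2 = - p o0 o1 - p o0 o2 by lra.
have A1 : a * p o0 o2 = b * p o0 o1.
  move: px; rewrite e03 e13 e23 e12 => px.
  by apply/eqP; rewrite -subr_eq0 -[X in _ == X](mulr0 2^-1) -px /c12 /c13; apply/eqP; field.
have A2 : a * p o1 o2 = c * p o0 o1 by rewrite e12 mulrBr A1 cE; ring.
split=> //; rewrite C_sum !sum4 /sf /= !p0.
rewrite (pC o1 o0) (pC o2 o0) (pC o2 o1).
transitivity (- 2 * c * (a * p o0 o2) - 2 * b * (a * p o1 o2) + 2 * b * c * p o0 o1); first by ring.
by rewrite A1 A2; ring.
Qed.

Lemma null_frame_quartic : let r := fr E T in [/\ r o0 o1 o0 o1 = 0,
  r o0 o1 o0 o2 + r o0 o1 o1 o3 = 0,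
  2 * r o0 o1 o2 o3 + (r o0 o2 o0 o2 + 2 * r o0 o2 o1 o3 + r o1 o3 o1 o3) = 0,
  r o2 o3 o0 o2 + r o2 o3 o1 o3 = 0 & r o2 o3 o2 o3 = 0].
Proof.
move=> r; have rC : curvature_like r by exact: curvature_like_fr.
have [a0 b0 c0 q0] := abq; have [p00 p11 p02 p12 Cf] := quadric_eqs.
have [T1 T2 T3] := rC; have PP := curvature_like_pair rC.
have S1 := (T1 o1 o0, T1 o2 o0, T1 o3 o0, T1 o2 o1, T1 o3 o1, T1 o3 o2).
have S2 i j := (T2 i j o1 o0, T2 i j o2 o0, T2 i j o3 o0, T2 i j o2 o1, T2 i j o3 o1, T2 i j o3 o2).
pose D := curv_form r.
have CD s t (S S' : 'M[F]_4) : Z s = E *m S *m E^T -> Z t = E *m S' *m E^T -> C s t = D S S'.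
  by move=> Zs Zt; rewrite /C Zs Zt curv_form_fr.
pose nu := 2^-1 * b * c * q.
have D00 : p o0 o0 = D S01 S01 by exact: CD null_frame_Om0 null_frame_Om0.
have D11 : p o1 o1 = D (delta *: S23) (delta *: S23) by exact: CD null_frame_Om1 null_frame_Om1.
have D01 : p o0 o1 = D S01 (delta *: S23) by exact: CD null_frame_Om0 null_frame_Om1.
have Dff : C sf sf = D (nu *: Sf) (nu *: Sf) by exact: CD null_frame_Omf null_frame_Omf.
have D0f : C (dl o0) sf = D S01 (nu *: Sf) by exact: CD null_frame_Om0 null_frame_Omf.
have D1f : C (dl o1) sf = D (delta *: S23) (nu *: Sf) by exact: CD null_frame_Om1 null_frame_Omf.
have C0f : C (dl o0) sf = 0.
  have -> : C (dl o0) sf = - c * p o0 o0 - b * p o0 o1 + a * p o0 o2.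
    by rewrite C_sum !sum4 /dl /sf /=; ring.
  by rewrite p00 p02; ring.
have C1f : C (dl o1) sf = 0.
  have -> : C (dl o1) sf = - c * p o0 o1 - b * p o1 o1 + a * p o1 o2.
    have pC : p o1 o0 = p o0 o1 by rewrite /p /C curv_formC.
    by rewrite C_sum !sum4 pC /dl /sf /=; ring.
  by rewrite p11 p12; ring.
have nu0 : nu != 0.
  have h2 : (2^-1 : F) != 0 by rewrite invr_eq0 pnatr_eq0.
  exact: mulf_neq0 (mulf_neq0 (mulf_neq0 h2 b0) c0) q0.
have z (k y : F) : k != 0 -> k * y = 0 -> y = 0.
  by move=> k0 /eqP; rewrite mulf_eq0 (negbTE k0) => /eqP.
have f4 : (4 : F) != 0 by rewrite pnatr_eq0.
have nz2 (k : F) : k != 0 -> 4 * k != 0 by move=> k0; apply: mulf_neq0.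
split.
- apply: (z _ _ f4); rewrite -p00 D00 /D ?curv_formZl ?curv_formZr /curv_form ?(sum_S01,
  sum_S23, sum_Sf) ?S1 ?S2 ?S1; ring.
- apply: (z _ _ (nz2 _ nu0)); rewrite -C0f D0f /D ?curv_formZl ?curv_formZr /curv_form
  ?(sum_S01, sum_S23, sum_Sf) ?S1 ?S2 ?S1 !(PP _ _ o0 o1); ring.
(* The one free parameter, the multiple of the Pfaffian, cancels in this combination. *)
- apply: (z _ _ (nz2 _ (mulf_neq0 (mulf_neq0 b0 c0) delta0))).
  transitivity (C sf sf + 2 * b * c * p o0 o1); last by rewrite Cf; ring.
  rewrite Dff D01 /D ?curv_formZl ?curv_formZr /curv_form ?(sum_S01, sum_S23, sum_Sf)
    ?S1 ?S2 ?S1 (PP o2 o3 o0 o1) (PP o1 o3 o0 o2).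
  transitivity (nu ^+ 2 * 4 * (r o0 o2 o0 o2 + 2 * r o0 o2 o1 o3 + r o1 o3 o1 o3)
    + 2 * b * c * delta * 4 * r o0 o1 o2 o3); last by ring.
  by rewrite sqr_q_f; ring.
- apply: (z _ _ (nz2 _ (mulf_neq0 nu0 delta0))).
  rewrite -C1f D1f /D ?curv_formZl ?curv_formZr /curv_form ?(sum_S01, sum_S23, sum_Sf)
    ?S1 ?S2 ?S1 !(PP _ _ o2 o3); ring.
- apply: (z _ _ (nz2 _ (expf_neq0 2 delta0))).
  rewrite -p11 D11 /D ?curv_formZl ?curv_formZr /curv_form ?(sum_S01, sum_S23, sum_Sf)
    ?S1 ?S2 ?S1; ring.
Qed.

Lemma null_frame : exists E' : 'M[F]_4, [/\ E'^T *m g *m E' = nullJ F, \det E' = kappa &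
  let r := fr E' T in [/\ r o0 o1 o0 o1 = 0,
  r o0 o1 o0 o2 + r o0 o1 o1 o3 = 0,
  2 * r o0 o1 o2 o3 + (r o0 o2 o0 o2 + 2 * r o0 o2 o1 o3 + r o1 o3 o1 o3) = 0,
  r o2 o3 o0 o2 + r o2 o3 o1 o3 = 0 & r o2 o3 o2 o3 = 0]].
Proof.
by exists E; split; [exact: null_frame_gram|exact: null_frame_det|exact: null_frame_quartic].
Qed.

End Quartic.

End NullFrameOfSolution.

(** * Symmetry of second directional derivatives *)

Section Schwarz.
Variables (R : realType) (V : normedModType R).
Implicit Types (f : V -> R) (A : set V) (x v w : V).

Lemma differentiable_eps f x : differentiable f x -> forall e, 0 < e ->
  exists2 r, 0 < r & forall k, `|k| < r -> `|f (k + x) - f x - 'd f x k| <= e * `|k|.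
Proof.
move=> /diff_locally /eqaddoP df e e0.
have /nbhs_ballP[r r0 H] := df e e0; exists r => // k kr.
have := H k; rewrite -ball_normE /= sub0r normrN => /(_ kr).
by rewrite /= opprD addrA.
Qed.

Lemma second_difference f A x v w : open A -> A x ->
    (forall y, A y -> differentiable f y) -> differentiable ('D_v f) x ->
  forall e, 0 < e -> exists2 r, 0 < r & forall s, 0 < s < r ->
    `|f (s *: v + s *: w + x) - f (s *: w + x) - f (s *: v + x) + f x
       - s ^+ 2 * 'D_w ('D_v f) x| <= e * s ^+ 2.
Proof.
move=> Ao Ax df dDf e e0.
(* In units of [s], the two increments used below have norms adding up to at most [2 |v| + |w|]; the
   1 keeps [N] positive. *)
pose N := 2 * `|v| + `|w| + 1.
have N0 : 0 < N by rewrite /N ltr_wpDl // addr_ge0 // mulr_ge0.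
have [r1 r10 H] := differentiable_eps dDf (divr_gt0 e0 N0).
have /nbhs_ballP[r2 r20 HA] : nbhs x A by exact: open_nbhs_nbhs.
pose r := Num.min r1 r2 / N.
have m0 : 0 < Num.min r1 r2 by rewrite lt_min r10 r20.
exists r; first by rewrite divr_gt0.
move=> s /andP[s0 sr].
have small k : `|k| <= s * N -> `|k| < r1 /\ A (k + x).
  move=> kN; have kr : `|k| < Num.min r1 r2.
    by apply: le_lt_trans kN _; rewrite -ltr_pdivlMr.
  move: kr; rewrite lt_min => /andP[k1 k2]; split=> //; apply: HA.
  by rewrite -ball_normE /= opprD addrCA subrr addr0 normrN.
have bnd c k : 0 <= c <= s -> `|c *: v + k| <= s * `|v| + `|k|.
  move=> /andP[c0 cs]; apply: le_trans (ler_normD _ _) _.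
  by rewrite lerD2r normrZ ger0_norm // ler_wpM2r.
have bw c : 0 <= c <= s -> `|c *: v + s *: w| <= s * (`|v| + `|w|).
  by move=> cs; apply: le_trans (bnd _ _ cs) _; rewrite normrZ gtr0_norm // mulrDr.
have b0 c : 0 <= c <= s -> `|c *: v| <= s * `|v|.
  by move=> cs; have := bnd c 0 cs; rewrite normr0 !addr0.
have leN1 : `|v| + `|w| <= N by rewrite /N; have := normr_ge0 v; lra.
have leN2 : `|v| <= N by rewrite /N; have := normr_ge0 v; have := normr_ge0 w; lra.
have in1 c : 0 <= c <= s -> `|c *: v + s *: w| <= s * N.
  by move=> /bw h; apply: le_trans h _; rewrite ler_pM2l.
have in2 c : 0 <= c <= s -> `|c *: v| <= s * N.
  by move=> /b0 h; apply: le_trans h _; rewrite ler_pM2l.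
pose phi (t : R) := f (t *: v + (s *: w + x)) - f (t *: v + x).
have dphi t : 0 <= t <= s -> is_derive t 1 phi ('D_v f (t *: v + (s *: w + x)) - 'D_v f
  (t *: v + x)).
  move=> ts.
  have aux y : A (t *: v + y) -> is_derive t (1 : R) (fun t : R => f (t *: v + y)) ('D_v
    f (t *: v + y)).
    move=> Ay; have dfy := df _ Ay.
    have Eq : (fun k : R => k^-1 *: (((fun t : R => f (t *: v + y)) \o shift t) (k *: 1)
        - f (t *: v + y))) =
      (fun k : R => k^-1 *: ((f \o shift (t *: v + y)) (k *: v) - f (t *: v + y))).
      apply/funext => k /=; congr (_ *: (f _ - _)).
      by rewrite (_ : k *: (1 : R) = k) ?scalerDl ?addrA //; exact: mulr1.
    split; first by rewrite /derivable Eq; exact: diff_derivable.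
    by rewrite /derive Eq.
  apply: is_deriveB; apply: aux.
  - by rewrite addrA; have [] := small _ (in1 _ ts).
  - by have [] := small _ (in2 _ ts).
have [c cin Ec] : exists2 c, c \in `]0, s[%R & phi s - phi 0 =
    ('D_v f (c *: v + (s *: w + x)) - 'D_v f (c *: v + x)) * (s - 0).
  apply: (@MVT R phi _ 0 s) => //.
    by move=> t; rewrite in_itv /= => /andP[t0 ts]; apply: dphi; rewrite !ltW.
  apply: derivable_within_continuous => t; rewrite in_itv /= => ts.
  by have [] := dphi t ts.
have cs : 0 <= c <= s by move: cin; rewrite in_itv /= => /andP[c0 cs]; rewrite !ltW.
have [k1 _] := small _ (in1 _ cs); have [k2 _] := small _ (in2 _ cs).
have e1 := H _ k1; have e2 := H _ k2.
have -> : f (s *: v + s *: w + x) - f (s *: w + x) - f (s *: v + x) + f x = phi s - phi 0.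
  by rewrite /phi scale0r !add0r addrA; ring.
rewrite Ec subr0 (deriveE _ dDf).
have lZ k u : 'd ('D_v f) x (k *: u) = k * 'd ('D_v f) x u by exact: linearZ.
move: e1 e2; rewrite !addrA linearD /= !lZ.
set dv := 'd _ x v; set dw := 'd ('D_v f) x w => e1 e2.
have eN : 0 <= e / N by rewrite ltW // divr_gt0.
have e1' := le_trans e1 (ler_wpM2l eN (bw _ cs)).
have e2' := le_trans e2 (ler_wpM2l eN (b0 _ cs)).
move: e1' e2'; set y1 := 'D_v f (c *: v + s *: w + x).
set y0 := 'D_v f x; set y2 := 'D_v f (c *: v + x) => e1' e2'.
have -> : (y1 - y2) * s - s ^+ 2 * dw = s * (y1 - y2 - s * dw) by ring.
rewrite normrM gtr0_norm // expr2 mulrCA ler_pM2l //.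
have -> : y1 - y2 - s * dw = (y1 - y0 - (c * dv + s * dw)) - (y2 - y0 - c * dv) by ring.
apply: le_trans (ler_normB _ _) _; apply: le_trans (lerD e1' e2') _.
have -> : e / N * (s * (`|v| + `|w|)) + e / N * (s * `|v|) = e * s * ((2 * `|v| + `|w|) / N).
  by field; rewrite gt_eqF.
rewrite -[X in _ <= X]mulr1 ler_wpM2l ?mulr_ge0 // ?ltW //.
by rewrite ltr_pdivrMr // mul1r /N ltrDl.
Qed.

(** The second difference is symmetric in [v] and [w], and divided by [s ^+ 2] it tends to both
    mixed derivatives. *)
Lemma derive_swap f A x v w : open A -> A x ->
    (forall y, A y -> differentiable f y) ->
    differentiable ('D_v f) x -> differentiable ('D_w f) x ->
  'D_w ('D_v f) x = 'D_v ('D_w f) x.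
Proof.
move=> Ao Ax df dv dw; apply/eqP; rewrite -subr_eq0 -normr_le0; apply/ler_addgt0Pr => e
  e0; rewrite add0r.
have e20 : 0 < e / 2 by rewrite divr_gt0.
have [r1 r10 H1] := second_difference w Ao Ax df dv e20.
have [r2 r20 H2] := second_difference v Ao Ax df dw e20.
pose s := Num.min r1 r2 / 2.
have m0 : 0 < Num.min r1 r2 by rewrite lt_min r10 r20.
have s0 : 0 < s by rewrite divr_gt0.
have sm : s < Num.min r1 r2 by rewrite ltr_pdivrMr // ltr_pMr // ltr1n.
move: (sm); rewrite lt_min => /andP[s1 s2].
have := H1 s; have := H2 s; rewrite s0 s1 s2 => /(_ isT) h2 /(_ isT) h1.
move: h1 h2; rewrite [s *: w + s *: v]addrC.
set a := 'D_w ('D_v f) x; set b := 'D_v ('D_w f) x; set t := f (s *: v + s *: w + x).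
set t1 := f (s *: w + x); set t2 := f (s *: v + x) => h1 h2.
have s20 : 0 < s ^+ 2 by rewrite exprn_gt0.
rewrite -(ler_pM2l s20) -{1}(gtr0_norm s20) -normrM [X in _ <= X]mulrC.
have -> : s ^+ 2 * (a - b) = (t - t2 - t1 + f x - s ^+ 2 * b) - (t - t1 - t2 + f x - s ^+ 2 * a).
  by ring.
apply: le_trans (ler_normB _ _) _; apply: le_trans (lerD h2 h1) _.
by rewrite -mulrDl -splitr.
Qed.

End Schwarz.

(** * Smooth functions as a differential ring *)

Section IteratedDerivatives.
Variables (R : realType) (V : normedModType R) (A : set V).
Hypothesis Ao : open A.
Implicit Types (f g : V -> R) (v x : V).

Lemma near_eq_differentiable f g x :
  (\near x, f x = g x) -> differentiable f x -> differentiable g x.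
Proof.
move=> fg fx; have fgx : f x = g x by apply: nbhs_singleton fg.
have [dc /eqaddoP df] := (diff_locallyP _ _).1 fx.
have gE : g \o shift x = cst (g x) + 'd f x +o_ 0 id.
  apply/eqaddoP => e e0; have := df e e0; apply: filter_app.
  have : \forall k \near 0, f (k + x) = g (k + x).
    by move: fg; rewrite (near_shift 0) subr0; exact: filterS.
  apply: filterS => k fgk H.
  have : `|f (k + x) - (f x + 'd f x k)| <= e * `|k| := H.
  by rewrite fgk fgx.
have dg := diff_unique dc gE.
by apply/diff_locallyP; rewrite dg.
Qed.

Lemma near_open x (P : V -> Prop) : A x -> (forall y, A y -> P y) -> \near x, P x.
Proof.
move=> Ax AP; have Anbhs : nbhs x A by exact: open_nbhs_nbhs.
exact: filterS Anbhs.
Qed.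

(** Counting derivatives instead of listing directions lets closure under products and inverses go
    by induction on [n], with [CnW] for the undifferentiated factor. *)
Fixpoint Cn n f : Prop := if n is n'.+1 then
  (forall x, A x -> differentiable f x) /\ forall v, Cn n' ('D_v f) else True.

Definition Coo f := forall n, Cn n f.

Lemma eq_Cn n f g : (forall x, A x -> f x = g x) -> Cn n f -> Cn n g.
Proof.
elim: n f g => //= n IH f g fg [df dDf]; split=> [x Ax|v].
  by apply: near_eq_differentiable (df _ Ax); exact: near_open.
apply: IH (dDf v) => x Ax; apply: near_eq_derive; exact: near_open.
Qed.

Lemma CnW n f : Cn n.+1 f -> Cn n f.
Proof. by elim: n f => // n IH f [df dDf]; split=> // v; exact: IH. Qed.

Lemma Cn_cst n c : Cn n (cst c).
Proof.
elim: n c => // n IH c; split=> [x _|v]; first exact: differentiable_cst.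
by apply: eq_Cn (IH 0) => x _; rewrite derive_cst.
Qed.

Lemma CnD n f g : Cn n f -> Cn n g -> Cn n (f + g).
Proof.
elim: n f g => // n IH f g [df Df] [dg Dg]; split=> [x Ax|v].
  by apply: differentiableD; [exact: df|exact: dg].
apply: eq_Cn (IH _ _ (Df v) (Dg v)) => x Ax.
by rewrite deriveD //; apply: diff_derivable; [exact: df|exact: dg].
Qed.

Lemma CnM n f g : Cn n f -> Cn n g -> Cn n (f * g).
Proof.
elim: n f g => // n IH f g fn gn; have [df Df] := fn; have [dg Dg] := gn.
split=> [x Ax|v].
  by apply: differentiableM; [exact: df|exact: dg].
apply: (@eq_Cn _ (f * 'D_v g + g * 'D_v f)).
  by move=> x Ax; rewrite deriveM //; apply: diff_derivable; [exact: df|exact: dg].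
by apply: CnD; apply: IH; first [exact: Df|exact: Dg|exact: CnW].
Qed.

Lemma CnN n f : Cn n f -> Cn n (- f).
Proof.
move=> fn; apply: eq_Cn (CnM (Cn_cst n (-1)) fn) => x Ax.
by rewrite /GRing.mul /= mulN1r.
Qed.

Lemma CnV n f : (forall x, A x -> f x != 0) -> Cn n f -> Cn n (fun x => (f x)^-1).
Proof.
move=> f0; elim: n => // n IH fn; have [df Df] := fn; have {}IH := IH (CnW fn).
split=> [x Ax|v]; first by apply: differentiableV; [exact: df|exact: f0].
apply: eq_Cn (CnN (CnM (CnM IH IH) (Df v))) => x Ax.
rewrite deriveV ?f0 //; last by apply: diff_derivable; exact: df.
have -> : (- ((fun x0 => (f x0)^-1) * (fun x0 => (f x0)^-1) * 'D_v f) : V -> R) x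
  = - ((f x)^-1 * (f x)^-1 * 'D_v f x) by [].
have -> : - f x ^- 2 *: 'D_v f x = - (f x ^- 2) * 'D_v f x by [].
by rewrite -exprVn expr2 mulNr.
Qed.

Lemma smooth_on_Coo f : smooth_on A (f : V -> R) -> Coo f.
Proof.
move=> fs n; elim: n f fs => // n IH f fs; split=> [x Ax|v]; first exact: (fs [::]).
by apply: IH => s x Ax; have := fs (rcons s v) x Ax; rewrite foldr_rcons.
Qed.

End IteratedDerivatives.

(** The point is there so that 1 differs from 0 in the ring of functions. *)
Record open_domain (R : realType) := OpenDomain {
  dom :> set 'rV[R]_4; dom_open : open dom; dom_point : exists x, dom x }.
Arguments dom_open {R} o.
Arguments dom_point {R} o.

(** Vanishing outside the domain turns equality on the domain into Leibniz equality, as the ring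
    axioms require. *)
Record smooth_fun (R : realType) (A : open_domain R) := SmoothFun {
  sval :> 'rV[R]_4 -> R; sval_Coo : Coo A sval; sval_out : forall x, ~ dom A x -> sval x = 0 }.

Arguments sval_Coo {R A} s n.
Arguments sval_out {R A} s x.

Section SmoothFunctions.
Variables (R : realType) (A : open_domain R).
Implicit Types f g : smooth_fun A.
Let Ao := dom_open A.

HB.instance Definition _ := gen_eqMixin (smooth_fun A).
HB.instance Definition _ := gen_choiceMixin (smooth_fun A).

Lemma smooth_fun_eqP f g : (forall x, dom A x -> f x = g x) -> f = g.
Proof.
case: f g => [f f1 f2] [g g1 g2] /= fg.
have E : f = g by apply/funext => x; case: (pselect (dom A x)) => [/fg //|Ax]; rewrite f2 ?g2.
by subst g; congr SmoothFun; apply: Prop_irrelevance.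
Qed.

Definition restrict0 (f : 'rV[R]_4 -> R) x : R := if pselect (dom A x) then f x else 0.

Lemma restrict0E (f : 'rV[R]_4 -> R) x : dom A x -> restrict0 f x = f x.
Proof. by rewrite /restrict0; case: pselect. Qed.

Lemma restrict0_out (f : 'rV[R]_4 -> R) x : ~ dom A x -> restrict0 f x = 0.
Proof. by rewrite /restrict0; case: pselect. Qed.

Lemma restrict0_Coo (f : 'rV[R]_4 -> R) : Coo A f -> Coo A (restrict0 f).
Proof. by move=> fs n; apply: eq_Cn (fs n) => // x Ax; rewrite restrict0E. Qed.

(* The operations are kept opaque: unification would otherwise unfold them. *)
Lemma smooth_restr (f : 'rV[R]_4 -> R) : Coo A f ->
  {h : smooth_fun A | forall x, dom A x -> h x = f x}.
Proof.
by move=> fs; exists (SmoothFun (restrict0_Coo fs) (restrict0_out f)); exact: restrict0E.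
Qed.

Lemma sfun_zero_ex : {h : smooth_fun A | forall x, dom A x -> h x = 0}.
Proof. by apply: smooth_restr => n; exact: Cn_cst. Qed.
Lemma sfun_one_ex : {h : smooth_fun A | forall x, dom A x -> h x = 1}.
Proof. by apply: smooth_restr => n; exact: Cn_cst. Qed.
Lemma sfun_add_ex :
  {h : smooth_fun A -> smooth_fun A -> smooth_fun A | forall f g x, dom A x -> h f g x = f x + g x}.
Proof.
have ex f g : {h : smooth_fun A | forall x, dom A x -> h x = f x + g x}.
  by apply: smooth_restr => n; exact: CnD (sval_Coo f n) (sval_Coo g n).
by exists (fun f g => projT1 (ex f g)) => f g; exact: projT2 (ex f g).
Qed.
Lemma sfun_opp_ex :
  {h : smooth_fun A -> smooth_fun A | forall f x, dom A x -> h f x = - f x}.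
Proof.
have ex f : {h : smooth_fun A | forall x, dom A x -> h x = - f x}.
  by apply: smooth_restr => n; exact: CnN (sval_Coo f n).
by exists (fun f => projT1 (ex f)) => f; exact: projT2 (ex f).
Qed.
Lemma sfun_mul_ex :
  {h : smooth_fun A -> smooth_fun A -> smooth_fun A | forall f g x, dom A x -> h f g x = f x * g x}.
Proof.
have ex f g : {h : smooth_fun A | forall x, dom A x -> h x = f x * g x}.
  by apply: smooth_restr => n; exact: CnM (sval_Coo f n) (sval_Coo g n).
by exists (fun f g => projT1 (ex f g)) => f g; exact: projT2 (ex f g).
Qed.
Lemma sfun_derP i f : Coo A (pd i f).
Proof. by move=> n; have [_] := sval_Coo f n.+1; apply. Qed.
Lemma sfun_der_ex : {h : 'I_4 -> smooth_fun A -> smooth_fun A |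
  forall i f x, dom A x -> h i f x = pd i f x}.
Proof.
have ex i f : {h : smooth_fun A | forall x, dom A x -> h x = pd i f x}.
  by apply: smooth_restr; exact: sfun_derP.
by exists (fun i f => projT1 (ex i f)) => i f; exact: projT2 (ex i f).
Qed.

Definition sfun_zero := projT1 sfun_zero_ex.
Definition sfun_one := projT1 sfun_one_ex.
Definition sfun_opp := projT1 sfun_opp_ex.
Definition sfun_add := projT1 sfun_add_ex.
Definition sfun_mul := projT1 sfun_mul_ex.
Definition sfun_der := projT1 sfun_der_ex.

Lemma sfun_zeroE x : dom A x -> sfun_zero x = 0. Proof. exact: (projT2 sfun_zero_ex). Qed.
Lemma sfun_oneE x : dom A x -> sfun_one x = 1. Proof. exact: (projT2 sfun_one_ex). Qed.
Lemma sfun_oppE f x : dom A x -> sfun_opp f x = - f x.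
Proof. exact: (projT2 sfun_opp_ex). Qed.
Lemma sfun_addE f g x : dom A x -> sfun_add f g x = f x + g x.
Proof. exact: (projT2 sfun_add_ex). Qed.
Lemma sfun_mulE f g x : dom A x -> sfun_mul f g x = f x * g x.
Proof. exact: (projT2 sfun_mul_ex). Qed.
Lemma sfun_derE i f x : dom A x -> sfun_der i f x = pd i f x.
Proof. exact: (projT2 sfun_der_ex). Qed.

Local Ltac sfun_ext := do ?move=> ?; apply: smooth_fun_eqP => x Ax; rewrite ?(sfun_addE,
  sfun_mulE, sfun_oppE, sfun_zeroE, sfun_oneE) //.

Lemma sfun_addA : associative sfun_add. Proof. by sfun_ext; rewrite addrA. Qed.
Lemma sfun_addC : commutative sfun_add. Proof. by sfun_ext; rewrite addrC. Qed.
Lemma sfun_add0 : left_id sfun_zero sfun_add. Proof. by sfun_ext; rewrite add0r. Qed.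
Lemma sfun_addN : left_inverse sfun_zero sfun_opp sfun_add.
Proof. by sfun_ext; rewrite addNr. Qed.
HB.instance Definition _ :=
  GRing.isZmodule.Build (smooth_fun A) sfun_addA sfun_addC sfun_add0 sfun_addN.

Lemma sfun_mulA : associative sfun_mul. Proof. by sfun_ext; rewrite mulrA. Qed.
Lemma sfun_mulC : commutative sfun_mul. Proof. by sfun_ext; rewrite mulrC. Qed.
Lemma sfun_mul1 : left_id sfun_one sfun_mul. Proof. by sfun_ext; rewrite mul1r. Qed.
Lemma sfun_mulD : left_distributive sfun_mul sfun_add. Proof. by sfun_ext; rewrite mulrDl. Qed.
Lemma sfun_one_neq0 : sfun_one != sfun_zero.
Proof.
apply/eqP => /(congr1 (fun f => sval f (xget 0 (dom A)))).
have [x Ax] := dom_point A; have Aget := xgetPex 0 (ex_intro _ x Ax).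
by rewrite sfun_zeroE // sfun_oneE // => /eqP; rewrite oner_eq0.
Qed.
HB.instance Definition _ := GRing.Zmodule_isComNzRing.Build (smooth_fun A)
  sfun_mulA sfun_mulC sfun_mul1 sfun_mulD sfun_one_neq0.

Lemma sfun_diff f x : dom A x -> differentiable (sval f) x.
Proof. by move=> Ax; have [df _] := sval_Coo f 1; exact: df. Qed.

Lemma pd_near_eq i (f g : 'rV[R]_4 -> R) x : dom A x -> (forall y, dom A y -> f y = g y)
  -> pd i f x = pd i g x.
Proof. by move=> Ax fg; apply: near_eq_derive; apply: (near_open (A := A)). Qed.

Lemma evD f g x : dom A x -> sval (f + g) x = sval f x + sval g x.
Proof. exact: sfun_addE. Qed.
Lemma evM f g x : dom A x -> sval (f * g) x = sval f x * sval g x.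
Proof. exact: sfun_mulE. Qed.
Lemma evN f x : dom A x -> sval (- f) x = - sval f x.
Proof. exact: sfun_oppE. Qed.
Lemma ev1 x : dom A x -> sval (1 : smooth_fun A) x = 1.
Proof. exact: sfun_oneE. Qed.
Lemma ev0 x : sval (0 : smooth_fun A) x = 0.
Proof.
by case: (pselect (dom A x)) => Ax; [exact: sfun_zeroE|exact: sval_out].
Qed.

Lemma sfun_derD i f g : sfun_der i (f + g) = sfun_der i f + sfun_der i g.
Proof.
apply: smooth_fun_eqP => x Ax; rewrite evD // !sfun_derE //.
rewrite (@pd_near_eq _ _ (sval f + sval g)) //; last by move=> y Ay; rewrite evD.
by rewrite /pd deriveD //; apply: diff_derivable; exact: sfun_diff.
Qed.

Lemma sfun_derM i f g : sfun_der i (f * g) = sfun_der i f * g + f * sfun_der i g.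
Proof.
apply: smooth_fun_eqP => x Ax; rewrite evD // !evM // !sfun_derE //.
rewrite (@pd_near_eq _ _ (sval f * sval g)) //; last by move=> y Ay; rewrite evM.
rewrite /pd deriveM; try (by apply: diff_derivable; exact: sfun_diff).
by rewrite /GRing.scale /= addrC [X in X + _]mulrC.
Qed.

Lemma sfun_derC i j f : sfun_der i (sfun_der j f) = sfun_der j (sfun_der i f).
Proof.
apply: smooth_fun_eqP => x Ax.
rewrite (sfun_derE i (sfun_der j f) Ax).
rewrite (sfun_derE j (sfun_der i f) Ax).
rewrite (@pd_near_eq i _ (pd j f) _ Ax (sfun_derE j f)).
rewrite (@pd_near_eq j _ (pd i f) _ Ax (sfun_derE i f)).
apply: (derive_swap Ao Ax) => [y Ay||]; first exact: sfun_diff.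
- by have [df _] := sfun_derP j f 1; exact: df.
- by have [df _] := sfun_derP i f 1; exact: df.
Qed.

Definition smooth_derivations : derivations (smooth_fun A) :=
  Derivations sfun_derD sfun_derM sfun_derC.

End SmoothFunctions.

(** * From the null frame to half-flatness, at a point and then on a domain *)

Section PointwiseHalfFlat.
Variable R : realType.
Variables (x : 'I_4 -> R) (U g h : 'M[R]_4) (Rie : 'I_4 -> 'I_4 -> 'I_4 -> 'I_4 -> R).
Hypothesis UT : U^T = U.
Local Notation a := (c12 x).
Local Notation b := (c13 x).
Local Notation c := (c14 x).
Hypothesis F0 : heav a b c U = 0.
Hypothesis hE : h = 2^-1 *: symbol a b c U.
Hypotheses (gT : g^T = g) (gh : g *m h = 1%:M).
Hypothesis kappa0 : 4^-1 * kap a b U != 0.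

Let T i j k l := \sum_m g i m * Rie m j k l.
Hypothesis TC : curvature_like T.
Hypothesis T_delta : forall i,
  curv_form T (hat (Om (fun j => (i == j)%:R) U)) (hat (Om (fun j => (i == j)%:R) U)) = 0.
Hypothesis T_x : curv_form T (hat (Om x U)) (hat (Om x U)) = 0.

Let ric j l := \sum_i Rie i j i l.
Let ric_up i k := \sum_m h i m * ric m k.
Let scal := \sum_i ric_up i i.
Let wey i j k l :=
  let d (p q : 'I_4) : R := (p == q)%:R in
  Rie i j k l
  - 2^-1 * (d i k * ric j l - d i l * ric j k + g j l * ric_up i k - g j k * ric_up i l)
  + 6^-1 * scal * (d i k * g j l - d i l * g j k).

Let hg : h *m g = 1%:M. Proof. exact: mulmx1C gh. Qed.

Let hT : h^T = h. Proof. by rewrite hE linearZ /= symbol_sym. Qed.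

Let sum_g_h i (f : 'I_4 -> R) : \sum_m g i m * \sum_n h m n * f n = f i.
Proof.
transitivity ((g *m (h *m \col_n f n)) i 0).
  rewrite mxE; apply: eq_bigr => m _; rewrite mxE; congr (_ * _).
  by apply: eq_bigr => n _; rewrite mxE.
by rewrite mulmxA gh mul1mx mxE.
Qed.

Let sum_g_delta i k : \sum_m g i m * (m == k)%:R = g i k.
Proof.
rewrite (bigD1 k) //= eqxx mulr1 big1 ?addr0 // => m /negbTE ->.
by rewrite mulr0.
Qed.

Let ricE j l : ric j l = lric h T j l.
Proof.
rewrite /ric /lric; apply: eq_bigr => i _.
transitivity ((h *m (g *m \col_m Rie m j i l)) i 0).
  by rewrite mulmxA hg mul1mx mxE.
rewrite mxE; apply: eq_bigr => k _; rewrite mxE; congr (_ * _).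
by apply: eq_bigr => m _; rewrite mxE.
Qed.

Let scalE : scal = lscal h T.
Proof.
rewrite /scal /ric_up /lscal exchange_big; apply: eq_bigr => j _.
by apply: eq_bigr => l _; rewrite ricE -{1}hT mxTE.
Qed.

Let weyE i j k l : \sum_m g i m * wey m j k l = lweyl g h T i j k l.
Proof.
rewrite /lweyl -scalE -!ricE.
rewrite -(sum_g_h i (ric^~ k)) -(sum_g_h i (ric^~ l)) -/(T i j k l) /T.
rewrite -(sum_g_delta i k) -(sum_g_delta i l) -/(ric_up _ k) /wey /ric_up !sum4 /=.
ring.
Qed.

Lemma hodge_weyl_point i j k l :
  2^-1 * Num.sqrt (\det g) * (\sum_p \sum_q \sum_r \sum_s
    h i p * h q r * levi_civita R p j q s * wey s r k l) =
  Num.sg (kap a b U) * wey i j k l.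
Proof.
have [E [EgE dE [q0 q1 q2 q3 q4]]] := null_frame UT F0 hE gT gh kappa0 TC T_delta T_x.
have frE p q r s : fr E (fun i j k l => \sum_m g i m * wey m j k l) p q r s =
    lweyl (nullJ R) (nullJ R) (fr E T) p q r s.
  rewrite (@eq_fr _ E _ (lweyl g h T)); last exact: weyE.
  by rewrite -{1}(frame_inv gh EgE) lweyl_fr EgE.
have N := lweyl_J_null (curvature_like_fr E TC) q0 q1 q2 q3 q4.
rewrite (@hodge_frame _ g h E wey gT gh EgE).
- rewrite dE sgrM (gtr0_sg (_ : 0 < 4^-1)) ?mul1r //.
- move=> p q r s; rewrite !weyE /lweyl; have [T1 _ _] := TC.
  by rewrite (T1 q p); ring.
- by move=> r s; rewrite frE; have [] := N r s.
- by move=> r s; rewrite frE; have [] := N r s.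
- by move=> r s; rewrite !frE; have [] := N r s.
Qed.

End PointwiseHalfFlat.

Section Symbol.
Variable R : realType.

(** Reads a directional derivative off an exact expansion along the line. It serves the quadratic
    equation as well as the linear coordinates, with [m = 0]. *)
Lemma derive_quadratic (V : normedModType R) (f : V -> R) (p v : V) (l m : R) :
  (forall t : R, f (t *: v + p) = f p + t * l + t ^+ 2 * m) -> 'D_v f p = l.
Proof.
move=> fE; apply: cvg_lim => //.
have E : {near (0 : R)^', (fun t : R => l + t * m) =1
    (fun t : R => t^-1 *: ((f \o shift p) (t *: v) - f p))}.
  near=> t; have t0 : t != 0 by near: t; exact: nbhs_dnbhs_neq.
  by rewrite [RHS](_ : _ = t^-1 * (f (t *: v + p) - f p)) // fE; field.
apply: cvg_trans (near_eq_cvg E) _.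
have : (fun t : R => l + t * m) @ (0 : R)^' --> l + 0 * m.
  by apply: cvgD; [exact: cvg_cst|apply: cvgM; [exact: nbhs_dnbhs|exact: cvg_cst]].
by rewrite mul0r addr0.
Unshelve. all: by end_near. Qed.

Lemma modified_heavenlyE (z : jet1 R) H : modified_heavenly z H =
  heav (c12 (jx z 0)) (c13 (jx z 0)) (c14 (jx z 0)) H.
Proof. by rewrite /modified_heavenly !ixE. Qed.

Lemma char_matrix_modified (z : jet1 R) H : char_matrix (@modified_heavenly R) z H =
  2^-1 *: symbol (c12 (jx z 0)) (c13 (jx z 0)) (c14 (jx z 0)) H.
Proof.
set a := c12 _; set b := c13 _; set c := c14 _.
pose L (V : 'M[R]_4) := a * (H o0 o1 * V o2 o3 + V o0 o1 * H o2 o3)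
  + b * (H o0 o2 * V o1 o3 + V o0 o2 * H o1 o3) + c * (H o1 o2 * V o0 o3 + V o1 o2 * H o0 o3).
have dE p q : dF_du (@modified_heavenly R) z H p q = L (sym_delta R p q).
  apply: (@derive_quadratic _ _ _ _ _ (heav a b c (sym_delta R p q))) => t.
  by rewrite !modified_heavenlyE -/a -/b -/c /heav /L !(mxDE, mxZE); ring.
apply/matrixP => p q; rewrite mxE !dE /L /sym_delta.
by move: p q; apply: ord4P; apply: ord4P; rewrite /= !mxE /=; field.
Qed.

End Symbol.

Section Evaluation.
Variables (R : realType) (A : open_domain R) (x : 'rV[R]_4).
Hypothesis Ax : dom A x.

Definition eval_at (f : smooth_fun A) : R := sval f x.

Lemma eval_is_zmod_morphism : zmod_morphism eval_at.
Proof. by move=> f g; rewrite /eval_at (evD _ _ Ax) (evN _ Ax). Qed.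
HB.instance Definition _ :=
  GRing.isZmodMorphism.Build (smooth_fun A) R eval_at eval_is_zmod_morphism.

Lemma eval_is_monoid_morphism : monoid_morphism eval_at.
Proof. by split=> [|f g]; [exact: ev1|exact: evM]. Qed.
HB.instance Definition _ :=
  GRing.isMonoidMorphism.Build (smooth_fun A) R eval_at eval_is_monoid_morphism.

Definition evalR : {rmorphism smooth_fun A -> R} := eval_at.

Lemma evalR_c xs : [/\ evalR (c12 xs) = c12 (evalR \o xs), evalR (c13 xs) = c13 (evalR \o xs) &
  evalR (c14 xs) = c14 (evalR \o xs)].
Proof. by split; rewrite rmorphM !rmorphB. Qed.

Lemma evalR_kap a b U : evalR (kap a b U) = kap (evalR a) (evalR b) (map_mx evalR U).
Proof. by rewrite /kap rmorphM rmorphB !rmorphM !mxE. Qed.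

Lemma evalR_hat O : map_mx evalR (hat O) = hat (map_mx evalR O).
Proof.
by apply/matrixP; apply: ord4P; apply: ord4P; rewrite !mxE /= ?rmorph0 ?rmorphN ?mxE.
Qed.

Lemma evalR_Om s U : map_mx evalR (Om s U) = Om (evalR \o s) (map_mx evalR U).
Proof. by apply/matrixP => i j; rewrite !mxE rmorphM rmorphB. Qed.

End Evaluation.

(** If [kap] vanished, [symbol_Om] and the invertibility of the symbol would kill every [Om s U].
    Then the off-diagonal entries of [U] would be zero, and so would the symbol. *)
Lemma heavenly_kap_neq0 (F : fieldType) (a b c t k : F) (U : 'M[F]_4) :
    U^T = U -> a + b + c = 0 -> heav a b c U = 0 ->
  t *: symbol a b c U \in unitmx -> k * kap a b U != 0 \/ k = 0.
Proof.
move=> UT abc F0 hu; have [->|k0] := eqVneq k 0; [by right|left].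
apply/negP; rewrite mulf_eq0 (negbTE k0) => /= /eqP kap0.
set h := t *: _ in hu.
have OmE s : Om s U = 0.
  have H : h *m Om s U *m h = 0.
    by rewrite /h -scalemxAr -!scalemxAl symbol_Om // kap0 scale0r !scaler0.
  by rewrite -[LHS](mulKmx hu) -[_ *m Om s U](mulmxK hu) H mul0mx mulmx0.
have U0 (i j : 'I_4) : i != j -> U i j = 0.
  move=> ij; have := OmE (fun k => (i == k)%:R) => /matrixP/(_ i j).
  by rewrite !mxE eqxx (negbTE ij) subr0 mul1r.
move: hu; rewrite /h (_ : symbol a b c U = 0) ?scaler0 ?unitmxE ?det0 ?unitr0 //.
by apply/matrixP; apply: ord4P; apply: ord4P; rewrite !mxE /= ?U0 ?mulr0.
Qed.

Section SolutionOnDomain.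
Variables (R : realType) (A : open_domain R) (u : 'rV[R]_4 -> R).
Hypothesis sol : solution (@modified_heavenly R) A u.
Hypothesis nondeg : char_nondegenerate (@modified_heavenly R) A u.

Local Notation K := (smooth_fun A).
Local Notation d := (smooth_derivations A).
Local Notation ev := (@evalR R A _).

Lemma coord_Coo i : Coo A (fun x : 'rV[R]_4 => x 0 i).
Proof.
case=> // n; split=> [x _|v]; first exact: differentiable_coord.
apply: (eq_Cn (dom_open A) _ (Cn_cst (dom_open A) n (v 0 i))) => x Ax.
apply/esym; apply: (@derive_quadratic _ _ _ _ _ _ 0) => t.
by rewrite /= mxDE mxZE; ring.
Qed.

Let half_cst : {f : K | forall x, dom A x -> f x = 2^-1}.
Proof. by apply: smooth_restr => n; exact: (Cn_cst (dom_open A)). Qed.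
Let hf := projT1 half_cst.
Let hf_val : forall x, dom A x -> hf x = 2^-1 := projT2 half_cst.

Let coord_ex i : {f : K | forall x, dom A x -> f x = x 0 i}.
Proof. by apply: smooth_restr; exact: coord_Coo. Qed.
Let xs i := projT1 (coord_ex i).
Let xs_val i : forall x, dom A x -> xs i x = x 0 i := projT2 (coord_ex i).

Let u_ex : {f : K | forall x, dom A x -> f x = u x}.
Proof. apply: smooth_restr; have [su _] := sol. exact: (smooth_on_Coo su). Qed.
Let us := projT1 u_ex.
Let us_val : forall x, dom A x -> us x = u x := projT2 u_ex.

Let U : 'M[K]_4 := \matrix_(i, j) d i (d j us).

Let ev_U x (Ax : dom A x) : map_mx (evalR Ax) U = hess u x.
Proof.
apply/matrixP => i j; rewrite !mxE /=.
rewrite [LHS](sfun_derE i (d j us) Ax).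
apply: (@pd_near_eq R A i _ _ x Ax) => y Ay; rewrite [LHS](sfun_derE j us Ay).
exact: (@pd_near_eq R A j _ _ y Ay).
Qed.

Let ev_xs x (Ax : dom A x) : evalR Ax \o xs = x 0.
Proof. by apply/funext => i; exact: xs_val. Qed.

Let UT : U^T = U. Proof. by apply/matrixP => i j; rewrite !mxE derC. Qed.

Let dU i j k : d i (U j k) = d j (U i k). Proof. by rewrite !mxE derC. Qed.

Let dx i j : d i (xs j) = (i == j)%:R.
Proof.
apply: smooth_fun_eqP => x Ax; rewrite [LHS](sfun_derE i (xs j) Ax).
rewrite (@pd_near_eq _ A i _ (fun y : 'rV[R]_4 => y 0 j) x Ax (xs_val j)).
transitivity (evalR Ax (i == j)%:R); last by [].
rewrite rmorph_nat; apply: (@derive_quadratic _ _ _ _ _ _ 0) => t.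
by rewrite /= mxDE mxZE mxE eqxx /= eq_sym; ring.
Qed.

Let F0 : heav (c12 xs) (c13 xs) (c14 xs) U = 0.
Proof.
apply: smooth_fun_eqP => x Ax; rewrite ev0.
transitivity (evalR Ax (heav (c12 xs) (c13 xs) (c14 xs) U)); first by [].
rewrite map_heav; have [-> -> ->] := evalR_c Ax xs; rewrite ev_xs ev_U.
by have [_ E] := sol; rewrite -[RHS](E x Ax) modified_heavenlyE.
Qed.

Let hfE : hf + hf = 1.
Proof.
apply: smooth_fun_eqP => x Ax; rewrite (evD _ _ Ax) (ev1 Ax) hf_val //.
by field.
Qed.

Let hK := hf *: symbol (c12 xs) (c13 xs) (c14 xs) U.

Let ev_hK x (Ax : dom A x) : map_mx (evalR Ax) hK = char_matrix_on (@modified_heavenly R) u x.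
Proof.
rewrite /char_matrix_on char_matrix_modified /hK map_mxZ map_symbol.
have [-> -> ->] := evalR_c Ax xs; rewrite ev_xs ev_U.
by congr (_ *: _); exact: hf_val.
Qed.

Let hKT : hK^T = hK. Proof. by rewrite /hK linearZ /= symbol_sym. Qed.

Lemma sfun_inverse (f : K) : (forall x, dom A x -> f x != 0) -> exists f' : K, f' * f = 1.
Proof.
move=> f0; have [f' f'E] : {h : K | forall x, dom A x -> h x = (f x)^-1}.
  by apply: smooth_restr => n; apply: (CnV (dom_open A)) => //; exact: sval_Coo.
exists f'; apply: smooth_fun_eqP => x Ax.
by rewrite (evM _ _ Ax) (ev1 Ax) f'E // mulVf // f0.
Qed.

(** Inversion over the ring of smooth functions: the determinant is nonzero at each point, so it has
    a smooth reciprocal, which multiplies the adjugate. [ev_gK] then identifies the values with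
    [char_metric]. *)
Let gK_ex : exists gK : 'M[K]_4, [/\ gK^T = gK & gK *m hK = 1%:M].
Proof.
have [di diE] : exists f' : K, f' * \det hK = 1.
  apply: sfun_inverse => x Ax.
  have -> : sval (\det hK) x = \det (map_mx (evalR Ax) hK) by rewrite det_map_mx.
  by rewrite ev_hK -unitfE -unitmxE; exact: nondeg.
have gh : (di *: \adj hK) *m hK = 1%:M.
  by rewrite -scalemxAl mul_adj_mx scale_scalar_mx diE.
exists (di *: \adj hK); split=> //; set g := di *: _ in gh *.
have hg := mulmx1C gh.
by rewrite -[LHS]mulmx1 -hg mulmxA -{1}hKT -trmx_mul hg trmx1 mul1mx.
Qed.

Let kappa_neq0 x (Ax : dom A x) :
  evalR Ax (kap (c12 xs) (c13 xs) U) != 0.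
Proof.
have [_ E] := sol; have := nondeg Ax; rewrite /char_matrix_on char_matrix_modified.
set h := _ *: _ => hu.
have HT : (hess u x)^T = hess u x.
  by rewrite -(ev_U Ax) -{2}UT; apply/matrixP => i j; rewrite !mxE.
have := E x Ax; rewrite modified_heavenlyE => Fx.
have [] := @heavenly_kap_neq0 R _ _ _ 2^-1 1 _ HT (c_sum _) Fx hu.
  by rewrite mul1r evalR_kap; have [-> -> _] := evalR_c Ax xs; rewrite ev_xs ev_U.
by move/eqP; rewrite oner_eq0.
Qed.

Lemma mulmx_sum3 (S : pzRingType) (g X Y Z : 'M[S]_4) i j k l :
  (forall m, X m j + Y m k + Z m l = 0) -> (g *m X) i j + (g *m Y) i k + (g *m Z) i l = 0.
Proof.
move=> XYZ; rewrite !mxE -!big_split; apply: big1 => m _ /=.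
by rewrite -!mulrDr XYZ mulr0.
Qed.

Section AtMetric.
Variables (gK : 'M[K]_4) (gT : gK^T = gK) (gh : gK *m hK = 1%:M).
Local Notation g := (char_metric (@modified_heavenly R) u).
Local Notation Rmg := (Rm d hf gK hK).

Let ev_gK x (Ax : dom A x) : map_mx (evalR Ax) gK = g x.
Proof.
have gx : map_mx (evalR Ax) gK *m char_matrix_on (@modified_heavenly R) u x = 1%:M.
  by rewrite -(ev_hK Ax) -map_mxM gh map_mx1.
have hu := nondeg Ax.
by rewrite -[LHS](mulmxK hu) gx mul1mx.
Qed.

Let ev_gKE x (Ax : dom A x) i j : gK i j x = g x i j.
Proof. by rewrite -(ev_gK Ax) mxE. Qed.

Let ev_ginv x (Ax : dom A x) : ginv g x = map_mx (evalR Ax) hK.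
Proof. by rewrite /ginv /char_metric invmxK ev_hK. Qed.

Let dgE x (Ax : dom A x) k i j : dg g k i j x = evalR Ax (d k (gK i j)).
Proof.
rewrite /dg; apply/esym; transitivity (pd k (gK i j) x); first exact: sfun_derE.
by apply: (@pd_near_eq R A k _ _ x Ax) => y Ay; exact: ev_gKE.
Qed.

Let christoffelE x (Ax : dom A x) i j k :
  christoffel g i j k x = evalR Ax (Gam d hf gK hK j i k).
Proof.
rewrite [Gam d hf gK hK j i k]mxE rmorphM rmorph_sum /christoffel.
congr (_ * _); first by apply/esym; exact: hf_val.
apply: eq_bigr => l _; rewrite rmorphM rmorphB rmorphD (ev_ginv Ax) mxE !(dgE Ax).
by congr (_ * (_ - _)); rewrite addrC.
Qed.

Let riemannE x (Ax : dom A x) i j k l : riemann g i j k l x = evalR Ax (Rmg k l i j).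
Proof.
rewrite RmE rmorphD !rmorphB /=; congr (_ - _ + _).
- apply/esym; transitivity (pd k (Gam d hf gK hK l i j) x); first exact: sfun_derE.
  by apply: (@pd_near_eq R A k _ _ x Ax) => y Ay; rewrite (christoffelE Ay).
- apply/esym; transitivity (pd l (Gam d hf gK hK k i j) x); first exact: sfun_derE.
  by apply: (@pd_near_eq R A l _ _ x Ax) => y Ay; rewrite (christoffelE Ay).
- rewrite !rmorph_sum -sumrB; apply: eq_bigr => m _.
  by rewrite !(christoffelE Ax) !rmorphM.
Qed.

Let T x i j k l := \sum_m g x i m * riemann g m j k l x.

Let TE x (Ax : dom A x) i j k l : T x i j k l = evalR Ax ((gK *m Rmg k l) i j).
Proof.
rewrite [(_ *m _) i j]mxE rmorph_sum; apply: eq_bigr => m _.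
by rewrite rmorphM (riemannE Ax) -(ev_gK Ax) mxE.
Qed.

Let T_curvature_like x (Ax : dom A x) : curvature_like (T x).
Proof.
split=> i j k l; rewrite !(TE Ax).
- have := g_Rm_antisym d hfE gT gh k l => /matrixP/(_ j i); rewrite mxTE mxNE => ->.
  by rewrite rmorphN.
- rewrite -rmorphN -mxNE -mulmxN; congr (evalR Ax ((_ *m _) i j)).
  by rewrite /Rm opprD !opprB.
- rewrite -!rmorphD -[RHS](rmorph0 (evalR Ax)); congr (evalR Ax _).
  by apply: mulmx_sum3 => m; exact: Rm_bianchi.
Qed.

(** At a point the cubed entry can be cancelled: either some entry of the bivector is nonzero there,
    or the whole bivector is zero and the claim is trivial. *)
Let T_null x (Ax : dom A x) (s : 'I_4 -> K) :
    (forall i j, i != j -> d i (s j) = 0) -> pfaffian (Om s U) = 0 ->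
  curv_form (T x) (hat (Om (evalR Ax \o s) (hess u x))) (hat (Om (evalR Ax \o s) (hess u x))) = 0.
Proof.
move=> ds pf; have [kV kVE] : exists f' : K, f' * (hf ^+ 2 * kap (c12 xs) (c13 xs) U) = 1.
  apply: sfun_inverse => y Ay.
  have -> : sval (hf ^+ 2 * kap (c12 xs) (c13 xs) U) y =
      evalR Ay (hf ^+ 2 * kap (c12 xs) (c13 xs) U) by [].
  rewrite rmorphM rmorphXn; apply: mulf_neq0; last exact: kappa_neq0.
  apply: expf_neq0; have -> : evalR Ay hf = 2^-1 by exact: hf_val.
  by rewrite invr_eq0 pnatr_eq0.
have H a b := curv_Om hfE UT dU F0 gT gh kVE a b ds pf.
rewrite -(ev_U Ax) -evalR_Om -evalR_hat; set B := hat (Om s U) in H *.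
have {}H a b : map_mx (evalR Ax) B a b ^+ 3 *
    curv_form (T x) (map_mx (evalR Ax) B) (map_mx (evalR Ax) B) = 0.
  have := congr1 (evalR Ax) (H a b); rewrite rmorph0 => <-.
  rewrite rmorphM rmorphXn; congr (_ * _); first by rewrite mxE.
  rewrite /curv_form !rmorph_sum; apply: eq_bigr => k _.
  rewrite rmorph_sum; apply: eq_bigr => l _; rewrite rmorphM [map_mx _ _ _ _]mxE; congr (_ * _).
  rewrite rmorph_sum; apply: eq_bigr => i _.
  rewrite rmorph_sum; apply: eq_bigr => j _; rewrite rmorphM [map_mx _ _ _ _]mxE.
  by rewrite (TE Ax).
have [B0|] := eqVneq (map_mx (evalR Ax) B) 0.
  by rewrite B0 /curv_form big1 // => k _; apply: big1 => l _; rewrite mxE mul0r.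
move=> B0; have [a [b Bab]] : exists a b, map_mx (evalR Ax) B a b != 0.
  apply/not_existsP => N; case/eqP: B0; apply/matrixP => a b; rewrite [RHS]mxE.
  by apply/eqP; apply: contrapT => Bab; apply: (N a); exists b; apply/negP.
by have /eqP := H a b; rewrite mulf_eq0 expf_eq0 /= (negbTE Bab) => /eqP.
Qed.

Definition kap_at (x : 'rV[R]_4) := kap (c12 (x 0)) (c13 (x 0)) (hess u x).

Lemma kap_at_eval x (Ax : dom A x) : kap_at x = evalR Ax (kap (c12 xs) (c13 xs) U).
Proof. by rewrite evalR_kap; have [-> -> _] := evalR_c Ax xs; rewrite ev_xs ev_U. Qed.

Lemma hodge_weyl_solution_metric x (Ax : dom A x) i j k l :
  hodge_weyl g i j k l x = Num.sg (kap_at x) * weyl g i j k l x.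
Proof.
have HT : (hess u x)^T = hess u x.
  by rewrite -(ev_U Ax) -{2}UT; apply/matrixP => p q; rewrite !mxE.
have Fx : heav (c12 (x 0)) (c13 (x 0)) (c14 (x 0)) (hess u x) = 0.
  by have [_ E] := sol; rewrite -[RHS](E x Ax) modified_heavenlyE.
have hE : ginv g x = 2^-1 *: symbol (c12 (x 0)) (c13 (x 0)) (c14 (x 0)) (hess u x).
  by rewrite (ev_ginv Ax) ev_hK /char_matrix_on char_matrix_modified.
have gxT : (g x)^T = g x.
  by rewrite -(ev_gK Ax) -{2}gT; apply/matrixP => p q; rewrite !mxE.
have gxh : g x *m ginv g x = 1%:M.
  by rewrite (ev_ginv Ax) -(ev_gK Ax) -map_mxM gh map_mx1.
have k0 : 4^-1 * kap (c12 (x 0)) (c13 (x 0)) (hess u x) != 0.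
  apply: mulf_neq0; first by rewrite invr_eq0 pnatr_eq0.
  by rewrite -/(kap_at x) (kap_at_eval Ax) kappa_neq0.
have Td q : curv_form (T x) (hat (Om (fun j => (q == j)%:R) (hess u x)))
    (hat (Om (fun j => (q == j)%:R) (hess u x))) = 0.
  have -> : (fun j => (q == j)%:R) = evalR Ax \o (fun j => (q == j)%:R) :> ('I_4 -> R).
    by apply/funext => p; rewrite /= rmorph_nat.
  apply: T_null; last exact: pfaffian_Om_delta.
  by move=> p r _; case: (q == r); [exact: der1|exact: raddf0].
have Tx : curv_form (T x) (hat (Om (x 0) (hess u x))) (hat (Om (x 0) (hess u x))) = 0.
  rewrite -(ev_xs Ax); apply: T_null; last by rewrite pfaffian_Om_x.
  by move=> p r pr; rewrite dx (negbTE pr).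
exact: (hodge_weyl_point HT Fx hE gxT gxh k0 (T_curvature_like Ax) Td Tx i j k l).
Qed.

Lemma kap_at_continuous : {within dom A, continuous kap_at}.
Proof.
pose f := kap (c12 xs) (c13 xs) U.
have fc : {within dom A, continuous (sval f)}.
  apply: continuous_in_subspaceT => x /set_mem Ax.
  exact: differentiable_continuous (sfun_diff f Ax).
apply: subspace_eq_continuous fc => x /set_mem Ax.
by apply/esym; exact: kap_at_eval.
Qed.

(** The star acts on the Weyl tensor as the sign of [kap_at], which is continuous and nowhere zero,
    hence of constant sign by the intermediate value property. *)
Lemma half_flat_connected : connected (dom A) -> half_flat g (dom A).
Proof.
move=> Ac; have k0 x : dom A x -> kap_at x != 0.
  by move=> Ax; rewrite (kap_at_eval Ax); exact: kappa_neq0.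
have Ic := connected_continuous_connected Ac kap_at_continuous.
have Iv : is_interval (kap_at @` dom A) by exact/connected_intervalP.
have [Hpos|Hneg] : (forall x, dom A x -> 0 < kap_at x) \/ (forall x, dom A x -> kap_at x < 0).
  have [x0 A0] := dom_point A; have := k0 _ A0; rewrite neq_lt => /orP[n0|p0].
    right=> x Ax; rewrite ltNge le_eqVlt negb_or eq_sym k0 //=; apply/negP => px.
    have [y Ay y0] : (kap_at @` dom A) 0.
      by apply: (Iv (kap_at x0) (kap_at x)); [exists x0|exists x|rewrite !ltW].
    by have := k0 _ Ay; rewrite y0 eqxx.
  left=> x Ax; rewrite ltNge le_eqVlt negb_or k0 //=; apply/negP => px.
  have [y Ay y0] : (kap_at @` dom A) 0.
    by apply: (Iv (kap_at x) (kap_at x0)); [exists x|exists x0|rewrite !ltW].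
  by have := k0 _ Ay; rewrite y0 eqxx.
- left=> x Ax i j k l; rewrite /weyl_minus hodge_weyl_solution_metric //.
  by rewrite gtr0_sg ?Hpos // mul1r subrr mulr0.
- right=> x Ax i j k l; rewrite /weyl_plus hodge_weyl_solution_metric //.
  by rewrite ltr0_sg ?Hneg // mulN1r subrr mulr0.
Qed.

End AtMetric.

Lemma half_flat_domain : connected (dom A) ->
  half_flat (char_metric (@modified_heavenly R) u) (dom A).
Proof. by move=> Ac; have [gK [gT gh]] := gK_ex; exact: half_flat_connected gT gh Ac. Qed.

End SolutionOnDomain.

Theorem modified_heavenly_half_flat (R : realType) (A : set 'rV[R]_4) (u : 'rV[R]_4 -> R) :
  open A -> connected A -> solution (@modified_heavenly R) A u ->
  char_nondegenerate (@modified_heavenly R) A u ->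
  half_flat (char_metric (@modified_heavenly R) u) A.
Proof.
move=> Ao Ac sol nd; have [A0|N] := pselect (exists x, A x).
  exact: (half_flat_domain (A := OpenDomain Ao A0) sol nd Ac).
by left=> x Ax; case: N; exists x.
Qed.

Section PolynomialIdentities.
Variable F : realFieldType.

(** Plays the role of a density argument: an identity checked at infinitely many parameters extends
    to the degenerate ones. *)
Lemma poly_eq0_inj (p : {poly F}) (r : nat -> F) : injective r ->
  (forall n, p.[r n] = 0) -> p = 0.
Proof.
move=> rI p0; have [//|pn0] := eqVneq p 0.
have : (size [seq r n | n <- iota 0 (size p)] < size p)%N.
  apply: (max_poly_roots pn0); first by apply/allP => _ /mapP[n _ ->]; rewrite /root p0.
  by rewrite map_inj_uniq ?iota_uniq.
by rewrite size_map size_iota ltnn.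
Qed.

Lemma natr_succ_inj : injective (fun n => n.+1%:R : F).
Proof. by move=> m n /eqP; rewrite eqr_nat eqSS => /eqP. Qed.

End PolynomialIdentities.

(** * Conformally symplectic maps preserving the equation *)

Section Transvections.
Variable F : realFieldType.
Implicit Types (H U : 'M[F]_4) (r q p : 'rV[F]_4).

(** The term in [t ^+ 2] is (a + b + c) r_0 r_1 r_2 r_3, which vanishes. So a characteristic rank
    one direction at a point of the equation spans a whole line inside the equation. *)
Lemma heav_rank1 a b c H r t : a + b + c = 0 ->
  2 * heav a b c (H + t *: (r^T *m r)) =
  2 * heav a b c H + t * (r *m symbol a b c H *m r^T) 0 0.
Proof.
move=> abc; have cE : c = - (a + b) by rewrite -[RHS]add0r -abc; ring.
have rrE i j : (r^T *m r) i j = r 0 i * r 0 j.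
  by rewrite mxE big_ord_recl big_ord0 addr0 mxTE; congr (r _ _ * r _ _); exact: ord1.
rewrite mulmx4E ![(r *m _) _ _]mulmx4E !mxTE !mxE /= /heav !(mxDE, mxZE) !rrE cE.
ring.
Qed.

(** The vectors of the plane spanned by [d/dx_i] and [d/dp_i] are
    characteristic at every point of the equation. *)
Lemma characteristic_plane a b c H i s t : H^T = H -> a + b + c = 0 ->
    heav a b c H = 0 ->
  let r := t *: delta_mx 0 i - s *: delta_mx 0 i *m H : 'rV[F]_4 in
  (r *m symbol a b c H *m r^T) 0 0 = 0.
Proof.
move=> HT abc F0; have cE : c = - (a + b) by rewrite -[RHS]add0r -abc; ring.
have Hs j k : H j k = H k j by rewrite -{1}HT mxTE.
pose r : 'rV[F]_4 := \row_j (t * (i == j)%:R - s * H i j).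
move=> r0; have -> : r0 = r.
  apply/rowP => j; rewrite /r0 mxDE mxNE -scalemxAl !mxZE -rowE !mxE.
  by rewrite eqxx eq_sym.
suff -> : (r *m symbol a b c H *m r^T) 0 0 = (2 * s ^+ 2 * H i i - 2 * s * t) * heav a b c H.
  by rewrite F0 mulr0.
rewrite mulmx4E ![(r *m _) _ _]mulmx4E !mxTE !mxE /= /heav cE.
move: i @r r0; apply: ord4P => r r0; rewrite /= ?(Hs o1 o0) ?(Hs o2 o0) ?(Hs o3 o0) ?(Hs
  o2 o1) ?(Hs o3 o1) ?(Hs o3 o2); ring.
Qed.

End Transvections.

Section ConformalSymplectic.
Variable F : realFieldType.
Variables (P Q R T : 'M[F]_4) (rho : F).
Hypothesis rho0 : rho != 0.
Hypotheses (PQ : P *m Q^T = Q *m P^T) (RT : R *m T^T = T *m R^T).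
Hypothesis TP : T *m P^T - R *m Q^T = rho%:M.

Let PT : P *m T^T - Q *m R^T = rho%:M.
Proof. by rewrite -[RHS]tr_scalar_mx -TP linearB /= !trmx_mul !trmxK. Qed.

(** The hypotheses say that the block matrix times its symplectic adjoint is [rho]; the two matrices
    commute. *)
Lemma symplectic_transpose : [/\ T^T *m P - Q^T *m R = rho%:M,
  T^T *m Q = Q^T *m T, P^T *m R = R^T *m P & P^T *m T - R^T *m Q = rho%:M].
Proof.
pose S := block_mx P Q R T; pose S' := block_mx T^T (- Q^T) (- R^T) P^T.
have SS' : S *m (rho^-1 *: S') = 1%:M.
  rewrite -scalemxAr mulmx_block !mulmxN PT PQ [- _ + _]addrC subrr RT subrr.
  by rewrite [- _ + _]addrC TP -scalar_mx_block scale_scalar_mx mulVf.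
have := mulmx1C SS'; rewrite -scalemxAl => /(congr1 ( *:%R rho)).
rewrite scalerA mulfV // scale1r scale_scalar_mx mulr1 scalar_mx_block mulmx_block.
move=> /eq_block_mx[]; rewrite !mulNmx => e1 e2 e3 e4; split => //.
- by apply/eqP; rewrite -subr_eq0 e2.
- by apply/eqP; rewrite -subr_eq0 addrC e3.
- by rewrite addrC.
Qed.

(** [H'] is the image of [H] under the action of [[P, Q], [R, T]] on the
    Lagrangian Grassmannian. *)
Definition lagr_rel (H H' : 'M[F]_4) :=
  P + H *m R \in unitmx /\ (P + H *m R) *m H' = Q + H *m T.

Lemma lagr_rel_sym H H' : H^T = H -> lagr_rel H H' -> H'^T = H'.
Proof.
move=> HT [Zu ZH]; set Z := P + H *m R in Zu ZH.
have key : (Q + H *m T) *m Z^T = Z *m (Q + H *m T)^T.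
  have ZT : Z^T = P^T + R^T *m H by rewrite raddfD /= trmx_mul HT.
  have WT : (Q + H *m T)^T = Q^T + T^T *m H by rewrite raddfD /= trmx_mul HT.
  rewrite ZT WT /Z 2!mulmxDl !mulmxDr PQ.
  have -> : H *m T *m P^T = H *m R *m Q^T + rho *: H.
    by rewrite -!mulmxA -mul_mx_scalar -mulmxDr; congr (_ *m _); rewrite -TP addrC subrK.
  have -> : P *m (T^T *m H) = Q *m (R^T *m H) + rho *: H.
    by rewrite !mulmxA -mul_scalar_mx -mulmxDl; congr (_ *m _); rewrite -PT addrC subrK.
  have -> : H *m R *m (T^T *m H) = H *m T *m (R^T *m H).
    by rewrite -!mulmxA (mulmxA R) RT -mulmxA.
  move: (Q *m P^T) (Q *m _) (H *m R *m Q^T) (rho *: H) (H *m T *m _) => y1 y2 y3 y4 y5.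
  by rewrite !addrA; congr (_ + _); rewrite -!addrA; congr (_ + (_ + _)); rewrite addrC.
have E : Z *m H' *m Z^T = Z *m H'^T *m Z^T by rewrite ZH key -ZH trmx_mul mulmxA.
have := congr1 (fun X => invmx Z *m X *m invmx Z^T) E.
by rewrite !mulmxA !mulVmx // !mul1mx !mulmxK ?unitmx_tr // => ->.
Qed.

Variables (a b c al be ga : F).
Hypotheses (abc : a + b + c = 0) (abg : al + be + ga = 0).
Hypotheses (al0 : al != 0) (be0 : be != 0) (ga0 : ga != 0).
Hypothesis maps : forall H H', H^T = H -> H'^T = H' -> lagr_rel H H' ->
  heav a b c H = 0 -> heav al be ga H' = 0.
Hypothesis maps_inv : forall H H', H^T = H -> H'^T = H' -> lagr_rel H H' ->
  heav al be ga H' = 0 -> heav a b c H = 0.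

(** [T^T - H' *m R^T] is the denominator of the inverse action, and its product with the direct
    denominator [P + H *m R] is [rho]. *)
Lemma lagr_rel_inv H' : H'^T = H' -> T^T - H' *m R^T \in unitmx ->
  exists H, [/\ H^T = H, lagr_rel H H' &
    (P + H *m R) = rho *: invmx (T^T - H' *m R^T)].
Proof.
move=> H'T; set Y := T^T - _ => Yu.
have [t1 t2 t3 t4] := symplectic_transpose.
pose H := invmx Y *m (H' *m P^T - Q^T).
have YZ : Y *m (P + H *m R) = rho%:M.
  rewrite mulmxDr !mulmxA mulmxV // mul1mx /Y !mulmxBl -t1 -!mulmxA t3.
  by rewrite addrA subrK.
have ZE : P + H *m R = rho *: invmx Y.
  by rewrite -[LHS]mul1mx -(mulVmx Yu) -mulmxA YZ mul_mx_scalar.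
exists H; split=> //.
- have YT : Y^T = T - R *m H'.
    by rewrite /Y linearB /= trmx_mul !trmxK H'T.
  have key : (H' *m P^T - Q^T) *m Y^T = Y *m (H' *m P^T - Q^T)^T.
    have -> : (H' *m P^T - Q^T)^T = P *m H' - Q by rewrite linearB /= trmx_mul !trmxK H'T.
    rewrite YT /Y !mulmxBl !mulmxBr.
    have -> : H' *m P^T *m T = rho *: H' + H' *m R^T *m Q.
      by rewrite -!mulmxA -mul_mx_scalar -mulmxDr; congr (_ *m _); rewrite -t4 subrK.
    have -> : T^T *m (P *m H') = rho *: H' + Q^T *m (R *m H').
      by rewrite !mulmxA -mul_scalar_mx -mulmxDl; congr (_ *m _); rewrite -t1 subrK.
    rewrite t2 -(mulmxA H') -(mulmxA H') !mulmxA -(mulmxA H' P^T) t3 !mulmxA.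
    set y1 := rho *: H'; set y2 := H' *m R^T *m Q; set y3 := H' *m R^T *m P *m H'.
    set y4 := Q^T *m T; set y5 := Q^T *m R *m H'.
    apply/matrixP => i j; rewrite !(mxDE, mxNE).
    by move: (y1 i j) (y2 i j) (y3 i j) (y4 i j) (y5 i j); clear => *; ring.
  pose W := (H' *m P^T - Q^T) *m Y^T.
  have WT : W^T = W by rewrite /W trmx_mul trmxK -key.
  have -> : H = invmx Y *m W *m invmx Y^T.
    by rewrite /W -!mulmxA mulmxV ?unitmx_tr // mulmx1.
  by move: WT; clearbody W => WT; rewrite !trmx_mul WT !trmx_inv trmxK mulmxA.
- split; first by rewrite ZE unitmxZ ?unitfE // unitmx_inv.
  have -> : (P + H *m R) *m H' = invmx Y *m (Y *m (P + H *m R) *m H').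
    by rewrite !mulmxA mulVmx // mul1mx.
  rewrite YZ; have -> : Q + H *m T = invmx Y *m (Y *m (Q + H *m T)).
    by rewrite !mulmxA mulVmx // mul1mx.
  congr (_ *m _); rewrite mulmxDr !mulmxA mulmxV // mul1mx /Y !mulmxBl.
  rewrite mul_scalar_mx t2 -(mulmxA H' R^T) -(mulmxA H' P^T).
  have -> : P^T *m T = rho%:M + R^T *m Q by rewrite -t4 subrK.
  rewrite mulmxDr mul_mx_scalar.
  move: (rho *: H') (Q^T *m T) (H' *m _) => y1 y2 y3.
  apply/matrixP => k l; rewrite !(mxDE, mxNE).
  by move: (y1 k l) (y2 k l) (y3 k l); clear => *; ring.
Qed.

(** [p - q *m H] is the class of the vector with components [q] along x and [p] along the momenta,
    modulo the Lagrangian plane of [H]. *)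
Definition char_poly_at (q p : 'rV[F]_4) (H : 'M[F]_4) : F :=
  let r := p - q *m H in (r *m symbol al be ga H *m r^T) 0 0.

(** One of [t = 1] and [t = -1] works, as failure of both would force [rho = 0]. It keeps a rank one
    perturbation inside the domain of the action. *)
Lemma exists_small_unit (mu : F) : exists2 t : F, t != 0 & rho + t * mu != 0.
Proof.
have [E|N] := eqVneq (rho + mu) 0; last by exists 1; rewrite ?oner_neq0 ?mul1r.
exists (-1); first by rewrite oppr_eq0 oner_neq0.
apply/eqP => E2; have : rho = 0 by lra.
by apply/eqP.
Qed.

(** The line through [H] in a characteristic rank one direction lies in the first equation. A second
    point of it goes to [H'] plus a rank one matrix, which is then on the second equation, and
    [heav_rank1] read backwards makes the image direction characteristic. *)
Lemma characteristic_image_unit i s t H' : H'^T = H' -> heav al be ga H' = 0 ->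
    T^T - H' *m R^T \in unitmx ->
  char_poly_at (s *: delta_mx 0 i *m P + t *: delta_mx 0 i *m R)
    (s *: delta_mx 0 i *m Q + t *: delta_mx 0 i *m T) H' = 0.
Proof.
move=> H'T F'0 Yu; have [H [HT rel ZE]] := lagr_rel_inv H'T Yu.
set q : 'rV[F]_4 := s *: _; set p : 'rV[F]_4 := t *: _.
have F0 := maps_inv HT H'T rel F'0.
pose r := p - q *m H.
have rM : (r *m symbol a b c H *m r^T) 0 0 = 0 by exact: characteristic_plane.
set Y := T^T - _ in Yu ZE; set Z := P + _ in ZE.
have [Zu ZH'] := rel; rewrite -/Z in Zu ZH'.
pose r' := r *m Y^T.
have r'E : q *m Q + p *m T - (q *m P + p *m R) *m H' = r'.
  have YT : Y^T = T - R *m H' by rewrite /Y linearB /= trmx_mul !trmxK H'T.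
  rewrite /r' YT /r mulmxBr !mulmxBl mulmxDl.
  have -> : q *m Q = q *m Z *m H' - q *m H *m T.
    by rewrite -mulmxA ZH' mulmxDr !mulmxA addrK.
  rewrite /Z mulmxDr mulmxDl !mulmxA.
  move: (q *m P *m H') (q *m H *m R *m H') (q *m H *m T) (p *m T) (p *m R *m H') => y1 y2 y3 y4 y5.
  apply/matrixP => k l; rewrite !(mxDE, mxNE).
  by move: (y1 k l) (y2 k l) (y3 k l) (y4 k l) (y5 k l); clear => *; ring.
clearbody r.
have Zr' : Z *m r'^T = rho *: r^T.
  by rewrite ZE /r' trmx_mul trmxK -scalemxAl mulmxA mulVmx // mul1mx.
pose mu := (r *m R *m r'^T) 0 0.
have muE : r *m R *m r'^T = mu%:M by exact: mx11_scalar.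
have [k k0 kmu] := exists_small_unit mu.
(* The coefficient of the image perturbation, by the Sherman-Morrison formula for the inverse of
   [P + H2 *m R]. *)
pose k' := k / (rho + k * mu).
have k'0 : k' != 0 by rewrite mulf_neq0 // invr_eq0.
pose H2 := H + k *: (r^T *m r); pose H2' := H' + k' *: (r'^T *m r').
have symr (v : 'rV[F]_4) : (v^T *m v)^T = v^T *m v by rewrite trmx_mul trmxK.
have H2T : H2^T = H2 by rewrite linearD linearZ /= symr HT.
have H2'T : H2'^T = H2' by rewrite linearD linearZ /= symr H'T.
have Z2 : P + H2 *m R = Z + k *: (r^T *m (r *m R)).
  by rewrite mulmxDl addrA -scalemxAl -mulmxA.
have rel2 : lagr_rel H2 H2'.
  split; rewrite Z2.
    have -> : Z + k *: (r^T *m (r *m R)) = Z *m (1%:M + (k / rho) *: (r'^T *m (r *m R))).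
      by rewrite mulmxDr mulmx1 -scalemxAr (mulmxA Z) Zr' -scalemxAl scalerA divfK.
    rewrite unitmx_mul Zu /=.
    have inv : (1%:M + (k / rho) *: (r'^T *m (r *m R))) *m (1%:M - k' *: (r'^T *m (r *m R))) = 1%:M.
      rewrite mulmxDl mul1mx mulmxBr mulmx1 -!scalemxAl -!scalemxAr.
      have -> : r'^T *m (r *m R) *m (r'^T *m (r *m R)) = mu *: (r'^T *m (r *m R)).
        by rewrite mulmxA -(mulmxA r'^T) muE mul_mx_scalar -scalemxAl.
      rewrite !scalerA -scalerBl -addrA; rewrite [- _ + _]addrC -scalerBl.
      rewrite (_ : _ - _ - _ = 0) ?scale0r ?addr0 //.
      by rewrite /k'; field; rewrite kmu rho0.
    by have [] := mulmx1_unit inv.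
  have r'D : r' = r *m T - r *m R *m H'.
    have YT : Y^T = T - R *m H' by rewrite /Y linearB /= trmx_mul !trmxK H'T.
    by rewrite /r' YT mulmxBr mulmxA.
  rewrite /H2 mulmxDl [_ *m T]mulmxDl addrA -ZH' /H2' !mulmxDr -!scalemxAr -!scalemxAl.
  rewrite (mulmxA Z) Zr' -scalemxAl (mulmxA _ r'^T r').
  have -> : r^T *m (r *m R) *m r'^T = mu *: r^T.
    by rewrite -mulmxA muE mul_mx_scalar.
  have -> : r^T *m r *m T = r^T *m r' + r^T *m (r *m R) *m H'.
    by rewrite r'D mulmxBr !mulmxA subrK.
  rewrite -!scalemxAl scalerDr !scalerA -!addrA; congr (_ + _).
  rewrite addrCA [RHS]addrC; congr (_ + _); rewrite -scalerDl; congr (_ *: _).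
  by rewrite /k'; field.
have F2 : heav a b c H2 = 0.
  have := heav_rank1 H r k abc; rewrite F0 rM !mulr0 addr0 -/H2 => /eqP.
  by rewrite mulf_eq0 pnatr_eq0 => /eqP.
have F2' := maps H2T H2'T rel2 F2.
have := heav_rank1 H' r' k' abg; rewrite -/H2' F2' F'0 !mulr0 add0r => /eqP.
by rewrite eq_sym mulf_eq0 (negbTE k'0) /= /char_poly_at r'E => /eqP.
Qed.

(** Kernel vectors [v_t] of [T - t R] for distinct [t] have nonzero pairwise
    orthogonal images [v_t R], so there are at most four of them. *)
Lemma exists_transversal : exists t : F, T^T - t%:M *m R^T \in unitmx.
Proof.
apply: contrapT => N.
have ker (n : 'I_5) : exists v : 'rV[F]_4, v != 0 /\ v *m T = n%:R *: (v *m R).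
  have : \det (T - n%:R%:M *m R) == 0.
    apply/negPn/negP => d0; apply: N; exists n%:R.
    rewrite -unitmx_tr linearB /= trmx_mul !trmxK tr_scalar_mx unitmxE unitfE.
    by rewrite mul_mx_scalar -mul_scalar_mx.
  move=> /det0P[v v0 vK]; exists v; split=> //.
  by move: vK; rewrite mulmxBr mulmxA mul_mx_scalar -scalemxAl => /eqP; rewrite subr_eq0 => /eqP.
have [v vP] := fin_all_exists ker.
pose W : 'M[F]_(5, 4) := \matrix_i (v i *m R).
have WE i j : (W *m W^T) i j = (v i *m R *m (v j *m R)^T) 0 0.
  rewrite !mxE; apply: eq_bigr => k _.
  by rewrite [W i k]mxE !mxTE [W j k]mxE.
have orth i j : i != j -> (W *m W^T) i j = 0.
  move=> ij; rewrite WE; set y := _ 0 0.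
  have e1 : i%:R * y = j%:R * y.
    have [_ vi] := vP i; have [_ vj] := vP j.
    have a1 : v i *m T *m (v j *m R)^T = i%:R *: (v i *m R *m (v j *m R)^T).
      by rewrite vi -scalemxAl.
    have a2 : v i *m R *m (v j *m T)^T = j%:R *: (v i *m R *m (v j *m R)^T).
      by rewrite vj linearZ /= -scalemxAr.
    have a3 : v i *m T *m (v j *m R)^T = v i *m R *m (v j *m T)^T.
      by rewrite !trmx_mul !mulmxA -(mulmxA (v i) T) -(mulmxA (v i) R) RT.
    by move: a3; rewrite a1 a2 => /matrixP/(_ 0 0); rewrite !mxZE.
  have : (i%:R - j%:R) * y = 0 by rewrite mulrBl e1 subrr.
  move=> /eqP; rewrite mulf_eq0 subr_eq0 eqr_nat => /orP[/eqP/val_inj ijE|/eqP //].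
  by rewrite ijE eqxx in ij.
have diag i : (W *m W^T) i i != 0.
  rewrite WE; have [v0 vi] := vP i; apply/eqP => y0.
  have vR : v i *m R = 0.
    apply/rowP => k; rewrite [RHS]mxE; move: y0; rewrite mxE => /eqP.
    rewrite psumr_eq0; last by move=> m _; rewrite mxTE -expr2 sqr_ge0.
    by move=> /allP/(_ k); rewrite mem_index_enum => /(_ isT); rewrite mxTE mulf_eq0 orbb => /eqP.
  have vT : v i *m T = 0 by rewrite vi vR scaler0.
  have : v i *m (T *m P^T - R *m Q^T) = 0.
    by rewrite mulmxBr !mulmxA vR vT !mul0mx subrr.
  rewrite TP mul_mx_scalar => /eqP; rewrite scaler_eq0 (negbTE rho0) /=.
  exact/negP.
have : (\rank (W *m W^T) <= 4)%N.
  by apply: leq_trans (mxrankM_maxl _ _) _; exact: rank_leq_col.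
have -> : W *m W^T = diag_mx (\row_i (W *m W^T) i i).
  apply/matrixP => i j; rewrite [RHS]mxE [(\row__ _) _ _]mxE.
  by have [->|ij] := eqVneq i j; rewrite ?mulr1n ?mulr0n // orth.
rewrite mxrank_unit // unitmxE det_diag unitfE; apply/prodf_neq0 => i _.
by rewrite mxE.
Qed.

(** The equation ignores the diagonal of [H'], so [t + y (H' - t)] is a line of
    solutions; [H'] is the limit of its points with invertible denominator. *)
Lemma characteristic_image i s t H' : H'^T = H' -> heav al be ga H' = 0 ->
  char_poly_at (s *: delta_mx 0 i *m P + t *: delta_mx 0 i *m R)
    (s *: delta_mx 0 i *m Q + t *: delta_mx 0 i *m T) H' = 0.
Proof.
move=> H'T F'0; have [t0 t0u] := exists_transversal.
set q := (X in char_poly_at X); set p := (X in char_poly_at _ X).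
pose pc m n (A : 'M[F]_(m, n)) := map_mx (@polyC F) A.
pose Hx : 'M[{poly F}]_4 := pc _ _ t0%:M + 'X *: pc _ _ (H' - t0%:M).
pose rx := pc _ _ p - pc _ _ q *m Hx.
pose f := (rx *m symbol al%:P be%:P ga%:P Hx *m rx^T) 0 0.
pose g := \det (pc _ _ T^T - Hx *m pc _ _ R^T).
pose Hs (y : F) := t0%:M + y *: (H' - t0%:M).
have ev m n y (A : 'M[F]_(m, n)) : map_mx (horner_eval y) (pc _ _ A) = A.
  by apply/matrixP => k l; rewrite !mxE /= /horner_eval hornerC.
have HxE y : map_mx (horner_eval y) Hx = Hs y.
  by rewrite /Hx map_mxD map_mxZ !ev /= /horner_eval hornerX.
have rxE y : map_mx (horner_eval y) rx = p - q *m Hs y.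
  by rewrite /rx map_mxB map_mxM HxE !ev.
have fE y : f.[y] = char_poly_at q p (Hs y).
  transitivity ((map_mx (horner_eval y) (rx *m symbol al%:P be%:P ga%:P Hx *m rx^T)) 0 0).
    by rewrite mxE.
  rewrite !map_mxM map_symbol HxE rxE /char_poly_at -rxE.
  rewrite /= /horner_eval !hornerC; congr ((_ *m _) 0 0).
  by apply/matrixP => k l; rewrite !mxE.
have gE y : g.[y] = \det (T^T - Hs y *m R^T).
  transitivity (horner_eval y g) => //.
  by rewrite /g -det_map_mx map_mxB map_mxM !ev HxE.
have HsT y : (Hs y)^T = Hs y.
  by rewrite linearD linearZ linearB /= H'T !tr_scalar_mx.
have Hs0 y : heav al be ga (Hs y) = 0.
  have off (k l : 'I_4) : k != l -> Hs y k l = y * H' k l.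
    by move=> kl; rewrite !mxE (negbTE kl) mulr0n add0r oppr0 addr0.
  transitivity (y ^+ 2 * heav al be ga H'); last by rewrite F'0 mulr0.
  by rewrite /heav !off //; ring.
have fg : f * g = 0.
  apply: (poly_eq0_inj (@natr_succ_inj F)) => n; rewrite hornerM fE gE.
  have [->|d0] := eqVneq (\det (T^T - Hs n.+1%:R *m R^T)) 0; first by rewrite mulr0.
  rewrite characteristic_image_unit ?mul0r //.
  by rewrite unitmxE unitfE.
have g0 : g != 0.
  apply/eqP => g0; have := gE 0; rewrite g0 horner0 /Hs scale0r addr0 => /esym/eqP.
  by apply/negP; rewrite -unitfE -unitmxE.
have f0 : f = 0.
  by move/eqP: fg; rewrite mulf_eq0 (negbTE g0) orbF => /eqP.
have := fE 1; rewrite f0 horner0 /Hs scale1r addrC subrK => <-.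
by [].
Qed.

(** The only nonzero off-diagonal entry, up to symmetry, sits at the two indices other than [i] and
    [j]. Every monomial of the equation then vanishes, and the characteristic form at a covector [r]
    is a nonzero multiple of [r_i r_j]; varying [d] and [e] separates the components. *)
Definition test_hessian (i j : 'I_4) (d e : F) : 'M[F]_4 := \matrix_(r, s)
  if r == s then (if r == i then d else if r == j then e else 0)
  else [&& r != i, r != j, s != i & s != j]%:R.

Lemma characteristic_pairs (q p : 'rV[F]_4) :
    (forall H', H'^T = H' -> heav al be ga H' = 0 -> char_poly_at q p H' = 0) ->
  forall i j, i != j -> [/\ q 0 i * q 0 j = 0, p 0 i * p 0 j = 0,
    q 0 i * p 0 j = 0 & p 0 i * q 0 j = 0].
Proof.
move=> qp i j ij.
have tT d e : (test_hessian i j d e)^T = test_hessian i j d e.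
  apply/matrixP => r s; rewrite !mxE eq_sym; case: eqP => [-> //|_].
  by congr (nat_of_bool _)%:R; case: (r == i); case: (r == j); case: (s == i); case: (s == j).
have t0 d e : heav al be ga (test_hessian i j d e) = 0.
  by move: i j ij {tT}; apply: ord4P; apply: ord4P => // _; rewrite /heav !mxE /=; ring.
have [k k0 kE] : exists2 k, k != 0 & forall d e, char_poly_at q p (test_hessian i j d e) =
    2 * k * ((p 0 i - q 0 i * d) * (p 0 j - q 0 j * e)).
  have rE (H : 'M[F]_4) l : (p - q *m H) 0 l = p 0 l - (q 0 o0 * H o0 l + q 0 o1 * H o1
    l + q 0 o2 * H o2 l + q 0 o3 * H o3 l).
    by rewrite mxDE mxNE mulmx4E.
  have cE (H : 'M[F]_4) (r : 'rV[F]_4) : (r *m symbol al be ga H *m r^T) 0 0 =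
      2 * (al * (H o2 o3 * r 0 o0 * r 0 o1 + H o0 o1 * r 0 o2 * r 0 o3)
        + be * (H o1 o3 * r 0 o0 * r 0 o2 + H o0 o2 * r 0 o1 * r 0 o3)
        + ga * (H o1 o2 * r 0 o0 * r 0 o3 + H o0 o3 * r 0 o1 * r 0 o2)).
    by rewrite mulmx4E ![(r *m _) _ _]mulmx4E !mxTE !mxE /=; ring.
  (* The coefficient of the monomial whose pairing of the four indices contains the pair [i],
     [j]. *)
  pose kk := if (i \in [:: o0; o1]) == (j \in [:: o0; o1]) then al else
    if (i \in [:: o0; o2]) == (j \in [:: o0; o2]) then be else ga.
  exists kk; first by rewrite /kk; do 2 case: ifP => // _.
  move=> d e; rewrite /char_poly_at cE !rE.
  move: i j ij @kk {tT t0}; apply: ord4P; apply: ord4P => //= _; rewrite !mxE /=; ring.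
have K d e : (p 0 i - q 0 i * d) * (p 0 j - q 0 j * e) = 0.
  have := kE d e; rewrite qp // => /esym/eqP; rewrite !mulf_eq0 pnatr_eq0 (negbTE k0) /=.
  by rewrite -mulf_eq0 => /eqP.
have k00 := K 0 0; have k01 := K 0 1; have k10 := K 1 0; have k11 := K 1 1.
have e1 : p 0 i * p 0 j = 0 by rewrite -k00; ring.
have e2 : p 0 i * q 0 j = 0.
  transitivity (p 0 i * p 0 j - (p 0 i - q 0 i * 0) * (p 0 j - q 0 j * 1)); first by ring.
  by rewrite e1 k01 subrr.
have e3 : q 0 i * p 0 j = 0.
  transitivity (p 0 i * p 0 j - (p 0 i - q 0 i * 1) * (p 0 j - q 0 j * 0)); first by ring.
  by rewrite e1 k10 subrr.
split=> //.
transitivity (((p 0 i - q 0 i * 1) * (p 0 j - q 0 j * 1)) - p 0 i * p 0 j + p 0 i * q 0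
  j + q 0 i * p 0 j); first by ring.
by rewrite k11 e1 e2 e3; ring.
Qed.

Lemma characteristic_rows i s t (j k : 'I_4) : j != k ->
  [/\ (s * P i j + t * R i j) * (s * P i k + t * R i k) = 0,
      (s * Q i j + t * T i j) * (s * Q i k + t * T i k) = 0,
      (s * P i j + t * R i j) * (s * Q i k + t * T i k) = 0 &
      (s * Q i j + t * T i j) * (s * P i k + t * R i k) = 0].
Proof.
move=> jk; have := characteristic_pairs (@characteristic_image i s t) jk.
have rE (X Y : 'M[F]_4) l : (s *: delta_mx 0 i *m X + t *: delta_mx 0 i *m Y : 'rV_4) 0 l =
    s * X i l + t * Y i l.
  by rewrite mxDE -!scalemxAl !mxZE -!rowE ![row _ _ _ _]mxE.
by rewrite !rE.
Qed.

Lemma characteristic_support i j : T i j * P i j - R i j * Q i j != 0 ->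
  forall k : 'I_4, k != j -> [/\ P i k = 0, Q i k = 0, R i k = 0 & T i k = 0].
Proof.
move=> d0 k kj; rewrite eq_sym in kj.
have key (x y x' y' : F) : x * x' = 0 -> y * y' = 0 -> x * y' = 0 -> y * x' = 0 ->
    (x != 0) || (y != 0) -> x' = 0 /\ y' = 0.
  by move=> /eqP h1 /eqP h2 /eqP h3 /eqP h4 /orP[n|n]; move: h1 h2 h3 h4;
    rewrite !mulf_eq0 (negbTE n) /= => /eqP h1 /eqP h2 /eqP h3 /eqP h4.
have [] := characteristic_rows i 1 0 kj; rewrite !mul1r !mul0r !addr0 => p1 p2 p3 p4.
have [] := characteristic_rows i 0 1 kj; rewrite !mul1r !mul0r !add0r => r1 r2 r3 r4.
have [-> ->] : P i k = 0 /\ Q i k = 0.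
  apply: key p1 p2 p3 p4 _; rewrite -negb_and; apply: contra d0 => /andP[/eqP-> /eqP->].
  by rewrite !mulr0 subrr.
have [-> ->] // : R i k = 0 /\ T i k = 0.
  apply: key r1 r2 r3 r4 _; rewrite -negb_and; apply: contra d0 => /andP[/eqP-> /eqP->].
  by rewrite !mul0r subrr.
Qed.

(** Since [rho] is a sum of 2 by 2 minors in each row index, some minor is nonzero; by
    [characteristic_support] the image of the i-th coordinate plane then lies in a single coordinate
    plane. *)
Lemma monomial_blocks : exists2 s : 'I_4 -> 'I_4, injective s & forall i,
  T i (s i) * P i (s i) - R i (s i) * Q i (s i) = rho /\
  forall k : 'I_4, k != s i -> [/\ P i k = 0, Q i k = 0, R i k = 0 & T i k = 0].
Proof.
have ex i : exists j, T i j * P i j - R i j * Q i j != 0.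
  apply/not_existsP => N; case/eqP: rho0.
  have <- : (T *m P^T - R *m Q^T) i i = rho by rewrite TP mxE eqxx.
  rewrite mxDE mxNE [X in X - _]mxE [X in _ - X]mxE -sumrB big1 // => j _; rewrite !mxTE.
  by apply/eqP; apply: contrapT => /negP; exact: N.
have [s sP] := fin_all_exists ex.
have supp i (k : 'I_4) : k != s i -> [/\ P i k = 0, Q i k = 0, R i k = 0 & T i k = 0].
  exact: characteristic_support (sP i) _.
have rowE (X Y : 'M[F]_4) i i' : (forall k : 'I_4, k != s i -> X i k = 0) ->
    (X *m Y^T) i i' = X i (s i) * Y i' (s i).
  move=> X0; rewrite mxE (bigD1 (s i)) //= mxTE big1 ?addr0 // => k ks.
  by rewrite X0 // mul0r.
have mP i i' (Y : 'M[F]_4) : (P *m Y^T) i i' = P i (s i) * Y i' (s i).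
  by rewrite rowE // => k /supp[].
have mQ i i' (Y : 'M[F]_4) : (Q *m Y^T) i i' = Q i (s i) * Y i' (s i).
  by rewrite rowE // => k /supp[].
have mR i i' (Y : 'M[F]_4) : (R *m Y^T) i i' = R i (s i) * Y i' (s i).
  by rewrite rowE // => k /supp[].
have mT i i' (Y : 'M[F]_4) : (T *m Y^T) i i' = T i (s i) * Y i' (s i).
  by rewrite rowE // => k /supp[].
have diag i i' : T i (s i) * P i' (s i) - R i (s i) * Q i' (s i) = (i == i')%:R * rho.
  by rewrite -mT -mR -mxNE -mxDE TP mxE mulr_natl.
(* If two planes had the same image plane, the image of one of its vectors would be symplectically
   orthogonal to a basis of that plane, hence zero. *)
have inj : injective s.
  move=> i i' si; apply/eqP; apply: contrapT => /negP ii'.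
  have := diag i i'; rewrite (negbTE ii') mul0r => e1.
  have e2 : P i (s i) * Q i' (s i) - Q i (s i) * P i' (s i) = 0.
    by rewrite -mP -mQ PQ subrr.
  have := diag i i; rewrite eqxx mul1r => e3.
  have P0 : P i' (s i) = 0.
    apply: (mulfI rho0); rewrite mulr0 -e3.
    transitivity (P i (s i) * (T i (s i) * P i' (s i) - R i (s i) * Q i' (s i)) +
      R i (s i) * (P i (s i) * Q i' (s i) - Q i (s i) * P i' (s i))); first by ring.
    by rewrite e1 e2 !mulr0 addr0.
  have Q0 : Q i' (s i) = 0.
    apply: (mulfI rho0); rewrite mulr0 -e3.
    transitivity (Q i (s i) * (T i (s i) * P i' (s i) - R i (s i) * Q i' (s i)) +
      T i (s i) * (P i (s i) * Q i' (s i) - Q i (s i) * P i' (s i))); first by ring.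
    by rewrite e1 e2 !mulr0 addr0.
  have := diag i' i'; rewrite eqxx mul1r -si P0 Q0 !mulr0 subrr => /esym/eqP.
  by rewrite (negbTE rho0).
exists s => // i; split; last exact: supp.
by have := diag i i; rewrite eqxx mul1r.
Qed.

End ConformalSymplectic.

(** * Action of monomial maps on the three coefficients *)

Section MonomialAction.
Variable F : realFieldType.
Variables (P Q R T : 'M[F]_4) (rho : F) (s tau : 'I_4 -> 'I_4).
Hypothesis rho0 : rho != 0.
Hypotheses (PQ : P *m Q^T = Q *m P^T) (RT : R *m T^T = T *m R^T).
Hypothesis TP : T *m P^T - R *m Q^T = rho%:M.
Hypotheses (sK : cancel s tau) (tauK : cancel tau s).
Hypothesis blocks : forall i, T i (s i) * P i (s i) - R i (s i) * Q i (s i) = rho /\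
  forall k : 'I_4, k != s i -> [/\ P i k = 0, Q i k = 0, R i k = 0 & T i k = 0].
Variables (a b c al be ga : F).
Hypothesis maps : forall H H', H^T = H -> H'^T = H' -> lagr_rel P Q R T H H' ->
  heav a b c H = 0 -> heav al be ga H' = 0.

Let S : 'M[F]_4 := \matrix_(i, j) (j == s i)%:R.
Let di (X : 'M[F]_4) : 'M[F]_4 := diag_mx (\row_i X i (s i)).

Let mulmxS m (X : 'M[F]_(m, 4)) i j : (X *m S) i j = X i (tau j).
Proof.
rewrite mxE (bigD1 (tau j)) //= [S _ _]mxE tauK eqxx mulr1 big1 ?addr0 // => k kj.
rewrite [S _ _]mxE (_ : j == s k = false) ?mulr0 //.
by apply: contraNF kj => /eqP ->; rewrite sK.
Qed.

Let diS (X : 'M[F]_4) : (forall i (k : 'I_4), k != s i -> X i k = 0) -> X = di X *m S.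
Proof.
move=> X0; apply/matrixP => i j; rewrite mulmxS /di mxE [(\row__ _) _ _]mxE.
have [->|ij] := eqVneq i (tau j); first by rewrite tauK mulr1n.
rewrite mulr0n X0 //; apply: contra ij => /eqP ->; by rewrite sK.
Qed.

Let PS : P = di P *m S. Proof. by apply: diS => i k /(proj2 (blocks i))[]. Qed.
Let QS : Q = di Q *m S. Proof. by apply: diS => i k /(proj2 (blocks i))[]. Qed.
Let RS : R = di R *m S. Proof. by apply: diS => i k /(proj2 (blocks i))[]. Qed.
Let TS : T = di T *m S. Proof. by apply: diS => i k /(proj2 (blocks i))[]. Qed.

Let Su : S \in unitmx.
Proof.
have : S *m S^T = 1%:M.
  apply/matrixP => i j; rewrite mxE (bigD1 (s i)) //= [S _ _]mxE mxTE [S _ _]mxE eqxx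
    mul1r big1 ?addr0.
    by rewrite mxE (inj_eq (can_inj sK)).
  by move=> k ks; rewrite [S _ _]mxE (negbTE ks) mul0r.
by case/mulmx1_unit.
Qed.

(** The entries of [P] and [R] at [i], [s i] cannot both vanish, so this diagonal makes every [la i]
    nonzero and the denominator invertible at [e = 0]. *)
Let d i : F := if P i (s i) == 0 then 1 else 0.
Let la i := P i (s i) + d i * R i (s i).

Let la0 i : la i != 0.
Proof.
rewrite /la /d; have [P0|P0] := eqVneq (P i (s i)) 0; last by rewrite mul0r addr0.
rewrite P0 mul1r add0r; have [E _] := blocks i; apply: contra rho0 => /eqP R0.
by rewrite -E P0 R0 mulr0 mul0r subrr.
Qed.

Let L := diag_mx (\row_i la i).
Let Li := diag_mx (\row_i (la i)^-1).

Let diE (v : 'I_4 -> F) (X : 'M[F]_4) i j : (X *m diag_mx (\row_k v k)) i j = X i j * v j.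
Proof. by rewrite mul_mx_diag !mxE. Qed.

Let LLi : L *m Li = 1%:M.
Proof.
apply/matrixP => i j; rewrite diE !mxE.
by case: eqP => [->|]; rewrite ?mulr1n ?mulr0n ?mul0r // divff.
Qed.

Definition pull (X : 'M[F]_4) : 'M[F]_4 := \matrix_(i, j) X (tau i) (tau j).

(** The image of [diag d + e K] is, up to the permutation and diagonal terms,
    [e rho N^-1 K L^-1] with [N = L + e K diag R]. *)
Lemma heav_pull_unit K e : K^T = K -> heav a b c K = 0 -> e != 0 ->
  L + e *: (K *m di R) \in unitmx ->
  heav al be ga (pull (invmx (L + e *: (K *m di R)) *m K *m Li)) = 0.
Proof.
move=> KT K0 e0; set N := L + _ => Nu.
pose H := diag_mx (\row_i d i) + e *: K.
have HT : H^T = H by rewrite linearD linearZ /= KT tr_diag_mx.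
have diL : L = di P + diag_mx (\row_i d i) *m di R.
  by apply/matrixP => i j; rewrite mxDE diE !mxE; case: eqP => [->|]; rewrite ?mulr1n
    ?mulr0n ?mul0r ?addr0.
have ZE : P + H *m R = N *m S.
  by rewrite {1}PS {1}RS mulmxA -mulmxDl; congr (_ *m _); rewrite /H mulmxDl addrA -diL -scalemxAl.
have Zu : P + H *m R \in unitmx by rewrite ZE unitmx_mul Nu Su.
pose H' := invmx (P + H *m R) *m (Q + H *m T).
have rel : lagr_rel P Q R T H H' by split=> //; rewrite /H' mulKVmx.
have H'T := lagr_rel_sym PQ RT TP HT rel.
have off (i j : 'I_4) : i != j ->
    H' i j = e * rho * pull (invmx N *m K *m Li) i j.
  move=> ij.
  pose Ga := diag_mx (\row_i ((Q i (s i) + d i * T i (s i)) / la i)).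
  have QE : Q + H *m T = (N *m Ga + (e * rho) *: (K *m Li)) *m S.
    rewrite {1}QS {1}TS mulmxA -mulmxDl; congr (_ *m _).
    apply/matrixP => k l; have [B _] := blocks l; have := la0 l => l0.
    have tQ x y p q r t (k0 : F) : p + x * r != 0 ->
        (q + x * t) = (p + x * r) * ((q + x * t) / (p + x * r)) /\
        y * k0 * t = y * (k0 * r) * ((q + x * t) / (p + x * r)) +
          y * (t * p - r * q) * (k0 / (p + x * r)).
      by move=> n0; split; field.
    have [t1 t2] := tQ (d l) e _ (Q l (s l)) _ (T l (s l)) (K k l) l0.
    rewrite !mxDE mxZE !diE /H /N !mxDE !mxZE !diE /L ![diag_mx _ _ _]mxE ![(\row__ _) _ _]mxE.
    rewrite -B [in LHS]mulrDl (mulrDl (la k *+ _)) t2 !addrA; do 2 congr (_ + _).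
    by case: eqP => [->|_]; rewrite ?mulr1n // !mulr0n !mul0r addr0.
  have H'E : S *m H' = (Ga + (e * rho) *: (invmx N *m K *m Li)) *m S.
    have -> : Ga + (e * rho) *: (invmx N *m K *m Li) =
        invmx N *m (N *m Ga + (e * rho) *: (K *m Li)).
      by rewrite mulmxDr mulKmx // -scalemxAr mulmxA.
    by rewrite -mulmxA -QE -(proj2 rel) ZE -mulmxA mulKmx.
  have SE (X : 'M[F]_4) : (S *m X) (tau i) j = X i j.
    rewrite mxE (bigD1 i) //= [S _ _]mxE tauK eqxx mul1r big1 ?addr0 // => k ki.
    by rewrite [S _ _]mxE tauK (negbTE ki) mul0r.
  transitivity ((S *m H') (tau i) j); first by rewrite SE.
  rewrite H'E mulmxS mxDE mxZE [pull _ _ _]mxE [Ga _ _]mxE.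
  by rewrite (inj_eq (can_inj tauK)) (negbTE ij) mulr0n add0r.
have H0 : heav a b c H = 0.
  have offH (k l : 'I_4) : k != l -> H k l = e * K k l.
    by move=> kl; rewrite mxDE mxZE [diag_mx _ _ _]mxE (negbTE kl) mulr0n add0r.
  transitivity (e ^+ 2 * heav a b c K); last by rewrite K0 mulr0.
  by rewrite /heav !offH //; ring.
have := maps HT H'T rel H0; rewrite {1}/heav !off // => E.
apply: (mulfI (_ : (e * rho) ^+ 2 != 0)); first by rewrite expf_neq0 // mulf_neq0.
by rewrite mulr0 -[RHS]E /heav; ring.
Qed.

(** The adjugate makes the conclusion of [heav_pull_unit] polynomial in [e], so it extends to
    [e = 0], where the image is [Li *m K *m Li]. This rescaling is harmless: every monomial of the
    equation uses each index once and acquires the same factor. *)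
Lemma heav_pull K : K^T = K -> heav a b c K = 0 -> heav al be ga (pull K) = 0.
Proof.
move=> KT K0.
pose pc (A : 'M[F]_4) : 'M[{poly F}]_4 := map_mx (@polyC F) A.
pose Nx := pc L + 'X *: pc (K *m di R).
pose pullx (X : 'M[{poly F}]_4) : 'M[{poly F}]_4 := \matrix_(i, j) X (tau i) (tau j).
pose f := heav al%:P be%:P ga%:P (pullx (\adj Nx *m pc K *m pc Li)).
pose N e := L + e *: (K *m di R).
have ev y (A : 'M[F]_4) : map_mx (horner_eval y) (pc A) = A.
  by apply/matrixP => k l; rewrite !mxE /= /horner_eval hornerC.
have NE y : map_mx (horner_eval y) Nx = N y.
  by rewrite /Nx map_mxD map_mxZ !ev /= /horner_eval hornerX.
have fE y : f.[y] = heav al be ga (pull (\adj (N y) *m K *m Li)).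
  transitivity (horner_eval y f) => //.
  rewrite /f map_heav /= /horner_eval !hornerC -NE; congr heav.
  have -> : pull (\adj (map_mx (horner_eval y) Nx) *m K *m Li) =
      pull (map_mx (horner_eval y) (\adj Nx *m pc K *m pc Li)).
    by rewrite !map_mxM map_mx_adj !ev.
  by apply/matrixP => k l; rewrite !mxE.
have gE y : (\det Nx).[y] = \det (N y).
  by transitivity (horner_eval y (\det Nx)) => //; rewrite -det_map_mx NE.
have adjE (X : 'M[F]_4) : X \in unitmx -> \adj X = \det X *: invmx X.
  by move=> Xu; rewrite /invmx Xu scalerA mulfV ?scale1r // -unitfE -unitmxE.
have heavZ t (X : 'M[F]_4) : heav al be ga (pull (t *: X)) = t ^+ 2 * heav al be ga (pull X).
  by rewrite /heav !mxE; ring.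
have fg : f * \det Nx = 0.
  apply: (poly_eq0_inj (@natr_succ_inj F)) => n; rewrite hornerM fE gE.
  have [->|d0] := eqVneq (\det (N n.+1%:R)) 0; first by rewrite mulr0.
  have Nu : N n.+1%:R \in unitmx by rewrite unitmxE unitfE.
  by rewrite adjE // -!scalemxAl heavZ heav_pull_unit ?mulr0 ?mul0r // pnatr_eq0.
have N0 : N 0 = L by rewrite /N scale0r addr0.
have [Lu _] := mulmx1_unit LLi.
have g0 : \det Nx != 0.
  apply/eqP => g0; have := gE 0; rewrite g0 horner0 N0 => /esym/eqP.
  by apply/negP; rewrite -unitfE -unitmxE.
have f0 : f = 0 by move/eqP: fg; rewrite mulf_eq0 (negbTE g0) orbF => /eqP.
have LV : invmx L = Li by rewrite -[RHS](mulKmx Lu) LLi mulmx1.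
have := fE 0; rewrite f0 horner0 N0 adjE // LV -!scalemxAl heavZ => /esym/eqP.
rewrite mulf_eq0 expf_eq0 /= -[_ == 0]negbK -unitfE -unitmxE Lu /= => /eqP E.
have LiE (X : 'M[F]_4) i j : (Li *m X *m Li) i j = (la i)^-1 * X i j / la j.
  by rewrite diE mul_diag_mx !mxE.
have pullE X i j : pull X i j = X (tau i) (tau j) by rewrite mxE.
pose p := (la (tau o0))^-1 * (la (tau o1))^-1 * (la (tau o2))^-1 * (la (tau o3))^-1.
have p0 : p != 0 by rewrite !mulf_neq0 // invr_eq0.
by apply: (mulfI p0); rewrite mulr0 -[RHS]E /heav !pullE !LiE /p; ring.
Qed.

End MonomialAction.

Section PairingClasses.
Variable F : realFieldType.
Implicit Types (X Y Z : F).

(** One factor of each monomial is set to 1, so that the equation becomes the linear form with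
    coefficients a, b, c in X, Y, Z. *)
Definition pairing_mx X Y Z : 'M[F]_4 := mx4
  [:: [:: 0; X; Y; Z]; [:: X; 0; 1; 1]; [:: Y; 1; 0; 1]; [:: Z; 1; 1; 0]].

(** A permutation of the indices permutes the three pairings, hence the coefficients. Only symmetric
    functions of them are recorded, which avoids naming the permutation. *)
Lemma heav_pull_pairing (tau : 'I_4 -> 'I_4) al be ga : injective tau ->
  exists al' be' ga', [/\ forall X Y Z,
      heav al be ga (pull tau (pairing_mx X Y Z)) = al' * X + be' * Y + ga' * Z,
    al' * be' * ga' = al * be * ga &
    al' ^+ 2 + be' ^+ 2 + ga' ^+ 2 = al ^+ 2 + be ^+ 2 + ga ^+ 2].
Proof.
move=> inj; pose E X Y Z := heav al be ga (pull tau (pairing_mx X Y Z)).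
exists (E 1 0 0), (E 0 1 0), (E 0 0 1); rewrite /E /heav.
have ne i j : i != j -> tau i != tau j by rewrite (inj_eq inj).
have := ne o0 o1 isT; have := ne o0 o2 isT; have := ne o0 o3 isT.
have := ne o1 o2 isT; have := ne o1 o3 isT; have := ne o2 o3 isT.
suff H : forall i0 i1 i2 i3 : 'I_4, i2 != i3 -> i1 != i3 -> i1 != i2 -> i0 != i3 ->
    i0 != i2 -> i0 != i1 ->
    let E X Y Z := al * pairing_mx X Y Z i0 i1 * pairing_mx X Y Z i2 i3
      + be * pairing_mx X Y Z i0 i2 * pairing_mx X Y Z i1 i3
      + ga * pairing_mx X Y Z i1 i2 * pairing_mx X Y Z i0 i3 in
    [/\ forall X Y Z, E X Y Z = E 1 0 0 * X + E 0 1 0 * Y + E 0 0 1 * Z,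
    E 1 0 0 * E 0 1 0 * E 0 0 1 = al * be * ga &
    E 1 0 0 ^+ 2 + E 0 1 0 ^+ 2 + E 0 0 1 ^+ 2 = al ^+ 2 + be ^+ 2 + ga ^+ 2].
  move=> n1 n2 n3 n4 n5 n6; have [h1 h2 h3] := H _ _ _ _ n1 n2 n3 n4 n5 n6.
  have pE X Y Z i j : pull tau (pairing_mx X Y Z) i j = pairing_mx X Y Z (tau i) (tau j).
    by rewrite mxE.
  by split=> [X Y Z||]; rewrite !pE; [exact: h1|exact: h2|exact: h3].
apply: ord4P; apply: ord4P; apply: ord4P; apply: ord4P => // _ _ _ _ _ _ E';
  by split=> [X Y Z||]; rewrite /E' !mxE /=; ring.
Qed.

End PairingClasses.

(** The zeros of one linear form are zeros of the other, so the coefficient triples are proportional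
    after a permutation. The identity is symmetric in each triple and homogeneous of degree six in
    each. *)
Lemma heavenly_invariant (F : realFieldType) (P Q R T : 'M[F]_4) (rho a b c al be ga : F) :
    rho != 0 -> P *m Q^T = Q *m P^T -> R *m T^T = T *m R^T ->
    T *m P^T - R *m Q^T = rho%:M ->
    a + b + c = 0 -> al + be + ga = 0 -> al != 0 -> be != 0 -> ga != 0 ->
    (forall H H', H^T = H -> H'^T = H' -> lagr_rel P Q R T H H' ->
      (heav a b c H = 0 <-> heav al be ga H' = 0)) ->
  (a ^+ 2 + b ^+ 2 + c ^+ 2) ^+ 3 * (al * be * ga) ^+ 2 =
  (a * b * c) ^+ 2 * (al ^+ 2 + be ^+ 2 + ga ^+ 2) ^+ 3.
Proof.
move=> rho0 PQ RT TP abc abg al0 be0 ga0 maps.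
have fwd H H' (h1 : H^T = H) (h2 : H'^T = H') (h3 : lagr_rel P Q R T H H') :=
  proj1 (maps H H' h1 h2 h3).
have bwd H H' (h1 : H^T = H) (h2 : H'^T = H') (h3 : lagr_rel P Q R T H H') :=
  proj2 (maps H H' h1 h2 h3).
have [s sinj sP] := monomial_blocks rho0 PQ RT TP abc abg al0 be0 ga0 fwd bwd.
have [tau sK tauK] := injF_bij sinj.
have [al' [be' [ga' [E E1 E2]]]] := heav_pull_pairing al be ga (can_inj tauK).
have key X Y Z : a * X + b * Y + c * Z = 0 -> al' * X + be' * Y + ga' * Z = 0.
  move=> h; rewrite -E; apply: (heav_pull rho0 PQ RT TP sK tauK sP fwd).
    by apply/matrixP; apply: ord4P; apply: ord4P; rewrite !mxE.
  by rewrite -[RHS]h /heav !mxE /=; ring.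
have k1 : b * al' = a * be'.
  have := key b (- a) 0; rewrite mulr0 addr0 => k; apply/eqP; rewrite -subr_eq0; apply/eqP.
  by rewrite -[RHS]k; ring.
have k2 : c * al' = a * ga'.
  have := key c 0 (- a); rewrite mulr0 addr0 => k; apply/eqP; rewrite -subr_eq0; apply/eqP.
  by rewrite -[RHS]k; ring.
have al'0 : al' != 0.
  have : al' * be' * ga' != 0 by rewrite E1 !mulf_neq0.
  by rewrite !mulf_eq0 !negb_or => /andP[/andP[]].
have -> : b = a * be' / al' by rewrite -k1 mulfK.
have -> : c = a * ga' / al' by rewrite -k2 mulfK.
by rewrite -E1 -E2; field.
Qed.

(** * Contact transformations *)

Section ContactDifferential.
Variables (R : realType) (V : normedModType R) (A : set V) (z v w : V).
Variables (u : V -> R) (x p : 'I_4 -> V -> R) (r gv gw : V -> R).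
Hypotheses (Ao : open A) (Az : A z).
Hypothesis du : forall y, A y -> differentiable u y.
Hypothesis dx : forall i y, A y -> differentiable (x i) y.
Hypothesis dp : forall i, differentiable (p i) z.
Hypothesis ddu : forall v, differentiable ('D_v u) z.
Hypothesis ddx : forall i v, differentiable ('D_v (x i)) z.
Hypotheses (dr : differentiable r z) (dgv : differentiable gv z) (dgw : differentiable gw z).

Let derive_contact v' w' g : differentiable g z ->
    (forall y, A y -> 'D_w' u y - \sum_i p i y * 'D_w' (x i) y = r y * g y) ->
  'D_v' ('D_w' u) z - \sum_i (p i z * 'D_v' ('D_w' (x i)) z + 'D_w' (x i) z * 'D_v' (p i) z) =
  r z * 'D_v' g z + g z * 'D_v' r z.
Proof.
move=> dg E.
have dpx i : differentiable (p i * 'D_w' (x i)) z by exact: differentiableM.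
have -> : r z * 'D_v' g z + g z * 'D_v' r z = 'D_v' (r * g) z.
  by rewrite deriveM //; exact: diff_derivable.
have -> : 'D_v' (r * g) z = 'D_v' ('D_w' u - \sum_i (p i * 'D_w' (x i))) z.
  apply: near_eq_derive; apply: (near_open Ao Az) => y Ay; transitivity (r y * g y) =>
    //; rewrite -E //.
  by congr (_ - _); rewrite fct_sumE.
rewrite deriveB; [|exact: diff_derivable|apply: diff_derivable; exact: differentiable_sum].
congr (_ - _); rewrite derive_sum; last by move=> i; exact: diff_derivable.
by apply: eq_bigr => i _; rewrite deriveM //; exact: diff_derivable.
Qed.

(** The exterior derivative of [du - \sum_i p_i dx_i = r g]. *)
Lemma contact_differential :
    (forall y, A y -> 'D_v u y - \sum_i p i y * 'D_v (x i) y = r y * gv y) ->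
    (forall y, A y -> 'D_w u y - \sum_i p i y * 'D_w (x i) y = r y * gw y) ->
    gv z = 0 -> gw z = 0 ->
  \sum_i ('D_v (p i) z * 'D_w (x i) z - 'D_w (p i) z * 'D_v (x i) z) =
  r z * ('D_w gv z - 'D_v gw z).
Proof.
move=> Ev Ew gv0 gw0.
have := derive_contact w dgv Ev; have := derive_contact v dgw Ew.
rewrite gv0 gw0 !mul0r !addr0 => e1 e2; rewrite mulrBr -e1 -e2.
rewrite (derive_swap Ao Az du) // opprD opprK addrACA subrr add0r -sumrN -big_split /=.
apply: eq_bigr => i _ /=.
have -> : 'D_w ('D_v (x i)) z = 'D_v ('D_w (x i)) z by apply: (derive_swap Ao Az (@dx i)).
by rewrite /=; ring.
Qed.

End ContactDifferential.

Section JetCoordinates.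
Variable R : realType.
Implicit Types (z w : jet1 R) (i : 'I_4).

Definition ju z : R := z.1.2.

Lemma differentiable_fst (V W : normedModType R) (y : V * W) :
  differentiable (fst : V * W -> V) y.
Proof. apply: (@linear_differentiable _ _ _ fst) => t; exact: cvg_fst. Qed.

Lemma differentiable_snd (V W : normedModType R) (y : V * W) :
  differentiable (snd : V * W -> W) y.
Proof. apply: (@linear_differentiable _ _ _ snd) => t; exact: cvg_snd. Qed.

Lemma differentiable_jx i z : differentiable (fun y : jet1 R => jx y 0 i) z.
Proof.
have d : differentiable (fun y : jet1 R => y.1.1) z.
  exact: (@differentiable_comp _ (jet1 R) ('rV[R]_4 * R^o)%type 'rV[R]_4 fst fst z
    (differentiable_fst z) (differentiable_fst z.1)).
exact: (differentiable_comp d (differentiable_coord _ 0 i)).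
Qed.

Lemma differentiable_jp i z : differentiable (fun y : jet1 R => jp y 0 i) z.
Proof.
exact: (@differentiable_comp _ (jet1 R) 'rV[R]_4 R snd _ z
  (differentiable_snd z) (differentiable_coord _ 0 i)).
Qed.

Lemma differentiable_ju z : differentiable (ju : jet1 R -> R) z.
Proof.
exact: (@differentiable_comp _ (jet1 R) ('rV[R]_4 * R^o)%type R fst snd z
    (differentiable_fst z) (differentiable_snd z.1)).
Qed.

Lemma derive_linear_comp (V W : normedModType R) (l : W -> R) (f : V -> W) (z w : V) :
    (forall y, differentiable l y) -> (forall t x y, l (t *: x + y) = t * l x + l y) ->
  differentiable f z -> 'D_w (l \o f) z = l ('D_w f z).
Proof.
move=> dl linl df.
have lE x y : 'D_x l y = l x.
  by apply: (@derive_quadratic _ _ _ _ _ _ 0) => t; rewrite linl; ring.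
rewrite deriveE; last exact: differentiable_comp.
by rewrite diff_comp // [LHS]/= -(deriveE w df) -deriveE.
Qed.
End JetCoordinates.

Section ContactMap.
Variables (R : realType) (U : set (jet1 R)) (phi : jet1 R -> jet1 R).
Hypotheses (Uo : open U) (sm : smooth_on U phi).
Hypothesis ct : forall z, U z -> exists2 rho : R, rho != 0 &
  forall w, contact_form (phi z) ('d phi z w) = rho * contact_form z w.

Local Notation fx i := (fun y => jx (phi y) 0 i).
Local Notation fp i := (fun y => jp (phi y) 0 i).
Local Notation fu := (fun y => ju (phi y)).
Local Notation eu := ((0, 1, 0) : jet1 R).

Let dphi y : U y -> differentiable phi y. Proof. exact: (sm [::]). Qed.
Let ddphi v y : U y -> differentiable ('D_v phi) y. Proof. exact: (sm [:: v]). Qed.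

Let linx i t (y1 y2 : jet1 R) : jx (t *: y1 + y2) 0 i = t * jx y1 0 i + jx y2 0 i.
Proof. by rewrite /jx /= mxDE mxZE. Qed.
Let linp i t (y1 y2 : jet1 R) : jp (t *: y1 + y2) 0 i = t * jp y1 0 i + jp y2 0 i.
Proof. by rewrite /jp /= mxDE mxZE. Qed.
Let linu t (y1 y2 : jet1 R) : ju (t *: y1 + y2) = t * ju y1 + ju y2.
Proof. by []. Qed.

Let component (l : jet1 R -> R) : (forall y, differentiable l y) ->
    (forall t x y, l (t *: x + y) = t * l x + l y) ->
  [/\ forall y, U y -> differentiable (fun y => l (phi y)) y,
      forall w y, U y -> 'D_w (fun y => l (phi y)) y = l ('d phi y w) &
      forall w y, U y -> differentiable ('D_w (fun y => l (phi y))) y].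
Proof.
move=> dl ll; have D w y : U y -> 'D_w (fun y => l (phi y)) y = l ('D_w phi y).
  by move=> Uy; exact: (derive_linear_comp _ dl ll (dphi Uy)).
split=> [y Uy|w y Uy|w y Uy].
- exact: (differentiable_comp (dphi Uy) (dl _)).
- by rewrite D // deriveE //; exact: dphi.
- apply: near_eq_differentiable (differentiable_comp (ddphi w Uy) (dl _)).
  by apply: (near_open Uo Uy) => t Ut; rewrite D.
Qed.

Let contactE (z w : jet1 R) : contact_form z w = ju w - \sum_i jp z 0 i * jx w 0 i.
Proof. by []. Qed.

Let derive_contact_form (v w z : jet1 R) : 'D_w (fun y => contact_form y v) z =
  - \sum_i jp w 0 i * jx v 0 i.
Proof.
apply: (@derive_quadratic _ _ _ _ _ _ 0) => t; rewrite mulr0 addr0 /contact_form.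
rewrite -addrA mulrN mulr_sumr -opprD -big_split; congr (_ - _); apply: eq_bigr => i _.
by rewrite linp /=; ring.
Qed.

Let differentiable_contact_form (v z : jet1 R) : differentiable (fun y => contact_form y v) z.
Proof.
have -> : (fun y => contact_form y v) =
    cst (ju v) - \sum_i (fun y : jet1 R => jp y 0 i) * cst (jx v 0 i).
  by apply/funext => y; rewrite /= contactE; congr (_ - _); rewrite fct_sumE.
apply: differentiableB; first exact: differentiable_cst.
by apply: differentiable_sum => i; apply: differentiableM;
  [exact: differentiable_jp|exact: differentiable_cst].
Qed.

(** The contact form takes the value 1 on [eu], so this is the conformal factor. Unlike the
    existential in the definition, the formula shows its differentiability in [z]. *)
Definition contact_factor z : R := contact_form (phi z) ('d phi z eu).

Lemma contact_factorP z : U z -> contact_factor z != 0 /\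
  forall w, contact_form (phi z) ('d phi z w) = contact_factor z * contact_form z w.
Proof.
move=> Uz; have [rho rho0 E] := ct Uz.
have -> : contact_factor z = rho.
  rewrite /contact_factor E contactE big1 ?subr0 ?mulr1 // => i _.
  by rewrite /jx /= [(0 : 'rV_4) _ _]mxE mulr0.
by [].
Qed.

(** The skew-symmetrised derivative of the contact condition. *)
Lemma contact_pullback z v w : U z -> contact_form z v = 0 -> contact_form z w = 0 ->
  let J := 'd phi z in
  \sum_i (jp (J v) 0 i * jx (J w) 0 i - jp (J w) 0 i * jx (J v) 0 i) =
  contact_factor z * \sum_i (jp v 0 i * jx w 0 i - jp w 0 i * jx v 0 i).
Proof.
move=> Uz v0 w0 J.
have X i := component (@differentiable_jx R i) (@linx i).
have P i := component (@differentiable_jp R i) (@linp i).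
have [u1 u2 u3] := component (@differentiable_ju R) linu.
have E w' y : U y -> 'D_w' fu y - \sum_i fp i y * 'D_w' (fx i) y =
    contact_factor y * contact_form y w'.
  move=> Uy; have [_ <-] := contact_factorP Uy; rewrite contactE u2 //.
  by congr (_ - _); apply: eq_bigr => i _; have [_ -> //] := X i.
have dr : differentiable contact_factor z.
  have d1 : differentiable ('D_eu fu - \sum_i (fp i) * 'D_eu (fx i)) z.
    apply: differentiableB; first exact: u3.
    apply: differentiable_sum => i; apply: differentiableM.
      by have [+ _ _] := P i; apply.
    by have [_ _] := X i; apply.
  apply: near_eq_differentiable d1; apply: (near_open Uo Uz) => y Uy.
  transitivity ('D_eu fu y - \sum_i fp i y * 'D_eu (fx i) y).
    by congr (_ - _); rewrite fct_sumE.
  rewrite E // contactE big1 ?subr0 ?mulr1 // => i _.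
  by rewrite /jx /= [(0 : 'rV_4) _ _]mxE mulr0.
have dX i y : U y -> differentiable (fx i) y by have [+ _ _] := X i; apply.
have dP i : differentiable (fp i) z by have [+ _ _] := P i; apply.
have ddX i v' : differentiable ('D_v' (fx i)) z by have [_ _] := X i; apply.
have := @contact_differential R _ U z v w fu (fun i => fx i) (fun i => fp i)
  contact_factor _ _ Uo Uz u1 dX dP (fun v => u3 v z Uz) ddX dr
  (differentiable_contact_form v z) (differentiable_contact_form w z) (E v) (E w) v0 w0.
rewrite !derive_contact_form => H.
transitivity (\sum_i ('D_v (fp i) z * 'D_w (fx i) z - 'D_w (fp i) z * 'D_v (fx i) z)).
  apply: eq_bigr => i _; have [_ Xi _] := X i; have [_ Pi _] := P i.
  by rewrite !Xi // !Pi.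
by rewrite H; congr (_ * _); rewrite opprK addrC sumrB.
Qed.

Section AtPoint.
Variables (z : jet1 R) (Uz : U z).

Definition base_vector i : jet1 R := (delta_mx 0 i, jp z 0 i, 0).
Definition fibre_vector i : jet1 R := (0, 0, delta_mx 0 i).

Local Notation J := ('d phi z).
Local Notation P := (\matrix_(i, j) jx (J (base_vector i)) 0 j).
Local Notation Q := (\matrix_(i, j) jp (J (base_vector i)) 0 j).
Local Notation S := (\matrix_(i, j) jx (J (fibre_vector i)) 0 j).
Local Notation T := (\matrix_(i, j) jp (J (fibre_vector i)) 0 j).

Let base_contact i : contact_form z (base_vector i) = 0.
Proof.
rewrite contactE /base_vector (bigD1 i) //= /jx /= mxE !eqxx mulr1 big1 ?addr0 ?subrr //.
by move=> k ki; rewrite mxE (negbTE ki) mulr0.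
Qed.

Let fibre_contact i : contact_form z (fibre_vector i) = 0.
Proof. by rewrite contactE big1 ?subrr // => k _; rewrite /jx /= mxE mulr0. Qed.

Let d0 (i k : 'I_4) : jx (base_vector i) 0 k = (i == k)%:R.
Proof. by rewrite /jx /= mxE eqxx eq_sym. Qed.
Let d1 (i k : 'I_4) : jp (base_vector i) 0 k = 0. Proof. by rewrite /jp /= mxE. Qed.
Let d2 (i k : 'I_4) : jx (fibre_vector i) 0 k = 0. Proof. by rewrite /jx /= mxE. Qed.
Let d3 (i k : 'I_4) : jp (fibre_vector i) 0 k = (i == k)%:R.
Proof. by rewrite /jp /= mxE eqxx eq_sym. Qed.

Let lin_sum (l : jet1 R -> R) (c c' : 'I_4 -> R) (w w' : 'I_4 -> jet1 R) :
    (forall t x y, l (t *: x + y) = t * l x + l y) ->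
  l (\sum_i c i *: w i + \sum_i c' i *: w' i) = \sum_i c i * l (w i) + \sum_i c' i * l (w' i).
Proof.
move=> ll; have l0 : l 0 = 0.
  have := ll 1 0 0; rewrite scaler0 addr0 mul1r => h.
  by apply: (addrI (l 0)); rewrite addr0; exact/esym.
have ls (e : 'I_4 -> R) y : l (\sum_i e i *: y i) = \sum_i e i * l (y i).
  by apply: (big_rec2 (fun x t => l x = t)) => // i t x _ lx; rewrite ll lx.
by rewrite -[X in l (X + _)]scale1r ll mul1r !ls.
Qed.

Let jet_eq (y1 y2 : jet1 R) : ju y1 = ju y2 -> (forall i, jx y1 0 i = jx y2 0 i) ->
  (forall i, jp y1 0 i = jp y2 0 i) -> y1 = y2.
Proof.
case: y1 y2 => [[x1 u1] p1] [[x2 u2] p2] /= ue xe pe.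
have -> : x1 = x2 by apply/rowP.
have -> : p1 = p2 by apply/rowP.
by move: ue; rewrite /ju /= => ->.
Qed.

(** The base and fibre vectors form a Darboux basis of the contact hyperplane at [z];
    [contact_pullback] on pairs of them gives the three relations. *)
Lemma contact_blocks : [/\ P *m Q^T = Q *m P^T, S *m T^T = T *m S^T &
  T *m P^T - S *m Q^T = (contact_factor z)%:M].
Proof.
have key (v w : 'I_4 -> jet1 R) (c : 'M[R]_4) :
    (forall i, contact_form z (v i) = 0) -> (forall i, contact_form z (w i) = 0) ->
    (forall i j, \sum_k (jp (v i) 0 k * jx (w j) 0 k - jp (w j) 0 k * jx (v i) 0 k) = c i j) ->
  (\matrix_(i, k) jp (J (v i)) 0 k) *m (\matrix_(i, k) jx (J (w i)) 0 k)^T -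
  (\matrix_(i, k) jx (J (v i)) 0 k) *m (\matrix_(i, k) jp (J (w i)) 0 k)^T =
  contact_factor z *: c.
  move=> v0 w0 cE; apply/matrixP => i j; rewrite mxZE -cE -contact_pullback //.
  rewrite mxDE mxNE [X in X - _]mxE [X in _ - X]mxE -sumrB; apply: eq_bigr => k _.
  by rewrite !mxE; congr (_ - _); rewrite mulrC.
split.
- have := key _ _ 0 base_contact base_contact _; rewrite scaler0 => e.
  apply/esym/eqP; rewrite -subr_eq0; apply/eqP/e => i j.
  by rewrite mxE big1 // => k _; rewrite !d1 !mul0r subrr.
- have := key _ _ 0 fibre_contact fibre_contact _; rewrite scaler0 => e.
  apply/esym/eqP; rewrite -subr_eq0; apply/eqP/e => i j.
  by rewrite mxE big1 // => k _; rewrite !d2 !mulr0 subrr.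
- rewrite -scalemx1; apply: key => // i j.
  rewrite (bigD1 j) // d0 d1 ?d2 d3 ?mul0r ?mulr0 subr0 eqxx mulr1 mxE big1; first by
    rewrite /= addr0.
  by move=> k kj; rewrite d0 d1 ?d2 [j == k]eq_sym (negbTE kj) !mulr0 subrr.
Qed.

(** The blocks give the x and p components of the image plane. The u component follows because the
    image of a contact vector is again annihilated by the contact form. *)
Lemma lagr_rel_prolongs H H' : lagr_rel P Q S T H H' -> prolongs_to phi z H H'.
Proof.
move=> [Zu ZH].
pose lift (v : 'rV[R]_4) (M : 'M[R]_4) y : jet1 R := (v, \sum_i jp y 0 i * v 0 i, v *m M).
have liftJ v : J (lift v H z) = lift (v *m (P + H *m S)) H' (phi z).
  have JE : J (lift v H z) = \sum_i (v 0 i *: J (base_vector i)) +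
      \sum_i ((v *m H) 0 i *: J (fibre_vector i)).
    have -> : lift v H z = \sum_i (v 0 i *: base_vector i) +
        \sum_i ((v *m H) 0 i *: fibre_vector i).
      apply: jet_eq => [|j|j].
      + rewrite (lin_sum _ _ _ _ linu) [X in _ = _ + X]big1 ?addr0; last by move=> i _;
        rewrite mulr0.
        by apply: eq_bigr => i _; rewrite mulrC.
      + rewrite (lin_sum _ _ _ _ (linx j)) [X in _ = _ + X]big1; last by move=> i _;
        rewrite d2 mulr0.
        rewrite addr0 (bigD1 j) //= d0 eqxx mulr1 big1 ?addr0 // => i ij.
        by rewrite d0 (negbTE ij) mulr0.
      + rewrite (lin_sum _ _ _ _ (linp j)) [X in _ = X + _]big1; last by move=> i _;
        rewrite d1 mulr0.
        rewrite add0r (bigD1 j) //= d3 eqxx mulr1 big1 ?addr0 // => i ij.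
        by rewrite d3 (negbTE ij) mulr0.
    by rewrite linearD !linear_sum /=; congr (_ + _); apply: eq_bigr => i _; rewrite linearZ.
  have Jx : jx (J (lift v H z)) = v *m (P + H *m S).
    apply/rowP => j; rewrite JE (lin_sum _ _ _ _ (linx j)) mulmxDr mxDE mulmxA.
    by congr (_ + _); rewrite [RHS]mxE; apply: eq_bigr => i _; rewrite [X in _ = _ * X]mxE.
  have Jp : jp (J (lift v H z)) = v *m (P + H *m S) *m H'.
    apply/rowP => j; rewrite JE (lin_sum _ _ _ _ (linp j)) -mulmxA ZH mulmxDr mxDE mulmxA.
    by congr (_ + _); rewrite [RHS]mxE; apply: eq_bigr => i _; rewrite [X in _ = _ * X]mxE.
  have [_ /(_ (lift v H z))] := contact_factorP Uz.
  rewrite [X in _ * X]contactE [ju _]/=.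
  rewrite [X in _ * (X - _)](_ : _ = \sum_i jp z 0 i * v 0 i) // subrr mulr0 contactE.
  move=> /eqP; rewrite subr_eq0 Jx => /eqP Ju.
  move: Jx Jp Ju; rewrite /jx /jp /ju; case: (J _) => [[jx' ju'] jp'] /= -> -> ->.
  by [].
apply/seteqP; split=> [_ [_ [v _ <-] <-]|_ [v _ <-]].
  by exists (v *m (P + H *m S)) => //; apply/esym; exact: liftJ.
exists (lift (v *m invmx (P + H *m S)) H z); first by exists (v *m invmx (P + H *m S)).
by rewrite [LHS]liftJ mulmxKV.
Qed.

End AtPoint.

End ContactMap.

Section NotContactEquivalent.
Variable R : realType.

(** [(a^2 + b^2 + c^2)^3 / (a b c)^2] is, up to a constant factor, the
    j-invariant of the cross-ratio [- a / b]. *)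
Definition invariant_defect (S : comNzRingType) (x : 'I_4 -> S) (al be ga : S) : S :=
  (c12 x ^+ 2 + c13 x ^+ 2 + c14 x ^+ 2) ^+ 3 * (al * be * ga) ^+ 2 -
  (c12 x * c13 x * c14 x) ^+ 2 * (al ^+ 2 + be ^+ 2 + ga ^+ 2) ^+ 3.

Lemma contact_equivalent_invariant (U : set (jet1 R)) phi (al be ga : R) z :
    al != 0 -> be != 0 -> ga != 0 -> al + be + ga = 0 ->
    contact_transformation U phi ->
    maps_equation U phi (@modified_heavenly R) (general_heavenly al be ga) -> U z ->
  invariant_defect (jx z 0) al be ga = 0.
Proof.
move=> al0 be0 ga0 abg [[Uo _ sm _] ct] maps Uz.
have [PQ ST TP] := contact_blocks Uo sm ct Uz.
have [rho0 _] := contact_factorP ct Uz.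
apply/eqP; rewrite subr_eq0; apply/eqP.
apply: (heavenly_invariant rho0 PQ ST TP (c_sum _) abg al0 be0 ga0) => H H' HT H'T rel.
have := maps z H H' Uz HT H'T (lagr_rel_prolongs ct Uz rel).
by rewrite modified_heavenlyE /general_heavenly !ixE.
Qed.

Lemma modified_heavenly_not_contact_equivalent (al be ga : R) :
    al != 0 -> be != 0 -> ga != 0 -> al + be + ga = 0 ->
  ~ contact_equivalent (@modified_heavenly R) (general_heavenly al be ga).
Proof.
move=> al0 be0 ga0 abg [U [phi [[z0 Uz0] ct maps]]].
have [[Uo _ _ _] _] := ct.
(* At [xb] the coefficient [c12] vanishes, so the invariant is infinite. *)
pose xb : 'rV[R]_4 := \row_i (nth 0 [:: 0; 0; 1; 2] i : R).
pose dz : jet1 R := (xb - jx z0, 0, 0).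
(* The base coordinates along the line from [z0] to [xb]. The defect vanishes at the parameters
   [e / n.+1], whose points lie in [U], hence identically and also at [xb], which may lie outside
   [U]. *)
pose xs (i : 'I_4) : {poly R} := (jx z0 0 i)%:P + 'X * (xb 0 i - jx z0 0 i)%:P.
pose f := invariant_defect xs al%:P be%:P ga%:P.
have fE t : f.[t] = invariant_defect (fun i => jx z0 0 i + t * (xb 0 i - jx z0 0 i)) al be ga.
  by rewrite /f /invariant_defect /c12 /c13 /c14 /xs !hornerE.
have [e e0 He] : exists2 e : R, 0 < e & forall t, 0 < t <= e -> U (z0 + t *: dz).
  have [/= e e0 eU] : nbhs_ball z0 U by apply/nbhs_ballP; exact: open_nbhs_nbhs.
  pose m := `|dz| + 1; have m0 : 0 < m by rewrite ltr_wpDl.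
  exists (e / (2 * m)); first by rewrite divr_gt0 ?mulr_gt0.
  move=> t /andP[t0 te]; apply: eU; rewrite -ball_normE /ball_ /= opprD addNKr normrN normrZ.
  rewrite gtr0_norm //; apply: (@le_lt_trans _ _ (e / (2 * m) * m)).
    by apply: ler_pM => //; [exact: ltW|rewrite lerDl].
  by rewrite invfM mulrA divfK ?gt_eqF // ltr_pdivrMr // ltr_pMr // ltr1n.
have f0 : f = 0.
  apply: (@poly_eq0_inj _ _ (fun n => e / n.+1%:R)) => [m n /= mn|n].
    by apply: natr_succ_inj; apply: invr_inj; exact: (mulfI (lt0r_neq0 e0)).
  rewrite fE; have Un : U (z0 + (e / n.+1%:R) *: dz).
    apply: He; rewrite divr_gt0 //=.
    by rewrite ler_pdivrMr // ler_peMr ?ler1n // ltW.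
  rewrite -[RHS](contact_equivalent_invariant al0 be0 ga0 abg ct maps Un).
  congr invariant_defect; apply/funext => i.
  by rewrite /jx /= mxDE mxZE mxDE mxNE.
have := fE 1; rewrite f0 horner0 /invariant_defect /c12 /c13 /c14 !mul1r ![_ + (_ - _)]addrC !subrK.
rewrite !mxE /=.
have -> : ((0 - 0) * (1 - 2)) = 0 :> R by rewrite subrr mul0r.
move=> /esym/eqP; apply/negP.
(* At [xb] the coefficients are 0, -2 and 2, so the sum of their squares is 8. *)
have -> : (0 ^+ 2 + ((1 - 0) * (0 - 2)) ^+ 2 + ((0 - 1) * (0 - 2)) ^+ 2) ^+ 3 * (al * be * ga) ^+ 2
  - (0 * ((1 - 0) * (0 - 2)) * ((0 - 1) * (0 - 2))) ^+ 2 * (al ^+ 2 + be ^+ 2 + ga ^+ 2)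
    ^+ 3 = 8 ^+ 3 * (al * be * ga) ^+ 2.
  ring.
by rewrite mulf_neq0 ?expf_neq0 ?mulf_neq0 // pnatr_eq0.
Qed.

End NotContactEquivalent.

Theorem mainTheorem4 (R : realType) :
  (forall (A : set 'rV[R]_4) (u : 'rV[R]_4 -> R),
      open A -> connected A ->
      solution (@modified_heavenly R) A u ->
      char_nondegenerate (@modified_heavenly R) A u ->
      half_flat (char_metric (@modified_heavenly R) u) A)
  /\
  (forall alpha beta gamma : R,
      alpha != 0 -> beta != 0 -> gamma != 0 -> alpha + beta + gamma = 0 ->
      ~ contact_equivalent (@modified_heavenly R)
                           (general_heavenly alpha beta gamma)).
Proof.
split; first exact: modified_heavenly_half_flat.
exact: modified_heavenly_not_contact_equivalent.
Qed.
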